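(* Consider the randomized play-the-winner urn with parameters $0<p_W,p_B<1$ and initial composition $W_0>0$, $B_0>0$, and suppose $\rho=p_W+p_B-1<1/2$. Let $q_W=1-p_W$, $q_B=1-p_B$, $v=q_B/(q_W+q_B)$ and $\sigma_1=\sqrt{q_Wq_B}/(q_W+q_B)$. Then $$\liminf_{n\to \infty}\sqrt{ \frac{\log \log n}{n}}\sup_{1\le m\le n}\big|Y_m-mv\big|= \liminf_{n\to \infty} \sqrt{ \frac{\log \log n}{n}}\sup_{1\le m\le n}\big|N_m-mv\big|= \frac{\sigma_1 \pi}{\sqrt{8}}\quad\text{a.s.}$$
   Context: Randomized play-the-winner urn: an urn contains white and black balls, starting with $W_0>0$ white balls and $B_0>0$ black balls. At each stage a ball is drawn uniformly at random from the urn and replaced. If the drawn ball is white, then one additional white ball is added with probability $p_W$, and one additional black ball with probability $q_W=1-p_W$. If the drawn ball is black, then one additional black ball is added with probability $p_B$, and one additional white ball with probability $q_B=1-p_B$ (given the color drawn, the color of the added ball is independent of the past). After $n$ stages, $Y_n$ is the number of white balls in the urn and $N_n$ is the number of times a white ball has been drawn. *)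

(* Defs.v *)
From HB Require Import structures.
From mathcomp Require Import all_boot all_order all_algebra.
From mathcomp Require Import all_classical all_reals all_analysis.

Set Implicit Arguments.
Unset Strict Implicit.
Unset Printing Implicit Defensive.

Import Order.TTheory GRing.Theory Num.Theory.

Local Open Scope classical_set_scope.
Local Open Scope ring_scope.

(* Colors are booleans: true is white, false is black. Stages are numbered
   from 0, so the first n stages are those of index k < n. *)

Definition white_count (a : nat -> bool) (n : nat) : nat :=
  (\sum_(k < n) a k)%N.

Section Urn.
Context d (T : measurableType d) (R : realType) (P : probability T R).
Variables (W0 B0 : nat) (pW pB : R).
(* [drawn k] and [added k] are the colors of the ball drawn from, resp. added
   to, the urn at stage k. *)
Variables drawn added : {RV P >-> bool}^nat.

Definition urn_history (n : nat) (x a : nat -> bool) : set T :=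
  [set w | forall k, (k < n)%N -> drawn k w = x k /\ added k w = a k].

(* The conditional laws given the past are stated as products,
   P (H `&` E) = p * P H for every elementary past event H, so that pasts of
   probability zero need no special treatment. The laws of the complementary
   events (drawing black, adding the color opposite to the one drawn) follow. *)
Record play_the_winner_urn : Prop := PlayTheWinnerUrn {
  urn_drawn_law : forall (n : nat) (x a : nat -> bool),
    P (urn_history n x a `&` [set w | drawn n w = true]) =
    (((W0 + white_count a n)%N%:R / (W0 + B0 + n)%N%:R)%:E
       * P (urn_history n x a))%E ;
  urn_added_law : forall (n : nat) (x a : nat -> bool) (c : bool),
    P (urn_history n x a `&` [set w | drawn n w = c]
         `&` [set w | added n w = c]) =
    ((if c then pW else pB)%:E
       * P (urn_history n x a `&` [set w | drawn n w = c]))%E }.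

Definition urn_Y (n : nat) (w : T) : nat :=
  (W0 + white_count (fun k => added k w) n)%N.

Definition urn_N (n : nat) (w : T) : nat :=
  white_count (fun k => drawn k w) n.

End Urn.

(* The terms being nonnegative, the default value 0 does not affect the
   maximum. *)
Definition sup_dev (R : realType) (u : nat -> nat) (v : R) (n : nat) : R :=
  \big[Num.max/0]_(1 <= m < n.+1) `|(u m)%:R - m%:R * v|.

(* Main.v *)
Require Import Defs.
From HB Require Import structures.
From mathcomp Require Import all_boot all_order all_algebra.
From mathcomp Require Import all_classical all_reals all_analysis.
From mathcomp Require Import ring lra.

Set Implicit Arguments.
Unset Strict Implicit.
Unset Printing Implicit Defensive.

Import Order.TTheory GRing.Theory Num.Theory.
Import numFieldNormedType.Exports.

Local Open Scope classical_set_scope.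
Local Open Scope ring_scope.

(** Put [s n = sqrt (ln (ln n) / n)] and let [D] be the centred count [Y - m v] or
    [N - m v]. Everything is deduced from sub- and supersolutions of the one-step
    recursion of the urn, without any approximation by Brownian motion.

    For [D = Y - m v], on the strip [|D| <= c / s n] the function [cos (theta D)] with
    [theta] slightly below [pi s n / (2 c)] decreases on average by the factor
    [1 - theta^2 sigma_1^2 / 2] per step, so [D] stays in the strip up to time [n] with
    probability at most about [(ln n)^(- (pi sigma_1)^2 / (8 c^2))]. For [D = N - m v],
    whose drift is not negligible, the cosine carries in addition a Girsanov factor built
    on the martingale [M] that compares the added balls with the drawn ones. When [c] is
    below the critical value, this is summable along geometric times.

    Conversely [cos y + kappa (1 + cos (2 y))], cut off at [|y| = pi / 2], is a subsolution
    for every drift that is small compared with [kappa theta]. It bounds the confinement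
    probability from below, given the past up to time [m], as soon as the state at time [m]
    is small. Along [n_k = (k!)^A] this is eventually the case, by a quadratic Lyapunov
    function which grows linearly because [rho < 1 / 2]. For supercritical [c] the
    conditional probabilities are at least [1 / k], which is not summable, so confinement
    occurs infinitely often. *)

(** * Taylor bounds and one-step estimates *)

(** The exponent is 1 at the critical width, and the choice of times must make this visible. Along
    geometric times [ln n] is of order [k], so the subcritical probabilities are below a multiple of
    [k ^ (- (1 + dl))]. For the converse the times must grow fast enough for the urn to forget its
    state, yet slowly enough for [ln (ln n_k)] to stay below [(1 + e) * ln k] up to a constant;
    [exp (k ^ 2)] would already double the exponent. Factorial powers meet both demands, since the
    ratio of successive times is a power of [k].

    Inside the strip the drift of [Y] is of order [1 / (s * n)]. Against a cosine of frequency of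
    order [s] it costs [1 / n] per step, a bounded factor in all. The drift of [N] also contains
    [M / balls], possibly of order [s], which would cost [s ^ 2] per step, as much as the main term.
    Hence the Girsanov factor in the upper bound and, in the lower bound, a second strip that
    confines [M].

    Successive blocks are not independent; the bounds given the past are therefore uniform over all
    pasts that end in a small state. *)

Section Calculus.
Variable R : realType.
Implicit Types x y t s : R.

Lemma le_at0_of_derive_ge0 (f df : R -> R) x :
  (forall z : R, is_derive z (1 : R) f (df z)) -> (forall z, 0 <= z -> 0 <= df z) ->
  0 <= x -> f 0 <= f x.
Proof.
move=> fdf df_ge0 x_ge0.
have fc : {within `[0, x], continuous f}.
  apply: continuous_subspaceT => z.
  by apply: differentiable_continuous; apply/derivable1_diffP; case: (fdf z).
have [c /[!in_itv]/= /andP[c_ge0 _] fE] :=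
  MVT_segment x_ge0 (fun z _ => fdf z) fc.
by rewrite -subr_ge0 fE subr0 mulr_ge0// df_ge0.
Qed.

Lemma sin_le_id x : 0 <= x -> sin x <= x.
Proof.
move=> x0; have := @le_at0_of_derive_ge0 (fun z => z - sin z) (fun z => 1 - cos z) x.
rewrite sin0 !subr0 subr_ge0; exact.
Qed.

(** The bounds for [sin] and [cos] climb one degree at a time: the preceding bound is the sign of
    the derivative. *)
Lemma cos_ge_quadratic x : 1 - x ^+ 2 / 2 <= cos x.
Proof.
wlog x0 : x / 0 <= x => [hw|].
  have [|/ltW x0] := leP 0 x; first exact: hw.
  by rewrite -(cosN x) -(sqrrN x); apply: hw; rewrite oppr_ge0.
have := @le_at0_of_derive_ge0 (fun z => cos z - 1 + z ^+ 2 / 2)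
  (fun z => - sin z + z) x.
rewrite cos0 expr0n/= mul0r addr0 subrr => H.
have : 0 <= cos x - 1 + x ^+ 2 / 2.
  apply: H => // z.
    by apply: is_derive_eq; rewrite /GRing.scale/=; field.
  by move=> z0; have := sin_le_id z0; lra.
lra.
Qed.

Lemma sin_ge_cubic x : 0 <= x -> x - x ^+ 3 / 6 <= sin x.
Proof.
move=> x0; have := @le_at0_of_derive_ge0 (fun z => sin z - z + z ^+ 3 / 6)
  (fun z => cos z - 1 + z ^+ 2 / 2) x.
rewrite sin0 expr0n/= mul0r addr0 subrr => H.
have : 0 <= sin x - x + x ^+ 3 / 6.
  apply: H => // z.
    by apply: is_derive_eq; rewrite /GRing.scale/=; field.
  by move=> _; have := cos_ge_quadratic z; lra.
lra.
Qed.

Lemma cos_le_quartic x : cos x <= 1 - x ^+ 2 / 2 + x ^+ 4 / 24.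
Proof.
wlog x0 : x / 0 <= x => [hw|].
  have [|/ltW x0] := leP 0 x; first exact: hw.
  have -> : x ^+ 4 = (- x) ^+ 4 by ring.
  by rewrite -(cosN x) -(sqrrN x); apply: hw; rewrite oppr_ge0.
have := @le_at0_of_derive_ge0 (fun z => 1 - z ^+ 2 / 2 + z ^+ 4 / 24 - cos z)
  (fun z => sin z - z + z ^+ 3 / 6) x.
rewrite cos0 !expr0n/= !mul0r addr0 subr0 subrr => H.
have : 0 <= 1 - x ^+ 2 / 2 + x ^+ 4 / 24 - cos x.
  apply: H => // z.
    by apply: is_derive_eq; rewrite /GRing.scale/=; field.
  by move=> z0; have := sin_ge_cubic z0; lra.
lra.
Qed.

Lemma normr_le1_pow3 x : `|x| <= 1 -> x ^+ 4 <= `|x| ^+ 3.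
Proof.
move=> x1; have -> : x ^+ 4 = `|x| ^+ 4 by rewrite -normrX ger0_norm// exprn_even_ge0.
by rewrite exprSr ler_piMr// exprn_ge0.
Qed.

Lemma cos_taylor2 x : `|x| <= 1 -> `|cos x - 1 + x ^+ 2 / 2| <= `|x| ^+ 3.
Proof.
move=> /normr_le1_pow3; have := cos_le_quartic x; have := cos_ge_quadratic x.
have : 0 <= x ^+ 4 by apply: exprn_even_ge0.
by rewrite ler_norml => ? ? ? ?; apply/andP; split; lra.
Qed.

Lemma sin_taylor1 x : `|sin x - x| <= `|x| ^+ 3.
Proof.
wlog x0 : x / 0 <= x => [hw|].
  have [|/ltW x0] := leP 0 x; first exact: hw.
  have := hw (- x); rewrite oppr_ge0 sinN (_ : - sin x - - x = - (sin x - x)); last by ring.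
  by rewrite !normrN; apply.
have := sin_le_id x0; have := sin_ge_cubic x0; have : 0 <= x ^+ 3 by apply: exprn_ge0.
by rewrite ler_norml (ger0_norm x0) => ? ? ?; apply/andP; split; lra.
Qed.

Lemma expRN_le_quadratic x : 0 <= x -> expR (- x) <= 1 - x + x ^+ 2 / 2.
Proof.
move=> x0; have := @le_at0_of_derive_ge0 (fun z => 1 - z + z ^+ 2 / 2 - expR (- z))
  (fun z => expR (- z) - 1 + z) x.
rewrite oppr0 expR0 expr0n/= mul0r !addr0 subrr => H.
have : 0 <= 1 - x + x ^+ 2 / 2 - expR (- x).
  apply: H => // z.
    by apply: is_derive_eq; rewrite /GRing.scale/=; field.
  by have := expR_ge1Dx (- z); lra.
lra.
Qed.

Lemma expR_le_cubic x : `|x| <= 1 -> expR x <= 1 + x + x ^+ 2 / 2 + `|x| ^+ 3.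
Proof.
have [x0 x1|x0 _] := leP 0 x; last first.
  have := @expRN_le_quadratic (- x); rewrite opprK.
  have : 0 <= `|x| ^+ 3 by apply: exprn_ge0.
  lra.
have := @le_at0_of_derive_ge0 (fun z => expR (- z) - 1 + z - z ^+ 2 / 2 + z ^+ 3 / 6)
  (fun z => - expR (- z) + 1 - z + z ^+ 2 / 2) x.
rewrite oppr0 expR0 !expr0n/= !mul0r oppr0 !addr0 subrr => H.
have {H} : 0 <= expR (- x) - 1 + x - x ^+ 2 / 2 + x ^+ 3 / 6.
  apply: H => // z.
    by apply: is_derive_eq; rewrite /GRing.scale/=; field.
  by move=> z0; have := expRN_le_quadratic z0; lra.
move: x1; rewrite ger0_norm// => x1 H.
(* As [p <= expR (- x)], it suffices that [p] times the right-hand side be at least 1. On the unit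
   interval this product is 1 plus [x ^+ 3] times a non-negative polynomial. *)
set p := 1 - x + x ^+ 2 / 2 - x ^+ 3 / 6.
have p_le : p <= expR (- x) by rewrite /p; lra.
have q0 : 0 < 1 + x + x ^+ 2 / 2 + x ^+ 3.
  by have := exprn_ge0 2 x0; have := exprn_ge0 3 x0; lra.
rewrite -[expR x]mulr1 -ler_pdivlMl ?expR_gt0// -expRN.
rewrite -ler_pdivrMr// mul1r -[_^-1]mulr1 ler_pdivrMl//.
apply: (le_trans _ (ler_wpM2l (ltW q0) p_le)); rewrite /p.
have x3 := exprn_ge0 3 x0.
have -> : (1 + x + x ^+ 2 / 2 + x ^+ 3) * (1 - x + x ^+ 2 / 2 - x ^+ 3 / 6) =
  1 + x ^+ 3 * (5 / 6 - 11 / 12 * x + 5 / 12 * x ^+ 2 - 1 / 6 * x ^+ 3) by field.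
rewrite lerDl mulr_ge0//.
have xx : 0 <= x ^+ 2 - x ^+ 3 by rewrite subr_ge0 exprSr ler_piMr ?exprn_ge0.
have : 0 <= (1 - x) ^+ 2 by apply: sqr_ge0.
rewrite sqrrB; nra.
Qed.

Lemma expR_le_quadratic x : `|x| <= 2^-1 -> expR x <= 1 + x + x ^+ 2.
Proof.
move=> x2; have := @expR_le_cubic x.
have : `|x| ^+ 3 <= x ^+ 2 / 2.
  rewrite exprSr -normrX [X in X * _]ger0_norm ?sqr_ge0// ler_wpM2l ?sqr_ge0//.
have : `|x| <= 1 by lra.
lra.
Qed.

End Calculus.

(** * One-step estimates for walks with Bernoulli increments *)

Section Bernoulli.
Variable R : realType.
Implicit Types x y t s p v theta gamma kappa : R.

Lemma normrM_le a b x y : `|a| <= x -> `|b| <= y -> `|a * b| <= x * y :> R.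
Proof. by move=> ax ay; rewrite normrM ler_pM. Qed.

Lemma cosD_taylor2 y t : `|t| <= 1 ->
  `|cos (y + t) - (cos y - t * sin y - t ^+ 2 / 2 * cos y)| <= 2 * `|t| ^+ 3.
Proof.
move=> t1; rewrite cosD.
have -> : cos y * cos t - sin y * sin t - (cos y - t * sin y - t ^+ 2 / 2 * cos y) =
  cos y * (cos t - 1 + t ^+ 2 / 2) - sin y * (sin t - t) by ring.
apply: (le_trans (ler_normB _ _)).
have := normrM_le (cos_max y) (cos_taylor2 t1).
have := normrM_le (sin_max y) (sin_taylor1 t).
lra.
Qed.

(** The sign of the cosine after the step matters because the exponential is expanded from above
    only, and this upper bound is multiplied by the cosine. *)
Lemma cos_expR_taylor y theta gamma s x :
  `|x| <= 1 -> `|theta| <= s -> `|gamma| <= s -> s <= 1 ->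
  0 <= cos (y + theta * x) ->
  cos (y + theta * x) * expR (- (gamma * x)) <=
  cos y * (1 - gamma * x + (gamma ^+ 2 - theta ^+ 2) / 2 * x ^+ 2)
  + sin y * (- theta * x + theta * gamma * x ^+ 2) + 8 * s ^+ 3.
Proof.
move=> x1 ths gas s1 cos_ge0.
have s0 : 0 <= s by apply: le_trans ths.
have ts : `|theta * x| <= s by rewrite -[s]mulr1 normrM_le.
have gs : `|gamma * x| <= s by rewrite -[s]mulr1 normrM_le.
set t := theta * x in cos_ge0 ts *; set g := gamma * x in gs *.
have t1 : `|t| <= 1 by apply: le_trans s1.
have g1 : `|- g| <= 1 by rewrite normrN; apply: le_trans s1.
have cubeg : `|- g| ^+ 3 <= s ^+ 3 by rewrite normrN lerXn2r// nnegrE.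
have cubet : `|t| ^+ 3 <= s ^+ 3 by rewrite lerXn2r// nnegrE.
have s30 : 0 <= s ^+ 3 by apply: exprn_ge0.
have expg := expR_le_cubic g1.
have cost := cosD_taylor2 y t1.
set r := cos (y + t) - _ in cost.
have rs : `|r| <= 2 * s ^+ 3 by lra.
have e1 : `|1 - g + g ^+ 2 / 2| <= 5 / 2.
  have g2 := normrM_le gs gs.
  move: gs g2; rewrite !ler_norml => /andP[? ?] /andP[? ?].
  have : s * s <= 1 by rewrite mulr_ile1.
  by rewrite expr2 => ?; apply/andP; split; lra.
apply: (@le_trans _ _ (cos (y + t) * (1 - g + g ^+ 2 / 2) + s ^+ 3)).
  apply: (le_trans (ler_wpM2l cos_ge0 expg)).
  have -> : cos (y + t) * (1 - g + (- g) ^+ 2 / 2 + `|- g| ^+ 3) =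
    cos (y + t) * (1 - g + g ^+ 2 / 2) + cos (y + t) * `|- g| ^+ 3 by ring.
  rewrite lerD2l; apply: le_trans cubeg; rewrite ler_piMl ?exprn_ge0//.
have -> : cos (y + t) = r + (cos y - t * sin y - t ^+ 2 / 2 * cos y) by rewrite /r; ring.
have /ler_normlP[_ h1] := normrM_le rs e1.
have n2 : `|2^-1 : R| <= 2^-1 by rewrite ger0_norm.
have n4 : `|4^-1 : R| <= 4^-1 by rewrite ger0_norm.
have gs1 : `|g| <= 1 by rewrite -normrN.
have /ler_normlP[h2' h2] : `|cos y * (t * t * g / 2)| <= 1 * (s * s * s / 2).
  by rewrite !normrM_le ?cos_max.
have /ler_normlP[h3' h3] : `|cos y * (t * t * g * g / 4)| <= 1 * (s * s * s * 1 / 4).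
  by rewrite !normrM_le ?cos_max.
have /ler_normlP[h4' h4] : `|sin y * (t * g * g / 2)| <= 1 * (s * s * s / 2).
  by rewrite !normrM_le ?sin_max.
have -> : cos y * (1 - g + (gamma ^+ 2 - theta ^+ 2) / 2 * x ^+ 2)
  + sin y * (- theta * x + theta * gamma * x ^+ 2) =
  cos y * (1 - g + (g ^+ 2 - t ^+ 2) / 2) + sin y * (- t + t * g).
  by rewrite /t /g; field.
have sss : s * s * s = s ^+ 3 by ring.
rewrite sss in h2 h2' h3 h3' h4 h4'.
have -> : (r + (cos y - t * sin y - t ^+ 2 / 2 * cos y)) * (1 - g + g ^+ 2 / 2) =
  r * (1 - g + g ^+ 2 / 2) + (cos y * (1 - g + (g ^+ 2 - t ^+ 2) / 2) + sin y * (- t + t * g))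
  + cos y * (t * t * g / 2) - cos y * (t * t * g * g / 4) - sin y * (t * g * g / 2).
  by field.
lra.
Qed.

(* One step of a walk with Bernoulli(p) - v increments, seen through
   [cos (theta x) * exp (- gamma x)]. The factor [exp] absorbs the drift p - v up to
   the error [p - v - gamma * v * (1 - v)]. *)
Lemma cos_expR_step y theta gamma s p v :
  `|theta| <= s -> `|gamma| <= s -> s <= 1 -> 0 <= p <= 1 -> 0 <= v <= 1 ->
  `|p - v| <= s ->
  0 <= cos y -> 0 <= cos (y + theta * (1 - v)) -> 0 <= cos (y + theta * (0 - v)) ->
  p * (cos (y + theta * (1 - v)) * expR (- (gamma * (1 - v))))
  + (1 - p) * (cos (y + theta * (0 - v)) * expR (- (gamma * (0 - v)))) <=
  cos y * (1 - theta ^+ 2 * (v * (1 - v)) / 2)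
  + 2 * s * `|p - v - gamma * (v * (1 - v))| + 10 * s ^+ 3.
Proof.
move=> ths gas s1 /andP[p0 p1] /andP[v0 v1] bs cosy c1 c2.
have s0 : 0 <= s by apply: le_trans ths.
have h1 : `|1 - v| <= 1 by rewrite ger0_norm; lra.
have h2 : `|0 - v| <= 1 by rewrite sub0r normrN ger0_norm; lra.
have {h1} := ler_wpM2l p0 (cos_expR_taylor h1 ths gas s1 c1).
have q0 : 0 <= 1 - p by lra.
have {h2} := ler_wpM2l q0 (cos_expR_taylor h2 ths gas s1 c2).
set X1 := cos (y + _) * _; set X2 := cos (y + _) * _ => H2 H1.
apply: (le_trans (lerD H1 H2)).
(* After inserting [p - v = gamma * (v * (1 - v)) + e], the terms in [sin y] cancel up to [e] and
   third order. Those in [gamma ^+ 2] leave [- gamma ^+ 2 * (v * (1 - v)) / 2 * cos y], which has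
   the favourable sign and is dropped ([f5]). *)
set e := p - v - _.
have s30 : 0 <= s ^+ 3 by apply: exprn_ge0.
have /ler_normlP[f1 _] : `|gamma * (e * cos y)| <= s * (`|e| * 1).
  by rewrite !normrM_le// cos_max.
have /ler_normlP[f2 _] : `|theta * (e * sin y)| <= s * (`|e| * 1).
  by rewrite !normrM_le// sin_max.
have v2 : `|1 - 2 * v| <= 1 by rewrite ler_norml; apply/andP; split; lra.
have ths2 := normrM_le ths ths; have gas2 := normrM_le gas gas.
have /ler_normlP[_ f3] : `|(gamma * gamma - theta * theta) / 2 * ((p - v) * (1 - 2 * v)) * cos y| <= (s * s) * (s * 1) * 1.
  apply: normrM_le (cos_max y); apply: normrM_le; last exact: normrM_le.
  by move: ths2 gas2; rewrite !ler_norml => /andP[? ?] /andP[? ?]; apply/andP; split; lra.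
have /ler_normlP[_ f4] : `|theta * gamma * ((p - v) * (1 - 2 * v)) * sin y| <= (s * s) * (s * 1) * 1.
  by rewrite !normrM_le// sin_max.
have sss : s * s * (s * 1) * 1 = s ^+ 3 by ring.
rewrite sss in f3 f4.
have f5 : 0 <= gamma ^+ 2 * (v * (1 - v)) / 2 * cos y.
  have sig0 : 0 <= v * (1 - v) by rewrite mulr_ge0//; lra.
  exact: mulr_ge0 (divr_ge0 (mulr_ge0 (sqr_ge0 _) sig0) (ler0n _ 2)) cosy.
rewrite -subr_ge0 [X in 0 <= X](_ : _ =
  (2 * s * `|e| + gamma * (e * cos y) + theta * (e * sin y))
  + (2 * s ^+ 3 - (gamma * gamma - theta * theta) / 2 * ((p - v) * (1 - 2 * v)) * cos y
    - theta * gamma * ((p - v) * (1 - 2 * v)) * sin y)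
  + gamma ^+ 2 * (v * (1 - v)) / 2 * cos y); first lra.
by rewrite /e; field.
Qed.

(** The correction is [2 * kappa * cos y ^+ 2]. It vanishes to second order at the ends of the strip
    and has second derivative [4 * kappa] there, where that of the cosine is 0. *)
Definition cos_bump kappa y : R :=
  if `|y| < pi / 2 then cos y + kappa * (1 + cos (2 * y)) else 0.

Lemma cos2M y : cos (2 * y) = 2 * cos y ^+ 2 - 1 :> R.
Proof. by rewrite mulr_natl cos_mulr2n mulr_natl. Qed.

Lemma sin2M y : sin (2 * y) = 2 * (cos y * sin y) :> R.
Proof. by rewrite mulr_natl sin_mulr2n mulr_natl. Qed.

Lemma cos_gt0_norm y : `|y| < pi / 2 -> 0 < cos y.
Proof. by rewrite ltr_norml; exact: cos_gt0_pihalf. Qed.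

Lemma cos_bump_ge0 kappa y : 0 <= kappa -> 0 <= cos_bump kappa y.
Proof.
move=> k0; rewrite /cos_bump; case: ifPn => // /cos_gt0_norm c0.
rewrite cos2M addr_ge0 ?(ltW c0)// mulr_ge0//; have := sqr_ge0 (cos y); lra.
Qed.

Lemma cos_bump_le kappa y : 0 <= kappa -> cos_bump kappa y <= 1 + 2 * kappa.
Proof.
move=> k0; rewrite /cos_bump; case: ifPn => _; last lra.
rewrite lerD ?cos_le1// mulrC ler_wpM2r//.
by have := cos_le1 (2 * y); lra.
Qed.

Lemma cos_bump_ge_half kappa y : 0 <= kappa -> `|y| <= pi / 4 -> 2^-1 <= cos_bump kappa y.
Proof.
move=> k0 y4; have p0 := pi_gt0 R; rewrite /cos_bump ifT; last lra.
have c0 : 0 <= cos (2 * y).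
  by apply: cos_ge0_pihalf; move: y4; rewrite ler_norml => /andP[? ?]; apply/andP; split; lra.
have c1 : 0 < cos y by apply: cos_gt0_norm; lra.
have : 2^-1 <= cos y.
  have := c0; rewrite cos2M => h; rewrite -(@ler_pXn2r _ 2)// ?nnegrE//; first lra.
  exact: ltW.
by have := mulr_ge0 k0 (_ : 0 <= 1 + cos (2 * y)); rewrite addr_ge0// => /(_ isT); lra.
Qed.

(** One step may overshoot the strip by at most [theta]. There the uncut formula equals
    [- sin w * (1 - 2 * kappa * sin w)] with [w] the overshoot, hence is at most 0; so Taylor bounds
    for the smooth formula remain lower bounds for the cut-off function. *)
Lemma cos_bump_ge_formula kappa theta y : 0 <= kappa -> 2 * kappa * theta <= 1 ->
  theta <= 1 -> `|y| <= pi / 2 + theta ->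
  cos y + kappa * (1 + cos (2 * y)) <= cos_bump kappa y.
Proof.
move=> k0 kt t1 yt; rewrite /cos_bump; case: ltP => // y2.
have -> : cos y = cos `|y| by rewrite cos_norm.
have -> : cos (2 * y) = cos (2 * `|y|) by rewrite !cos2M cos_norm.
rewrite cos2M -[`|y|](subrK (pi / 2)) cosDpihalf.
set w := _ - _; have w0 : 0 <= w by rewrite /w; lra.
have wt : w <= theta by rewrite /w; lra.
have sw := sin_le_id w0.
have sw0 : 0 <= sin w.
  by apply: sin_ge0_pi; have := pi_ge2 R; rewrite w0 /=; lra.
rewrite (_ : - _ + _ = - (sin w * (1 - 2 * kappa * sin w))); last by ring.
rewrite oppr_le0 mulr_ge0// subr_ge0; apply: le_trans kt.
by rewrite ler_wpM2l ?mulr_ge0//; lra.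
Qed.

(* The slack [kappa] in the curvature of [cos_bump] near its zeros pays for drifts
   of order [kappa * theta], whatever their sign. *)
Lemma cos_bump_step kappa theta p v y :
  0 < kappa -> 0 < theta -> 2 * theta <= 1 -> 2 * kappa * theta <= 1 ->
  (2 + 17 * kappa + 4 * kappa ^+ 2) * theta <= kappa * (v * (1 - v)) ->
  0 <= p <= 1 -> 0 <= v <= 1 -> `|p - v| <= kappa * (v * (1 - v)) * theta ->
  (1 - v * (1 - v) * (2^-1 + 4 * kappa + 4 * kappa ^+ 2) * theta ^+ 2) * cos_bump kappa y <=
  p * cos_bump kappa (y + theta * (1 - v)) + (1 - p) * cos_bump kappa (y + theta * (0 - v)).
Proof.
move=> k0 th0 th1 kth Cth /andP[p0 p1] /andP[v0 v1] bk.
have q0 : 0 <= 1 - p by lra.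
have [y2|y2] := ltP `|y| (pi / 2); last first.
  rewrite [X in _ * X]/cos_bump ltNge y2/= mulr0.
  by rewrite addr_ge0// mulr_ge0// cos_bump_ge0// ltW.
have c0 := cos_gt0_norm y2.
have key x : `|x| <= 1 ->
  cos y + kappa * (1 + cos (2 * y))
  - theta * x * (sin y + 2 * kappa * sin (2 * y))
  - (theta * x) ^+ 2 / 2 * (cos y + 4 * kappa * cos (2 * y))
  - (2 + 16 * kappa) * theta ^+ 3 <= cos_bump kappa (y + theta * x).
  move=> x1; have tx : `|theta * x| <= theta * 1 by rewrite normrM_le// ger0_norm// ltW.
  have tx1 : `|theta * x| <= 1 by lra.
  have tx2 : `|2 * (theta * x)| <= 1 by rewrite normrM ger0_norm; lra.
  have t3 : `|theta * x| ^+ 3 <= theta ^+ 3.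
    by rewrite lerXn2r// ?nnegrE; lra.
  have /ler_normlP[A1 _] := cosD_taylor2 y tx1.
  have /ler_normlP[A2 _] := cosD_taylor2 (2 * y) tx2.
  set u := theta * x in tx tx1 tx2 t3 A1 A2 *.
  have yu : `|y + u| <= pi / 2 + theta by apply: (le_trans (ler_normD _ _)); lra.
  apply: le_trans (@cos_bump_ge_formula kappa theta (y + u) (ltW k0) kth _ yu); last by lra.
  rewrite [2 * (y + u)]mulrDr.
  have A3 := ler_wpM2l (ltW k0) A2.
  have e2 : `|2 * u| ^+ 3 = 8 * `|u| ^+ 3 by rewrite normrM exprMn ger0_norm//; ring.
  rewrite e2 in A3.
  have := ler_wpM2l (ltW k0) t3.
  lra.
have h1 : `|1 - v| <= 1 by rewrite ger0_norm; lra.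
have h2 : `|0 - v| <= 1 by rewrite sub0r normrN ger0_norm; lra.
have := lerD (ler_wpM2l p0 (key _ h1)) (ler_wpM2l q0 (key _ h2)).
apply: le_trans; rewrite /cos_bump y2.
rewrite sin2M cos2M.
set c := cos y in c0 *; set sg := sin y.
have c1 : c <= 1 by apply: cos_le1.
set sig := v * (1 - v) in Cth bk *.
have sig0 : 0 <= sig by rewrite mulr_ge0//; lra.
have sig1 : sig <= 1 by rewrite /sig; nra.
have v2 : `|1 - 2 * v| <= 1 by rewrite ler_norml; apply/andP; split; lra.
set b := p - v in bk *.
have bk' : `|b| <= kappa * 1 * theta.
  by apply: (le_trans bk); rewrite ler_pM2r// ler_pM2l.
have G1 : `|sg + 4 * kappa * (sg * c)| <= 1 + 4 * kappa * c.
  have -> : sg + 4 * kappa * (sg * c) = sg * (1 + 4 * kappa * c) by ring.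
  rewrite normrM [X in _ * X]ger0_norm; last by rewrite addr_ge0// !mulr_ge0// ?(ltW c0)// ltW.
  by rewrite ler_piMl ?sin_max// addr_ge0// !mulr_ge0// ?(ltW c0)// ltW.
have c2 : c ^+ 2 <= c by rewrite expr2 ler_piMr// ltW.
have c20 : 0 <= c ^+ 2 by apply: sqr_ge0.
have G2 : `|c + 4 * kappa * (2 * c ^+ 2 - 1)| <= 1 + 4 * kappa.
  rewrite ler_norml; apply/andP; split.
    have : 0 <= 4 * kappa * (2 * c ^+ 2) by rewrite !mulr_ge0// ltW.
    lra.
  have : 4 * kappa * (2 * c ^+ 2 - 1) <= 4 * kappa * 1 by apply: ler_wpM2l; lra.
  lra.
have /ler_normlP[_ E1] := normrM_le bk G1.
have /ler_normlP[_ E2] := normrM_le (normrM_le bk' v2) G2.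
have E1' := ler_wpM2l (ltW th0) E1.
have t20 : 0 <= theta ^+ 2 by apply: sqr_ge0.
have E2' := ler_wpM2l t20 E2.
have Cth' := ler_wpM2l t20 Cth.
have k2c : 0 <= theta ^+ 2 * (sig * (kappa * (c - c ^+ 2))).
  by apply: (mulr_ge0 t20 (mulr_ge0 sig0 (mulr_ge0 (ltW k0) _))); lra.
have k2c2 : 0 <= theta ^+ 2 * (sig * (kappa ^+ 2 * c ^+ 2)).
  exact: mulr_ge0 t20 (mulr_ge0 sig0 (mulr_ge0 (sqr_ge0 _) c20)).
have k2c3 : 0 <= theta ^+ 2 * (sig * (kappa ^+ 3 * c ^+ 2)).
  exact: mulr_ge0 t20 (mulr_ge0 sig0 (mulr_ge0 (exprn_ge0 _ (ltW k0)) c20)).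
have k2c4 : 0 <= theta ^+ 2 * (sig * (kappa * c ^+ 2)).
  exact: mulr_ge0 t20 (mulr_ge0 sig0 (mulr_ge0 (ltW k0) c20)).
rewrite -subr_ge0.
(* The curvature of the correction yields [2 * kappa * sig * theta ^+ 2] whatever [c] is. One half
   pays for the part of the drift that does not vanish with [c], the other, through [Cth], for the
   cubic errors. The terms that vanish with [c] are covered by the excess of the rate over
   [2^-1]. *)
set Y := (X in 0 <= X).
have -> : Y =
   (theta * (kappa * sig * theta * (1 + 4 * kappa * c)) - theta * (b * (sg + 4 * kappa * (sg * c))))
 + (theta ^+ 2 * (kappa * 1 * theta * 1 * (1 + 4 * kappa)) - theta ^+ 2 * (b * (1 - 2 * v) * (c + 4 * kappa * (2 * c ^+ 2 - 1)))) / 2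
 + (theta ^+ 2 * (kappa * sig) - theta ^+ 2 * ((2 + 17 * kappa + 4 * kappa ^+ 2) * theta))
 + theta ^+ 3 * (kappa / 2 + 2 * kappa ^+ 2)
 + 4 * (theta ^+ 2 * (sig * (kappa * (c - c ^+ 2))))
 + 8 * (theta ^+ 2 * (sig * (kappa ^+ 2 * c ^+ 2)))
 + 8 * (theta ^+ 2 * (sig * (kappa ^+ 3 * c ^+ 2)))
 + (theta ^+ 2 * (sig * (kappa * c ^+ 2))).
  by rewrite /Y /b /sig; field.
have : 0 <= theta ^+ 3 * (kappa / 2 + 2 * kappa ^+ 2).
  by rewrite mulr_ge0 ?exprn_ge0 ?(ltW th0)// addr_ge0 ?divr_ge0 ?mulr_ge0 ?sqr_ge0 ?(ltW k0).
lra.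
Qed.

End Bernoulli.

(** * The urn as a recursion on finite words *)

(* A word lists the (drawn, added) pairs of the first stages, the most recent one first. *)
Notation word := (seq (bool * bool)).

Section UrnWords.
Variables (R : realType) (W0 B0 : nat) (pW pB : R).
Hypothesis W0_gt0 : (0 < W0)%N.
Hypothesis pW0 : 0 < pW.
Hypothesis pW1 : pW < 1.
Hypothesis pB0 : 0 < pB.
Hypothesis pB1 : pB < 1.
(* [lra] does not see section hypotheses. *)
Ltac urn_lra := move: pW0 pW1 pB0 pB1; lra.
Implicit Types (h : word) (f g u : word -> R) (phi psi G : pred word).

Definition whites h : R := (W0 + count snd h)%:R.
Definition balls h : R := (W0 + B0 + size h)%:R.
Definition white_prob h : R := whites h / balls h.
Definition add_white_prob (x : bool) : R := if x then pW else 1 - pB.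

Definition mean_added f h (x : bool) : R :=
  add_white_prob x * f ((x, true) :: h) + (1 - add_white_prob x) * f ((x, false) :: h).

Definition next_mean f h : R :=
  white_prob h * mean_added f h true + (1 - white_prob h) * mean_added f h false.

(** The transition operator acts on functions, so its innermost application averages over the last
    stage and its outermost one over the first. *)
Definition word_mean n f : R := iter n next_mean f [::].

Definition word_prob n phi : R := word_mean n (fun h => (phi h)%:R).

Lemma balls_gt0 h : 0 < balls h.
Proof. by rewrite ltr0n -addnA addn_gt0 W0_gt0. Qed.

Lemma white_prob01 h : 0 <= white_prob h <= 1.
Proof.
rewrite divr_ge0//= ler_pdivrMr ?balls_gt0// mul1r ler_nat.
by rewrite -addnA leq_add2l (leq_trans (count_size _ _))// leq_addl.
Qed.

Lemma add_white_prob01 x : 0 < add_white_prob x < 1.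
Proof.
by case: x; rewrite /add_white_prob; apply/andP; split; urn_lra.
Qed.

Lemma mean_added_le f g h x : (forall a, f ((x, a) :: h) <= g ((x, a) :: h)) ->
  mean_added f h x <= mean_added g h x.
Proof.
by move=> fg; have /andP[? ?] := add_white_prob01 x; rewrite lerD// ler_wpM2l//; lra.
Qed.

Lemma next_mean_le f g h : (forall c, f (c :: h) <= g (c :: h)) ->
  next_mean f h <= next_mean g h.
Proof.
move=> fg; have /andP[? ?] := white_prob01 h.
by rewrite lerD// ler_wpM2l ?mean_added_le//; lra.
Qed.

Lemma next_meanZ k f h : next_mean (fun h => k * f h) h = k * next_mean f h.
Proof. by rewrite /next_mean /mean_added; ring. Qed.

Lemma next_meanD f g h :
  next_mean (fun h => f h + g h) h = next_mean f h + next_mean g h.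
Proof. by rewrite /next_mean /mean_added; ring. Qed.

Lemma next_mean_cst k h : next_mean (fun=> k) h = k.
Proof. by rewrite /next_mean /mean_added; ring. Qed.

Lemma le_iter_next_mean n f g h :
  (forall h', size h' = (size h + n)%N -> f h' <= g h') ->
  iter n next_mean f h <= iter n next_mean g h.
Proof.
elim: n h => [|n IH] h fg /=; first by rewrite fg ?addn0.
by apply: next_mean_le => c; apply: IH => h' /= h'E; rewrite fg// h'E addSnnS.
Qed.

Lemma word_mean_le n f g : (forall h, size h = n -> f h <= g h) ->
  word_mean n f <= word_mean n g.
Proof. by move=> fg; apply: le_iter_next_mean => h; exact: fg. Qed.

Lemma eq_word_mean n f g : (forall h, size h = n -> f h = g h) ->
  word_mean n f = word_mean n g.
Proof.
by move=> fg; apply/le_anti; rewrite !word_mean_le// => h /fg->.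
Qed.

Lemma word_meanS n f : word_mean n.+1 f = word_mean n (next_mean f).
Proof. by rewrite /word_mean iterSr. Qed.

Lemma word_meanZ n k f : word_mean n (fun h => k * f h) = k * word_mean n f.
Proof.
elim: n f => [//|n IH] f; rewrite !word_meanS -IH.
by apply: eq_word_mean => h _; rewrite next_meanZ.
Qed.

Lemma word_meanD n f g :
  word_mean n (fun h => f h + g h) = word_mean n f + word_mean n g.
Proof.
elim: n f g => [//|n IH] f g; rewrite !word_meanS -IH.
by apply: eq_word_mean => h _; rewrite next_meanD.
Qed.

Lemma word_mean_cst n k : word_mean n (fun=> k) = k.
Proof.
elim: n => [//|n IH]; rewrite word_meanS -[RHS]IH.
by apply: eq_word_mean => h _; rewrite next_mean_cst.
Qed.

Lemma word_prob_le n phi psi : (forall h, size h = n -> phi h -> psi h) ->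
  word_prob n phi <= word_prob n psi.
Proof.
move=> pp; apply: word_mean_le => h hn.
by rewrite ler_nat; case: (phi h) (pp h hn) => //= ->.
Qed.

Lemma word_prob_ge0 n phi : 0 <= word_prob n phi.
Proof. by rewrite -(word_mean_cst n 0); apply: word_mean_le => h _; rewrite ler0n. Qed.

Lemma word_prob_le1 n phi : word_prob n phi <= 1.
Proof.
by rewrite -[leRHS](word_mean_cst n 1); apply: word_mean_le => h _; rewrite lern1 leq_b1.
Qed.

Lemma word_probC n phi psi :
  word_prob n (fun h => phi h && ~~ psi h) =
  word_prob n phi - word_prob n (fun h => phi h && psi h).
Proof.
apply/eqP; rewrite eq_sym subr_eq; apply/eqP.
rewrite /word_prob -word_meanD; apply: eq_word_mean => h _.
by case: (phi h); case: (psi h); rewrite /= ?addr0 ?add0r.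
Qed.

Lemma word_probU n phi psi :
  word_prob n (fun h => phi h || psi h) <= word_prob n phi + word_prob n psi.
Proof.
rewrite /word_prob -word_meanD; apply: word_mean_le => h _.
by rewrite -natrD ler_nat; case: (phi h); case: (psi h).
Qed.

Definition past m h : word := drop (size h - m) h.

Lemma past_size h : past (size h) h = h.
Proof. by rewrite /past subnn drop0. Qed.

Lemma past_cons m c h : (m <= size h)%N -> past m (c :: h) = past m h.
Proof. by move=> mh; rewrite /past /= subSn. Qed.

Lemma word_prob_past m n phi : (m <= n)%N ->
  word_prob n (fun h => phi (past m h)) = word_prob m phi.
Proof.
move=> /subnKC <-; elim: (n - m)%N => [|k IH].
  by rewrite addn0; apply: eq_word_mean => h <-; rewrite past_size.
rewrite addnS -IH /word_prob word_meanS; apply: eq_word_mean => h hE.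
rewrite -[RHS](next_mean_cst _ h); apply/le_anti.
by rewrite !next_mean_le// => c; rewrite past_cons// hE leq_addr.
Qed.

(* The words of length greater than [m] reached by [h] all satisfy [G]. *)
Fixpoint stay m G h : bool :=
  if h is _ :: h' then (size h' < m)%N || (G h && stay m G h') else true.

Lemma stay_cons m G c h : (m <= size h)%N -> stay m G (c :: h) = G (c :: h) && stay m G h.
Proof. by move=> mh; rewrite /= ltnNge mh. Qed.

Lemma stay_le m G h : (size h <= m)%N -> stay m G h.
Proof. by case: h => //= c h ->. Qed.

Lemma stayP m G h :
  reflect (forall j, (m < j <= size h)%N -> G (past j h)) (stay m G h).
Proof.
elim: h => [|c h IH].
  by apply: ReflectT => -[|j]; rewrite ?andbF ?ltn0.
have [hm|mh] := ltnP (size h) m.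
  rewrite stay_le//; apply: ReflectT => j /andP[mj /= jh].
  by have := leq_trans mj jh; rewrite ltnS leqNgt hm.
rewrite stay_cons//; apply: (iffP andP) => [[Gh /IH sh] j /andP[mj]|H]; last first.
  split; first by rewrite -[c :: h]past_size H// leqnn andbT ltnS mh.
  by apply/IH => j /andP[mj jh]; rewrite -(past_cons c)// H// mj /= ltnW.
rewrite leq_eqVlt => /orP[/eqP->|]; first by rewrite past_size.
by rewrite /= ltnS => jh; rewrite past_cons// sh// mj.
Qed.

Lemma stay_last m G h phi : (forall h, phi h -> G h) -> (m <= size h)%N ->
  phi (past m h) && stay m G h -> G h.
Proof.
move=> phiG; rewrite leq_eqVlt => /orP[/eqP->|mh /andP[_ /stayP]].
  by rewrite past_size => /andP[/phiG].
by move=> /(_ (size h)); rewrite past_size mh leqnn; apply.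
Qed.

Lemma next_mean_stay m G u phi h : (m <= size h)%N ->
  next_mean (fun h => (phi (past m h) && stay m G h)%:R * u h) h =
  (phi (past m h) && stay m G h)%:R * next_mean (fun h => (G h)%:R * u h) h.
Proof.
move=> mh; rewrite -next_meanZ; apply/le_anti.
rewrite !next_mean_le// => c; rewrite past_cons// stay_cons//.
all: by case: (phi _); case: (stay m G h); rewrite /= ?andbT ?andbF ?mul0r ?mul1r.
Qed.

(** The last stage is averaged first: on the event of having stayed so far, it yields one factor
    [lambda]. Since [stay m] does not test the word of length [m] itself, the inclusion of [phi] in
    [G] makes the one-step inequality available there. *)
Lemma stay_supersolution m n phi G u lambda :
  (m <= n)%N -> 0 <= lambda -> (forall h, phi h -> G h) ->
  (forall h, (m <= size h < n)%N -> G h ->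
     next_mean (fun h => (G h)%:R * u h) h <= lambda * u h) ->
  word_mean n (fun h => (phi (past m h) && stay m G h)%:R * u h) <=
  lambda ^+ (n - m) * word_mean m (fun h => (phi h)%:R * u h).
Proof.
move=> mn l0 phiG; rewrite -(subnKC mn) addKn; elim: (n - m)%N => [|k IH] H.
  rewrite addn0 expr0 mul1r; apply: word_mean_le => h hm.
  by rewrite stay_le ?hm// andbT -hm past_size.
rewrite addnS word_meanS exprS -mulrA.
apply: (@le_trans _ _ (lambda * word_mean (m + k)
    (fun h => (phi (past m h) && stay m G h)%:R * u h))).
  rewrite -word_meanZ; apply: word_mean_le => h hE.
  have mh : (m <= size h)%N by rewrite hE leq_addr.
  rewrite next_mean_stay//; case: (boolP (_ && _)) => [s|_]; last by rewrite !mul0r mulr0.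
  by rewrite !mul1r H ?(stay_last phiG mh s)// mh hE addnS leqnn.
rewrite ler_wpM2l// IH// => h /andP[mh hk] Gh; apply: H => //.
by rewrite mh addnS ltnS ltnW.
Qed.

Lemma stay_subsolution m n phi G u lambda :
  (m <= n)%N -> 0 <= lambda -> (forall h, phi h -> G h) ->
  (forall h, (m <= size h < n)%N -> G h ->
     lambda * u h <= next_mean (fun h => (G h)%:R * u h) h) ->
  lambda ^+ (n - m) * word_mean m (fun h => (phi h)%:R * u h) <=
  word_mean n (fun h => (phi (past m h) && stay m G h)%:R * u h).
Proof.
move=> mn l0 phiG; rewrite -(subnKC mn) addKn; elim: (n - m)%N => [|k IH] H.
  rewrite addn0 expr0 mul1r; apply: word_mean_le => h hm.
  by rewrite stay_le ?hm// andbT -hm past_size.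
rewrite addnS word_meanS exprS -mulrA.
apply: (@le_trans _ _ (lambda * word_mean (m + k)
    (fun h => (phi (past m h) && stay m G h)%:R * u h))).
  rewrite ler_wpM2l// IH// => h /andP[mh hk] Gh; apply: H => //.
  by rewrite mh addnS ltnS ltnW.
rewrite -word_meanZ; apply: word_mean_le => h hE.
have mh : (m <= size h)%N by rewrite hE leq_addr.
rewrite next_mean_stay//; case: (boolP (_ && _)) => [s|_]; last by rewrite !mul0r mulr0.
by rewrite !mul1r H ?(stay_last phiG mh s)// mh hE addnS leqnn.
Qed.

(** This is the maximal inequality for non-negative supermartingales, given the past. The auxiliary
    [F] is [f] until the exit from [G] and 1 afterwards; it decreases in mean because [f] is at
    least 1 at the exit. *)
Lemma exit_prob_le m n phi G f eta :
  (m <= n)%N -> (forall h, phi h -> G h) ->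
  (forall h, (m <= size h <= n)%N -> 0 <= f h) ->
  (forall h, (m < size h <= n)%N -> ~~ G h -> 1 <= f h) ->
  (forall h, (m <= size h < n)%N -> G h -> next_mean f h <= f h) ->
  (forall h, size h = m -> phi h -> f h <= eta) ->
  word_prob n (fun h => phi (past m h) && ~~ stay m G h) <= eta * word_prob m phi.
Proof.
move=> mn phiG f_ge0 f_ge1 f_super f_eta.
pose F h := (phi (past m h))%:R * ((stay m G h)%:R * f h + (~~ stay m G h)%:R).
apply: (@le_trans _ _ (word_mean n F)).
  apply: word_mean_le => h hn; rewrite /F; case: (phi _); rewrite /= ?mul0r// mul1r.
  by case: (stay _ _ _); rewrite /= ?mul1r ?mul0r ?addr0 ?add0r// f_ge0// hn mn leqnn.
apply: (@le_trans _ _ (word_mean m F)); last first.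
  rewrite /word_prob -word_meanZ; apply: word_mean_le => h hm.
  rewrite /F stay_le ?hm// -hm past_size /= mul1r addr0.
  by case: (boolP (phi h)) => [/(f_eta _ hm)|_]; rewrite ?mul1r ?mulr1// !mul0r mulr0.
rewrite -(subnKC mn); rewrite -(subnKC mn) in f_ge1 f_super.
elim: (n - m)%N f_ge1 f_super => [|k IH] f_ge1 f_super; first by rewrite addn0.
apply: (le_trans _ (IH _ _)); last first.
- by move=> h /andP[mh hk] Gh; apply: f_super => //; rewrite mh addnS ltnS ltnW.
- by move=> h /andP[mh hk] Gh; apply: f_ge1 => //; rewrite mh addnS ltnW.
rewrite addnS word_meanS; apply: word_mean_le => h hE.
have mh : (m <= size h)%N by rewrite hE leq_addr.
pose F' h' := (phi (past m h))%:R * ((stay m G h)%:R * f h' + (~~ stay m G h)%:R).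
apply: (@le_trans _ _ (next_mean F' h)).
  apply: next_mean_le => c; rewrite /F /F' past_cons// stay_cons//.
  case: (phi _); rewrite /= ?mul0r// !mul1r.
  case: (boolP (G (c :: h))) => [|/f_ge1]; rewrite //= hE ltnS leq_addr addnS leqnn.
  move=> /(_ isT); case: (stay m G h); rewrite /= ?mul0r ?mul1r ?addr0 ?add0r//.
rewrite /F' /F next_meanZ next_meanD next_meanZ next_mean_cst.
case: (boolP (phi _)) => [ph|_]; rewrite /= ?mul0r// !mul1r.
case: (boolP (stay _ _ _)) => [sh|_]; rewrite /= ?mul0r// !mul1r !addr0.
rewrite f_super// ?mh ?hE ?addnS ?leqnn//.
by apply: (stay_last phiG mh); rewrite ph sh.
Qed.

End UrnWords.

(** * The law of the history of the urn *)

Section UrnLaw.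
Context d (T : measurableType d) (R : realType) (P : probability T R).
Variables (W0 B0 : nat) (pW pB : R) (drawn added : {RV P >-> bool}^nat).
Hypothesis urn : play_the_winner_urn W0 B0 pW pB drawn added.
Local Notation next_mean := (next_mean W0 B0 pW pB).
Local Notation word_prob := (word_prob W0 B0 pW pB).
Local Notation white_prob := (white_prob R W0 B0).
Local Notation add_white_prob := (add_white_prob pW pB).

Fixpoint history n w : word :=
  if n is n'.+1 then (drawn n' w, added n' w) :: history n' w else [::].

Lemma size_history n w : size (history n w) = n.
Proof. by elim: n => //= n ->. Qed.

Lemma past_history m n w : (m <= n)%N -> past m (history n w) = history m w.
Proof.
move=> /subnKC <-; elim: (n - m)%N => [|k IH].
  by rewrite addn0 -{1}(size_history m w) past_size.
by rewrite addnS/= past_cons ?size_history ?leq_addr.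
Qed.

Lemma measurable_bool_RV (X : {RV P >-> bool}) b : measurable [set w | X w = b].
Proof.
rewrite (_ : [set w | _] = X @^-1` [set b])//.
by rewrite -[X in measurable X]setTI; exact: measurable_funPT.
Qed.

Lemma measurable_history n (phi : pred word) : measurable [set w | phi (history n w)].
Proof.
elim: n phi => [|n IH] phi /=.
  have [H|H] := boolP (phi [::]).
    by rewrite (_ : [set _ | _] = setT)//; apply/seteqP; split.
  by rewrite (_ : [set _ | _] = set0)//; apply/seteqP; split => // w /=; apply/negP.
rewrite (_ : [set _ | _] = \bigcup_(c in [set: bool * bool])
  ([set w | (phi \o cons c) (history n w)] `&`
    [set w | drawn n w = c.1] `&` [set w | added n w = c.2])).
  apply: fin_bigcup_measurable => // -[x a] _.
  by do 2 ?apply: measurableI; [exact: IH|exact: measurable_bool_RV..].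
apply/seteqP; split => [w /= H|w [[x a] _ /= [[H e1] e2]]].
  by exists (drawn n w, added n w).
by rewrite e1 e2.
Qed.

Lemma measurable_history_eq n h : measurable [set w | history n w = h].
Proof.
rewrite (_ : [set w | _] = [set w | (pred1 h) (history n w)]).
  exact: measurable_history.
by apply/seteqP; split => w /= /eqP.
Qed.

(** [urn_history] is indexed by stages from 0, while a word starts with the latest stage; hence the
    reversal. The default pair is never read below the size of the word. *)
Let pastx h k : bool := (nth (false, false) (rev h) k).1.
Let pasta h k : bool := (nth (false, false) (rev h) k).2.

Lemma urn_history_word h :
  urn_history drawn added (size h) (pastx h) (pasta h) = [set w | history (size h) w = h].
Proof.
have nth_last c h' : nth (false, false) (rev (c :: h')) (size h') = c.
  by rewrite rev_cons nth_rcons size_rev ltnn eqxx.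
have nth_prev c h' k : (k < size h')%N ->
    nth (false, false) (rev (c :: h')) k = nth (false, false) (rev h') k.
  by move=> kh; rewrite rev_cons nth_rcons size_rev kh.
elim: h => [|c h IH]; first by apply/seteqP; split.
have {}IH w : urn_history drawn added (size h) (pastx h) (pasta h) w <->
    history (size h) w = h by rewrite IH.
apply/seteqP; split => w /=.
  move=> H; congr (_ :: _).
    by have [-> ->] := H _ (ltnSn _); rewrite /pastx /pasta nth_last; case: c {H}.
  apply/IH => k kh; have := H k (ltnW kh).
  by rewrite /pastx /pasta nth_prev.
move=> [<- wh] k; rewrite ltnS leq_eqVlt => /orP[/eqP->|kh].
  by rewrite /pastx /pasta nth_last.
by rewrite /pastx /pasta nth_prev//; exact: ((IH w).2 wh k kh).
Qed.

Lemma white_count_word h : white_count (pasta h) (size h) = count snd h.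
Proof.
elim: h => [|c h IH]; first by rewrite /white_count big_ord0.
rewrite /white_count big_ord_recr /= -IH addnC; congr (_ + _)%N.
  by rewrite /pasta rev_cons nth_rcons size_rev ltnn eqxx.
by apply: eq_bigr => k _; rewrite /pasta rev_cons nth_rcons size_rev ltn_ord.
Qed.

Lemma measure_RV_compl A (X : {RV P >-> bool}) b p : measurable A ->
  P (A `&` [set w | X w = b]) = (p%:E * P A)%E ->
  P (A `&` [set w | X w = ~~ b]) = ((1 - p)%:E * P A)%E.
Proof.
move=> mA; have mX := measurable_bool_RV X.
have : P A = (P (A `&` [set w | X w = b]) + P (A `&` [set w | X w = ~~ b]))%E.
  rewrite -measureU; [|exact: measurableI..|].
    rewrite -setIUr (_ : _ `|` _ = setT) ?setIT//.
    by apply/seteqP; split => // w _ /=; case: b (X w) => [] []; [left|right|right|left].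
  by apply/seteqP; split => // w /= [[_ ->] [_]]; case: b.
have /fineK <- : P A \is a fin_num by exact: fin_num_measure.
have /fineK <- : P (A `&` [set w | X w = ~~ b]) \is a fin_num.
  by apply: fin_num_measure; exact: measurableI.
move=> + pE; rewrite {}pE -!EFinM -EFinD => -[H].
by congr EFin; rewrite mulrBl mul1r {1}H; ring.
Qed.

Lemma measure_next_drawn h x :
  P ([set w | history (size h) w = h] `&` [set w | drawn (size h) w = x]) =
  ((if x then white_prob h else 1 - white_prob h)%:E *
    P [set w | history (size h) w = h])%E.
Proof.
have Pt : P ([set w | history (size h) w = h] `&` [set w | drawn (size h) w = true]) =
    ((white_prob h)%:E * P [set w | history (size h) w = h])%E.
  have := urn_drawn_law urn (size h) (pastx h) (pasta h).
  by rewrite urn_history_word white_count_word.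
case: x => //; rewrite (measure_RV_compl _ Pt)//; exact: measurable_history_eq.
Qed.

Lemma measure_next_history h x a :
  P [set w | history (size h).+1 w = (x, a) :: h] =
  (((if x then white_prob h else 1 - white_prob h) *
    (if a then add_white_prob x else 1 - add_white_prob x))%:E *
    P [set w | history (size h) w = h])%E.
Proof.
have mD : measurable ([set w | history (size h) w = h] `&` [set w | drawn (size h) w = x]).
  by apply: measurableI; [exact: measurable_history_eq|exact: measurable_bool_RV].
have Px : P (([set w | history (size h) w = h] `&` [set w | drawn (size h) w = x])
      `&` [set w | added (size h) w = x]) =
    ((if x then pW else pB)%:E *
     P ([set w | history (size h) w = h] `&` [set w | drawn (size h) w = x]))%E.
  have := urn_added_law urn (size h) (pastx h) (pasta h) x.
  by rewrite urn_history_word.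
rewrite (_ : [set w | _] =
    ([set w | history (size h) w = h] `&` [set w | drawn (size h) w = x])
      `&` [set w | added (size h) w = a]); last first.
  by apply/seteqP; split => w /= [] => [-> -> ->//|[-> ->] ->].
have -> : P (([set w | history (size h) w = h] `&` [set w | drawn (size h) w = x])
      `&` [set w | added (size h) w = a]) =
    ((if a then add_white_prob x else 1 - add_white_prob x)%:E *
     P ([set w | history (size h) w = h] `&` [set w | drawn (size h) w = x]))%E.
  case: (altP (a =P x)) => [->|].
    rewrite Px; congr (_%:E * _)%E; rewrite /add_white_prob.
    by case: x {Px mD}; rewrite // opprB addrCA subrr addr0.
  case: a x mD Px => [] [] //= mD Px _.
    exact: (measure_RV_compl mD Px).
  rewrite (measure_RV_compl mD Px).
by rewrite measure_next_drawn muleA -EFinM mulrC.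
by rewrite measure_next_drawn muleA -EFinM mulrC.
Qed.

(** The induction splits over the next pair, so it must be general in the starting word. The product
    form avoids any division by the probability of the past, which may be zero. *)
Lemma measure_history_from n h (phi : pred word) :
  P ([set w | history (size h) w = h] `&` [set w | phi (history (size h + n) w)]) =
  ((iter n next_mean (fun h' => (phi h')%:R) h)%:E * P [set w | history (size h) w = h])%E.
Proof.
elim: n h => [|n IH] h.
  rewrite addn0 /=; have [H|H] := boolP (phi h).
    rewrite mul1e; congr (P _); apply/seteqP; split => w //= [] // -> //.
  rewrite mul0e (_ : _ `&` _ = set0) ?measure0//.
  by apply/seteqP; split => // w /= [->]; apply/negP.
pose A c := [set w | history (size h).+1 w = c :: h] `&` [set w | phi (history (size h + n.+1) w)].
have mA c : measurable (A c).
  by apply: measurableI; [exact: measurable_history_eq|exact: measurable_history].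
have PA x a : P (A (x, a)) = (iter n next_mean (fun h' => (phi h')%:R) ((x, a) :: h) *
    ((if x then white_prob h else 1 - white_prob h) *
    (if a then add_white_prob x else 1 - add_white_prob x)) *
     fine (P [set w | history (size h) w = h]))%:E.
  rewrite /A addnS -addSn; have := IH ((x, a) :: h); rewrite /= -/(history _ _).
  rewrite -[X in P ([set w | X w = _] `&` _)]/(history (size h).+1) => ->.
  rewrite measure_next_history -mulrA !EFinM fineK ?muleA//.
  by apply: fin_num_measure; exact: measurable_history_eq.
have A_disj c c' : c != c' -> A c `&` A c' = set0.
  move=> cc; apply/seteqP; split => // w /= [[[e1 _] _] [[e2 _] _]].
  by move: cc; rewrite -e1 -e2 eqxx.
rewrite (_ : _ `&` _ = (A (true, true) `|` A (true, false)) `|`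
    (A (false, true) `|` A (false, false))); last first.
  apply/seteqP; split => w; rewrite /A /=.
    move=> [-> ->]; case: (drawn _ w) (added _ w) => [] [];
    by [left;left|left;right|right;left|right;right].
  by move=> [[|]|[|]] [[_ _ -> ->]].
rewrite measureU; [|exact: measurableU..|]; last first.
  by rewrite setIUl !setIUr !A_disj// !setU0.
rewrite !measureU//; [|exact: A_disj..].
rewrite -[LHS]/(P (A (true, true)) + P (A (true, false)) +
  (P (A (false, true)) + P (A (false, false))))%E !PA.
rewrite -!EFinD /=.
have /fineK <- : P [set w | history (size h) w = h] \is a fin_num.
  by apply: fin_num_measure; exact: measurable_history_eq.
rewrite -EFinM; congr EFin; rewrite /next_mean /mean_added /=.
ring.
Qed.

Lemma measure_history n (phi : pred word) :
  P [set w | phi (history n w)] = (word_prob n phi)%:E.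
Proof.
have := measure_history_from n [::] phi; rewrite add0n /=.
rewrite (_ : [set w | [::] = [::]] = setT) ?setTI; last by apply/seteqP; split.
by move=> ->; rewrite probability_setT mule1.
Qed.

End UrnLaw.

(** * Centred counts *)

Section UrnProcess.
Variables (R : realType) (W0 B0 : nat) (pW pB : R).
Hypothesis W0_gt0 : (0 < W0)%N.
Hypothesis pW0 : 0 < pW.
Hypothesis pW1 : pW < 1.
Hypothesis pB0 : 0 < pB.
Hypothesis pB1 : pB < 1.
Ltac urn_lra := move: pW0 pW1 pB0 pB1; lra.
Implicit Types (h : word).
Local Notation next_mean := (next_mean W0 B0 pW pB).
Local Notation mean_added := (mean_added pW pB).
Local Notation white_prob := (white_prob R W0 B0).
Local Notation balls := (balls R W0 B0).
Local Notation whites := (whites R W0).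
Local Notation add_white_prob := (add_white_prob pW pB).

Definition rho : R := pW + pB - 1.
(* Locked so that rewriting does not look inside. *)
Definition limit_frac : R := locked ((1 - pB) / ((1 - pW) + (1 - pB))).
Local Notation v := limit_frac.
Definition limit_var : R := locked (v * (1 - v)).
Local Notation sig2 := limit_var.

Lemma limit_fracE : v = (1 - pB) / ((1 - pW) + (1 - pB)).
Proof. by rewrite /limit_frac -lock. Qed.

Lemma limit_varE : sig2 = v * (1 - v).
Proof. by rewrite /limit_var -lock. Qed.

Definition devN h : R := (count fst h)%:R - (size h)%:R * v.
Definition devY h : R := whites h - (size h)%:R * v.
(* [devY] recentred so that its drift is exactly [rho * excess / balls]. *)
Definition excess h : R := whites h - balls h * v.
(* The martingale recording the added balls given the drawn ones. *)
Definition added_mart h : R := devY h - rho * devN h - W0%:R.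

Lemma limit_frac01 : 0 < v < 1.
Proof.
have d0 : 0 < (1 - pW) + (1 - pB) by urn_lra.
by rewrite limit_fracE divr_gt0 ?subr_gt0//= ltr_pdivrMr// mul1r ltrDr subr_gt0.
Qed.

Let v0 : 0 < v. Proof. by case/andP: limit_frac01. Qed.
Let v1 : v < 1. Proof. by case/andP: limit_frac01. Qed.

Lemma limit_var_gt0 : 0 < sig2.
Proof. by rewrite limit_varE mulr_gt0 // subr_gt0. Qed.

Lemma limit_var_le1 : sig2 <= 1.
Proof. by rewrite limit_varE mulr_ile1 ?(ltW v0) ?(ltW v1) ?subr_ge0 ?(ltW v1)// gerBl ltW. Qed.

Lemma rho_norm : `|rho| <= 1.
Proof. by rewrite ler_norml /rho; apply/andP; split; urn_lra. Qed.

Lemma limit_frac_fix : v * (1 - rho) = 1 - pB.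
Proof.
rewrite limit_fracE /rho (_ : 1 - (pW + pB - 1) = 1 - pW + (1 - pB)); last by ring.
by rewrite divfK// lt0r_neq0// addr_gt0 ?subr_gt0.
Qed.

(** [v] is the fixed point of the affine map [x -> (1 - pB) + rho * x]. Hence the centred added ball
    has conditional mean [rho] times the centred drawn ball, which makes [devY - rho * devN] a
    martingale. *)
Lemma add_white_probE (x : bool) : add_white_prob x = v + rho * (x%:R - v).
Proof.
have := limit_frac_fix; rewrite /add_white_prob; case: x => /=.
  by rewrite /rho; lra.
by rewrite sub0r; lra.
Qed.

Lemma balls_cons c h : balls (c :: h) = balls h + 1.
Proof. by rewrite /balls /= addnS -addn1 natrD. Qed.

Lemma devN_cons x a h : devN ((x, a) :: h) = devN h + (x%:R - v).
Proof. by rewrite /devN /= natrD -(addn1 (size h)) natrD; ring. Qed.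

Lemma devY_cons x a h : devY ((x, a) :: h) = devY h + (a%:R - v).
Proof. by rewrite /devY /whites /= !natrD -(addn1 (size h)) natrD; ring. Qed.

Lemma excess_cons x a h : excess ((x, a) :: h) = excess h + (a%:R - v).
Proof. by rewrite /excess balls_cons /whites /= !natrD; ring. Qed.

Lemma added_mart_cons x a h :
  added_mart ((x, a) :: h) = added_mart h + (a%:R - add_white_prob x).
Proof. by rewrite /added_mart devN_cons devY_cons add_white_probE; ring. Qed.

Lemma excessE h : excess h = devY h - (W0 + B0)%:R * v.
Proof. by rewrite /excess /devY /balls !natrD; ring. Qed.

(** This splits the drift of [devN] into a part that the strip controls, a martingale that it does
    not control, and a constant. *)
Lemma excess_added_mart h :
  excess h = rho * devN h + added_mart h + (W0%:R - (W0 + B0)%:R * v).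
Proof. by rewrite excessE /added_mart; ring. Qed.

Lemma white_prob_drift h : white_prob h - v = excess h / balls h.
Proof.
rewrite /white_prob /excess mulrBl [balls h * v]mulrC mulfK//.
by rewrite gt_eqF// balls_gt0.
Qed.

Ltac frac_lra := move: v0 v1; lra.

Lemma norm_bool_frac (x : bool) : `|x%:R - v| <= 1.
Proof.
by case: x; rewrite ler_norml /= ?mulr1n ?mulr0n; apply/andP; split; frac_lra.
Qed.

Lemma norm_excess_devY h : `|excess h| <= `|devY h| + (W0 + B0)%:R.
Proof.
rewrite excessE; apply: (le_trans (ler_normB _ _)); rewrite lerD2l.
rewrite ger0_norm; last by apply: mulr_ge0 => //; exact: ltW.
by rewrite ler_piMr// ltW.
Qed.

Lemma norm_offset : `|W0%:R - (W0 + B0)%:R * v| <= (W0 + B0)%:R.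
Proof.
have h1 : W0%:R <= (W0 + B0)%:R :> R by rewrite ler_nat leq_addr.
have h2 : 0 <= W0%:R :> R by [].
have h3 : (W0 + B0)%:R * v <= (W0 + B0)%:R by rewrite ler_piMr// ltW.
have h4 : 0 <= (W0 + B0)%:R * v by apply: mulr_ge0 => //; exact: ltW.
by rewrite ler_norml; apply/andP; split; lra.
Qed.

Lemma norm_excess_devN h : `|excess h| <= `|devN h| + `|added_mart h| + (W0 + B0)%:R.
Proof.
rewrite excess_added_mart; apply: (le_trans (ler_normD _ _)).
apply: lerD norm_offset; apply: (le_trans (ler_normD _ _)); rewrite lerD2r normrM.
by rewrite ler_piMl// rho_norm.
Qed.

Lemma next_mean_added (g : R -> R) h :
  next_mean (fun h' => g (devY h')) h =
  (v + rho * (white_prob h - v)) * g (devY h + (1 - v))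
  + (1 - (v + rho * (white_prob h - v))) * g (devY h + (0 - v)).
Proof.
rewrite /next_mean /mean_added !devY_cons !add_white_probE /= !mulr1n !mulr0n.
by ring.
Qed.

Lemma next_mean_devY_cos theta s a h :
  0 <= theta -> theta <= s -> s <= 1 -> theta * (a + 1) <= pi / 2 -> `|devY h| <= a ->
  `|excess h / balls h| <= s ->
  next_mean (fun h => cos (theta * devY h)) h <=
  cos (theta * devY h) * (1 - theta ^+ 2 * sig2 / 2)
  + 2 * s * `|excess h / balls h| + 10 * s ^+ 3.
Proof.
move=> th0 ths s1 tha ha es.
have ta : `|theta * devY h| <= theta * a by rewrite normrM_le// ger0_norm.
have cosz x : `|x| <= theta -> 0 <= cos (theta * devY h + x).
  move=> xt; apply: cos_ge0_pihalf; rewrite -ler_norml.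
  by apply: (le_trans (ler_normD _ _)); rewrite mulrDr mulr1 in tha; lra.
rewrite (next_mean_added (fun z => cos (theta * z))).
rewrite [theta * (_ + (1 - v))]mulrDr [theta * (_ + (0 - v))]mulrDr.
have /andP[w0 w1] := @white_prob01 R W0 B0 W0_gt0 h.
set p := v + rho * (white_prob h - v).
have pE : p = add_white_prob true * white_prob h + add_white_prob false * (1 - white_prob h).
  by rewrite !add_white_probE /p /= mulr1n mulr0n; ring.
have p01 : 0 <= p <= 1.
  have /andP[? ?] := add_white_prob01 pW0 pW1 pB0 pB1 true.
  have /andP[? ?] := add_white_prob01 pW0 pW1 pB0 pB1 false.
  by rewrite pE; apply/andP; split; nra.
have pv : p - v = rho * (excess h / balls h) by rewrite /p white_prob_drift; ring.
have pvs : `|p - v| <= `|excess h / balls h|.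
  by rewrite pv normrM ler_piMl// rho_norm.
have := @cos_expR_step R (theta * devY h) theta 0 s p v.
rewrite ger0_norm// normr0 !mul0r !oppr0 !expR0 !mulr1 addr0.
have s0 : 0 <= s by lra.
have v01 : 0 <= v <= 1 by rewrite !ltW.
have c0 : 0 <= cos (theta * devY h) by rewrite -[X in cos X]addr0 cosz// normr0.
have c1 : 0 <= cos (theta * devY h + theta * (1 - v)).
  by apply: cosz; rewrite normrM !ger0_norm ?ler_piMr//; frac_lra.
have c2 : 0 <= cos (theta * devY h + theta * (0 - v)).
  by apply: cosz; rewrite normrM sub0r normrN !ger0_norm ?ler_piMr//; frac_lra.
rewrite -limit_varE => H; apply: (le_trans (H ths s0 s1 p01 v01 (le_trans pvs es) c0 c1 c2)).
by rewrite lerD2r lerD2l ler_wpM2l//; lra.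
Qed.

Lemma mean_expR_added_le tau x : `|tau| <= 2^-1 ->
  add_white_prob x * expR (- (tau * (1 - add_white_prob x)))
  + (1 - add_white_prob x) * expR (- (tau * (0 - add_white_prob x))) <= expR (tau ^+ 2).
Proof.
move=> t2; have /andP[p0 p1] := add_white_prob01 pW0 pW1 pB0 pB1 x.
set p := add_white_prob x in p0 p1 *.
have q0 : 0 <= 1 - p by lra.
have h1 : `|- (tau * (1 - p))| <= 2^-1.
  by rewrite normrN -[2^-1]mulr1 normrM_le// ger0_norm; lra.
have h2 : `|- (tau * (0 - p))| <= 2^-1.
  by rewrite normrN -[2^-1]mulr1 normrM_le// sub0r normrN ger0_norm; lra.
apply: (le_trans _ (expR_ge1Dx _)).
apply: (le_trans (lerD (ler_wpM2l (ltW p0) (expR_le_quadratic h1))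
  (ler_wpM2l q0 (expR_le_quadratic h2)))).
rewrite -subr_ge0 (_ : _ - _ = tau ^+ 2 * (1 - p * (1 - p))); last by ring.
by rewrite mulr_ge0 ?sqr_ge0//; nra.
Qed.

(* The exponential is the Girsanov factor that turns the drift of [devN] into a
   negligible one; [added_mart h / (sig2 * balls h)] is the removed drift over [sig2]. *)
Definition tilt theta h : R :=
  cos (theta * devN h) * expR (- (devN h * added_mart h / (sig2 * balls h))).

Let b0 h : 0 < balls h. Proof. exact: balls_gt0. Qed.
Let sig0 : 0 < sig2. Proof. exact: limit_var_gt0. Qed.

(** The factorization is exact because the exponent is bilinear in [devN] and [added_mart]. It
    separates a tilt [gamma] of the drawn ball, the effect of the growth of [balls], and a tilt
    [tau] of the added ball, the only factor that depends on the latter. *)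
Lemma mean_added_tilt theta h (x : bool) :
  mean_added (tilt theta) h x =
  let gamma := added_mart h / (sig2 * (balls h + 1)) in
  let tau := (devN h + (x%:R - v)) / (sig2 * (balls h + 1)) in
  let p := add_white_prob x in
  cos (theta * devN h + theta * (x%:R - v)) * expR (- (gamma * (x%:R - v)))
  * expR (- (devN h * added_mart h / (sig2 * balls h))
          + devN h * added_mart h / (sig2 * balls h * (balls h + 1)))
  * (p * expR (- (tau * (1 - p))) + (1 - p) * expR (- (tau * (0 - p)))).
Proof.
have s0 : sig2 != 0 by rewrite gt_eqF.
have t0 : balls h != 0 by rewrite gt_eqF.
have t10 : balls h + 1 != 0 by rewrite gt_eqF// addr_gt0.
rewrite /mean_added /tilt !devN_cons !balls_cons !added_mart_cons /= mulr1n mulr0n.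
set H := devN h; set M := added_mart h; set p := add_white_prob x; set D := _ - v.
move: (balls h) t0 t10 => t t0 t10.
have E (z : R) : expR (- ((H + D) * (M + z) / (sig2 * (t + 1)))) =
    expR (- (M / (sig2 * (t + 1)) * D)) *
    expR (- (H * M / (sig2 * t)) + H * M / (sig2 * t * (t + 1))) *
    expR (- ((H + D) / (sig2 * (t + 1)) * z)).
  by rewrite -!expRD; congr expR; field; rewrite s0 t0 t10.
by rewrite !E mulrDr; ring.
Qed.

(** Three errors appear: [zeta] from the growth of [balls] in the exponent, [eta ^+ 2] from
    averaging the added ball, and the drift of [devN] that [gamma * sig2] fails to remove. *)
Lemma next_mean_tilt theta s a eta zeta h :
  let gamma := added_mart h / (sig2 * (balls h + 1)) in
  0 <= theta -> theta <= s -> s <= 1 -> theta * (a + 1) <= pi / 2 -> `|devN h| <= a ->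
  `|excess h / balls h| <= s -> `|gamma| <= s ->
  (a + 1) / (sig2 * balls h) <= eta -> eta <= 2^-1 ->
  `|devN h * added_mart h| / (sig2 * balls h * balls h) <= zeta ->
  next_mean (tilt theta) h <=
  expR (- (devN h * added_mart h / (sig2 * balls h)) + zeta + eta ^+ 2) *
  (cos (theta * devN h) * (1 - theta ^+ 2 * sig2 / 2)
  + 2 * s * `|excess h / balls h - gamma * sig2| + 10 * s ^+ 3).
Proof.
move=> gamma th0 ths s1 tha ha es gs aeta eta2 HMz.
have ta : `|theta * devN h| <= theta * a by rewrite normrM_le// ger0_norm.
have cosz x : `|x| <= theta -> 0 <= cos (theta * devN h + x).
  move=> xt; apply: cos_ge0_pihalf; rewrite -ler_norml.
  by apply: (le_trans (ler_normD _ _)); rewrite mulrDr mulr1 in tha; lra.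
have cosx (x : bool) : 0 <= cos (theta * devN h + theta * (x%:R - v)).
  by apply: cosz; rewrite -[leRHS]mulr1 normrM_le ?norm_bool_frac// ger0_norm.
have c0 : 0 <= cos (theta * devN h) by rewrite -[X in cos X]addr0 cosz// normr0.
have b1 : 0 < balls h + 1 by rewrite addr_gt0.
have sb : 0 < sig2 * balls h by apply: mulr_gt0.
have sb1 : 0 < sig2 * (balls h + 1) by apply: mulr_gt0.
have den : `|(sig2 * (balls h + 1))^-1| <= (sig2 * balls h)^-1.
  by rewrite normfV gtr0_norm// lef_pV2 ?posrE// ler_pM2l// lerDl.
have key (x : bool) : mean_added (tilt theta) h x <=
    expR (- (devN h * added_mart h / (sig2 * balls h)) + zeta + eta ^+ 2) *
    (cos (theta * devN h + theta * (x%:R - v)) * expR (- (gamma * (x%:R - v)))).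
  rewrite mean_added_tilt /= -/gamma; set tau := (devN h + _) / _.
  have tau_eta : `|tau| <= eta.
    apply: le_trans aeta; rewrite normrM_le//.
    by apply: (le_trans (ler_normD _ _)); rewrite lerD// norm_bool_frac.
  have tau2 : `|tau| <= 2^-1 by apply: le_trans eta2.
  apply: (le_trans (ler_wpM2l _ (mean_expR_added_le x tau2))).
    by rewrite !mulr_ge0 ?expR_ge0.
  rewrite [leRHS]mulrC -[leLHS]mulrA; apply: ler_wpM2l; first by rewrite mulr_ge0 ?expR_ge0.
  rewrite -expRD ler_expR.
  rewrite -!addrA lerD2l; apply: lerD.
    apply: le_trans HMz; apply: (le_trans (ler_norm _)); rewrite normrM.
    have sbb : 0 < sig2 * balls h * balls h by apply: mulr_gt0.
    have sbb1 : 0 < sig2 * balls h * (balls h + 1) by apply: mulr_gt0.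
    by rewrite ler_wpM2l// normfV gtr0_norm// lef_pV2 ?posrE// ler_pM2l// lerDl.
  rewrite -(ger0_norm (sqr_ge0 tau)) normrX lerXn2r// nnegrE//.
  exact: le_trans tau_eta.
have /andP[w0 w1] := @white_prob01 R W0 B0 W0_gt0 h.
have w1' : 0 <= 1 - white_prob h by lra.
apply: (le_trans (lerD (ler_wpM2l w0 (key true)) (ler_wpM2l w1' (key false)))).
set Ex := expR _.
rewrite !(mulrCA _ Ex) -mulrDr ler_wpM2l ?expR_ge0//= mulr1n mulr0n.
have pvs : `|white_prob h - v| <= s by rewrite white_prob_drift.
have v01 : 0 <= v <= 1 by rewrite !ltW.
rewrite -white_prob_drift limit_varE; apply: cos_expR_step => //.
- by rewrite ger0_norm.
- by rewrite w0.
- exact: (cosx true).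
- exact: (cosx false).
Qed.

End UrnProcess.

(** * Upper bound on the confinement probability *)

Section ConfinementUpper.
Variables (R : realType) (W0 B0 : nat) (pW pB : R).
Hypothesis W0_gt0 : (0 < W0)%N.
Hypothesis B0_gt0 : (0 < B0)%N.
Hypothesis pW0 : 0 < pW.
Hypothesis pW1 : pW < 1.
Hypothesis pB0 : 0 < pB.
Hypothesis pB1 : pB < 1.
Implicit Types (h : word).
Local Notation next_mean := (next_mean W0 B0 pW pB).
Local Notation balls := (balls R W0 B0).
Local Notation rho := (rho pW pB).
Local Notation v := (limit_frac pW pB).
Local Notation sig2 := (limit_var pW pB).
Local Notation devN := (devN pW pB).
Local Notation devY := (devY W0 pW pB).
Local Notation excess := (excess W0 B0 pW pB).
Local Notation added_mart := (added_mart W0 pW pB).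
Local Notation tilt := (tilt W0 B0 pW pB).

Let b0 h : 0 < balls h. Proof. exact: balls_gt0. Qed.
Let sig0 : 0 < sig2. Proof. exact: limit_var_gt0. Qed.

(* [lra] fails once section variables are cleared. *)
Ltac clr := repeat match goal with H : _ |- _ => lazymatch H with
  | R => fail | W0 => fail | B0 => fail | pW => fail | pB => fail
  | W0_gt0 => fail | B0_gt0 => fail | pW0 => fail | pW1 => fail | pB0 => fail | pB1 => fail
  | b0 => fail | sig0 => fail | _ => clear H end end.

(* [kd] selects the drawn count N ([true]) or the white ball count Y ([false]). *)
Definition dev (kd : bool) h : R := if kd then devN h else devY h.

Definition damped (kd : bool) theta h : R :=
  if kd then tilt theta h else cos (theta * devY h).

Lemma damped_ge0 kd theta a h : 0 <= theta -> theta * a <= pi / 2 -> `|dev kd h| <= a ->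
  0 <= damped kd theta h.
Proof.
move=> th0 tha ha.
have c0 : 0 <= cos (theta * dev kd h).
  apply: cos_ge0_pihalf; rewrite -ler_norml normrM ger0_norm//.
  by apply: le_trans tha; rewrite ler_wpM2l.
by rewrite /damped; case: kd ha c0 => //= ha c0; rewrite /tilt mulr_ge0 ?expR_ge0.
Qed.

Lemma dev_cons_le kd c h a : `|dev kd h| <= a -> `|dev kd (c :: h)| <= a + 1.
Proof.
case: c => x y ha; rewrite (_ : dev _ (_ :: _) = dev kd h + ((if kd then x else y)%:R - v)).
  by apply: (le_trans (ler_normD _ _)); rewrite lerD// norm_bool_frac.
by case: kd ha => _ /=; rewrite ?devN_cons ?devY_cons.
Qed.

Lemma cos_antitone_norm (x y : R) : `|x| <= y -> y <= pi -> cos y <= cos x.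
Proof.
move=> xy ypi; rewrite -(cos_norm x) leNgt; apply/negP.
have y0 : 0 <= y by apply: le_trans xy.
have xpi := le_trans xy ypi.
by rewrite ltr_cos ?in_itv/= ?normr_ge0 ?y0 ?ypi ?xpi// ltNge xy.
Qed.

(** [N] is the final time, and [eps * N <= balls h] leaves out an initial fraction of the stages.
    There all relative errors of a step are of order [1 / N], hence bounded in total, and the
    Girsanov exponent is at most of order [(c / s) * (4 * N * s) / N], a constant. *)
Lemma damped_step (c eps th : R) : 0 < c -> 0 < eps -> 0 < th -> th * c < pi / 2 ->
  exists K s0 : R, [/\ 0 < K, 0 < s0 & forall kd N s h,
    0 < N -> 0 < s <= s0 -> 1 <= N * s ^+ 2 -> N * s ^+ 3 <= 1 ->
    eps * N <= balls h -> `|dev kd h| <= c / s -> `|added_mart h| <= 4 * N * s ->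
    [/\ expR (- K) <= damped kd (th * s) h <= expR K,
        forall c, 0 <= damped kd (th * s) (c :: h) &
        next_mean (damped kd (th * s)) h <=
          expR (- (th ^+ 2 * sig2 / 2 * s ^+ 2) + K / N) * damped kd (th * s) h]].
Proof.
move=> c0 e0 th0 thc.
set b : R := (W0 + B0)%:R; have bge0 : 0 <= b by [].
(* As [th * c] is strictly below [pi / 2], the cosine is at least [c1] in the strip; this turns
   additive errors into factors. *)
set c1 := cos (th * c).
have c1_gt0 : 0 < c1 by apply: cos_gt0_norm; rewrite gtr0_norm// mulr_gt0.
(* These are the coefficients of the bounds below: [k1] for the drift of [devN], [k2] for what the
   tilt leaves of it, [k3] for [gamma], [k4] for [eta], [k5] for [zeta] and [k6] for the Girsanov
   exponent. *)
have [k1 k1E] : {k1 | k1 = (c + b + 4) / eps} by exists ((c + b + 4) / eps).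
have [k2 k2E] : {k2 | k2 = 4 / eps ^+ 2} by exists (4 / eps ^+ 2).
have [k3 k3E] : {k3 | k3 = 4 / (sig2 * eps)} by exists (4 / (sig2 * eps)).
have [k4 k4E] : {k4 | k4 = (c + 1) / (sig2 * eps)} by exists ((c + 1) / (sig2 * eps)).
have [k5 k5E] : {k5 | k5 = 4 * c / (sig2 * eps ^+ 2)} by exists (4 * c / (sig2 * eps ^+ 2)).
have [k6 k6E] : {k6 | k6 = 4 * c / (sig2 * eps)} by exists (4 * c / (sig2 * eps)).
have se0 : 0 < sig2 * eps by rewrite mulr_gt0.
have e20 : 0 < eps ^+ 2 by rewrite exprn_gt0.
have se20 : 0 < sig2 * eps ^+ 2 by rewrite mulr_gt0.
have k1p : 0 < k1 by rewrite k1E divr_gt0//; move: c0 bge0; clr; lra.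
have k2p : 0 < k2 by rewrite k2E divr_gt0.
have k3p : 0 < k3 by rewrite k3E divr_gt0.
have k4p : 0 < k4 by rewrite k4E divr_gt0//; move: c0; clr; lra.
have k5p : 0 < k5 by rewrite k5E divr_gt0// mulr_gt0.
have k6p : 0 < k6 by rewrite k6E divr_gt0// mulr_gt0.
have [K0 K0E] : {K0 | K0 = th + k1 + k2 + k3 + k4 + k5 + k6} by exists (th + k1 + k2 + k3 + k4 + k5 + k6).
have K0p : 0 < K0 by rewrite K0E; move: th0 k1p k2p k3p k4p k5p k6p; clr; lra.
have [kth kk1 kk12 kk3 kk4] : [/\ th <= K0, k1 <= K0, (c + b) / eps + k2 <= K0, k3 <= K0 & k4 <= K0].
  have : 0 < 4 / eps by rewrite divr_gt0.
  rewrite K0E k1E !mulrDl; move: th0 k1p k2p k3p k4p k5p k6p; rewrite k1E !mulrDl; clr.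
  by split; lra.
have [kk5 kk6] : k5 <= K0 /\ k6 <= K0.
  by rewrite K0E; move: th0 k1p k2p k3p k4p k5p k6p; clr; split; lra.
clear K0E.
have [C CE] : {C | C = (2 * K0 ^+ 2 + 10 * K0 ^+ 3)} by exists ((2 * K0 ^+ 2 + 10 * K0 ^+ 3)).
have Cp : 0 < C by rewrite CE addr_gt0 ?mulr_gt0 ?exprn_gt0.
pose K := K0 + K0 ^+ 2 + (C + 1) / c1.
have K0sqp : 0 < K0 ^+ 2 by rewrite exprn_gt0.
have KK0 : K0 + 1 / c1 <= K.
  have : 0 < C / c1 by rewrite divr_gt0.
  by rewrite /K mulrDl; move: K0sqp; clr; lra.
(* The first bound gives [K0 * s <= 2^-1], which is needed for [eta]; the second leaves room for one
   more step before the cosine changes sign. *)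
pose s0 := Num.min (1 / (2 * K0)) (Num.min ((pi / 2 - th * c) / th) 1).
exists K, s0; split.
- by rewrite /K addr_gt0// ?addr_gt0// divr_gt0//; move: Cp; clr; lra.
- by rewrite /s0 !lt_min; apply/and3P; split => //; apply: divr_gt0 => //; move: K0p thc; clr; lra.
move=> kd N s h N0 /andP[s_gt0]; rewrite !le_min => /and3P[sKs sths s1] Ns2 Ns3 tN ha hM.
have sK : K0 * s <= 2^-1.
  have K2 : 0 < 2 * K0 by rewrite mulr_gt0.
  by move: sKs; rewrite ler_pdivlMr//; clr; lra.
have sth : th * s <= pi / 2 - th * c.
  by move: sths; rewrite ler_pdivlMr// mulrC.
have sge0 := ltW s_gt0.
(* [q] is the order of the drift that the strip permits. All errors reduce to [q * s = iN],
   [s ^+ 3 <= iN] and [q ^+ 2 <= iN]. *)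
pose iN := N^-1; pose q := (s * N)^-1.
have iNp : 0 < iN by rewrite invr_gt0.
have qp : 0 < q by rewrite invr_gt0 mulr_gt0.
have Nn0 : N != 0 by rewrite gt_eqF.
have sn0 : s != 0 by rewrite gt_eqF.
have iNs2 : iN <= s ^+ 2 by rewrite /iN -[N^-1]mulr1 ler_pdivrMl.
have qiN : q * s = iN by rewrite /q /iN; field; rewrite Nn0 sn0.
have iNs3 : s ^+ 3 <= iN by rewrite /iN -[N^-1]mulr1 ler_pdivlMl.
have qs : q <= s by rewrite -(ler_pM2r s_gt0) qiN -expr2.
have iNq : iN <= q by rewrite -qiN ler_piMr// ltW.
have q2 : q ^+ 2 <= iN.
  by rewrite expr2 -qiN ler_wpM2l// ltW.
have t0 := b0 h; have eN0 : 0 < eps * N by rewrite mulr_gt0.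
have t1_0 : 0 < balls h + 1 by apply: addr_gt0.
have st0 : 0 < sig2 * balls h by apply: mulr_gt0.
have st1 : 0 < sig2 * (balls h + 1) by apply: mulr_gt0.
have tt1 : 0 < balls h * (balls h + 1) by apply: mulr_gt0.
have stt : 0 < sig2 * balls h * balls h by apply: mulr_gt0.
have seN : 0 < sig2 * (eps * N) by apply: mulr_gt0.
have seNN : 0 < sig2 * (eps * N) * (eps * N) by apply: mulr_gt0.
have eNN : 0 < eps * N * (eps * N) by apply: mulr_gt0.
have divt x : 0 <= x -> x / balls h <= x / (eps * N).
  by move=> x0; rewrite ler_wpM2l// lef_pV2.
have en0 : eps != 0 by rewrite gt_eqF.
have sign0 : sig2 != 0 by rewrite gt_eqF.
have cs0 : 0 <= c / s by rewrite divr_ge0 ?(ltW c0).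
have M0 : 0 <= 4 * N * s by rewrite !mulr_ge0 ?(ltW N0).
have off : `|rho * devN h + (W0%:R - (W0 + B0)%:R * v)| <= `|devN h| + b.
  apply: (le_trans (ler_normD _ _)); apply: lerD; last exact: norm_offset.
  by rewrite normrM ler_piMl// rho_norm.
have thK : th * s <= K0 * s by rewrite ler_wpM2r.
have Ks1 : K0 * s <= 1 by move: sK; clr; lra.
have tha : th * s * (c / s + 1) <= pi / 2.
  rewrite (_ : _ * _ = th * c + th * s); first by move: sth; clr; lra.
  by move: sn0; clr => sn0; field.
have xa : `|th * s * dev kd h| <= th * c.
  rewrite (_ : th * c = th * s * (c / s)); last by move: sn0; clr => sn0; field.
  by rewrite normrM_le// ger0_norm// mulr_ge0// ltW.
have cosge : c1 <= cos (th * s * dev kd h).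
  by apply: cos_antitone_norm => //; move: (pi_gt0 R) thc; clr; lra.
have final x w : c1 <= x -> w <= 1 - (th * s) ^+ 2 * sig2 / 2 -> w = w ->
  x * (1 - (th * s) ^+ 2 * sig2 / 2) + C * iN <=
  expR (- (th ^+ 2 * sig2 / 2 * s ^+ 2) + C / c1 * iN) * x.
  move=> cx _ _; apply: (@le_trans _ _ (x * (1 + (- (th ^+ 2 * sig2 / 2 * s ^+ 2) + C / c1 * iN)))).
    have : C * iN <= x * (C / c1 * iN).
      rewrite (_ : x * _ = x / c1 * (C * iN)); last by ring.
      by rewrite ler_peMl ?mulr_ge0 ?(ltW Cp) ?(ltW iNp)// ler_pdivlMr// mul1r.
    rewrite !mulrDr mulr1 exprMn; clr; lra.
  by rewrite mulrC ler_wpM2r ?expR_ge1Dx// (le_trans (ltW c1_gt0)).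
have err e : `|e| <= K0 * q -> 2 * (K0 * s) * `|e| + 10 * (K0 * s) ^+ 3 <= C * iN.
  move=> eq; have : 2 * (K0 * s) * `|e| <= 2 * (K0 * s) * (K0 * q).
    by rewrite ler_wpM2l// !mulr_ge0// ltW.
  have : 10 * (K0 * s) ^+ 3 <= 10 * K0 ^+ 3 * iN.
    by rewrite exprMn mulrA ler_wpM2l// mulr_ge0// exprn_ge0// ltW.
  have -> : 2 * (K0 * s) * (K0 * q) = 2 * K0 ^+ 2 * (q * s) by ring.
  by rewrite CE qiN; clr; lra.
have cosle : cos (th * s * dev kd h) <= 1 by apply: cos_le1.
have KiN : K / N = K0 * iN + K0 ^+ 2 * iN + C / c1 * iN + 1 / c1 * iN.
  by rewrite /K /iN; field; rewrite Nn0 gt_eqF.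
have c1iN : 0 <= 1 / c1 * iN by rewrite mulr_ge0 ?divr_ge0 ?(ltW c1_gt0) ?(ltW iNp).
have K0iN : 0 <= K0 * iN by rewrite mulr_ge0// ltW.
have K02iN : 0 <= K0 ^+ 2 * iN by rewrite mulr_ge0// ltW.
have expc1 : expR (- (1 / c1)) <= c1.
  rewrite expRN -[leRHS]invrK lef_pV2 ?posrE ?expR_gt0 ?invr_gt0//.
  by apply: le_trans (expR_ge1Dx _); rewrite div1r lerDr.
have dcons c' : 0 <= damped kd (th * s) (c' :: h).
  by apply: (damped_ge0 _ tha); [rewrite mulr_ge0// ltW|exact: dev_cons_le].
split=> //.
  case: kd ha xa cosge cosle dcons => ha xa cosge cosle dcons; rewrite /damped; last first.
    apply/andP; split.
      by apply: le_trans cosge; apply: le_trans expc1; rewrite ler_expR; move: KK0 (ltW K0p); clr; lra.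
    apply: (le_trans cosle); rewrite -expR0 ler_expR.
    have : 0 <= 1 / c1 by rewrite divr_ge0// ltW.
    by move: KK0 (ltW K0p); clr; lra.
  have Eb : `|devN h * added_mart h / (sig2 * balls h)| <= K0.
    rewrite normrM normfV (gtr0_norm (mulr_gt0 sig0 t0)) normrM.
    apply: (@le_trans _ _ ((c / s) * (4 * N * s) / (sig2 * (eps * N)))).
      apply: ler_pM; [by rewrite mulr_ge0|by rewrite invr_ge0 ltW|by rewrite ler_pM|].
      by rewrite lef_pV2 ?posrE// ler_pM2l.
    rewrite (_ : _ / _ = k6) // k6E.
    by move: Nn0 sn0 en0 sign0; clr => *; field; apply/and4P.
  move: Eb; rewrite ler_norml => /andP[Eb1 Eb2].
  rewrite /tilt; apply/andP; split.
    apply: (@le_trans _ _ (expR (- (1 / c1)) * expR (- K0))).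
      by rewrite -expRD ler_expR; move: KK0; clr; lra.
    by rewrite ler_pM ?expR_ge0// ?ler_expR; [apply: le_trans expc1 cosge|move: Eb2; clr; lra].
  apply: (@le_trans _ _ (1 * expR K0)).
    by rewrite ler_pM ?expR_ge0 ?ler_expR//; [apply: le_trans cosge; exact: ltW|move: Eb1; clr; lra].
  rewrite mul1r ler_expR.
  have : 0 <= 1 / c1 by rewrite divr_ge0// ltW.
  by move: KK0; clr; lra.
case: kd ha xa cosge cosle dcons => ha xa cosge cosle dcons; rewrite /damped; last first.
  have es : `|excess h / balls h| <= K0 * q.
    rewrite normrM normfV (gtr0_norm t0).
    apply: (@le_trans _ _ ((c / s + b) / balls h)).
      rewrite ler_wpM2r ?invr_ge0 ?(ltW t0)//.
      by apply: (le_trans (norm_excess_devY W0 B0 pW0 pW1 pB0 pB1 h)); rewrite lerD2r.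
    apply: (le_trans (divt _ (addr_ge0 cs0 bge0))).
    rewrite (_ : _ / _ = c / eps * q + b / eps * iN); last first.
      by rewrite /q /iN; move: Nn0 sn0 en0; clr => *; field; apply/and3P.
    have : b / eps * iN <= b / eps * q by rewrite ler_wpM2l ?divr_ge0// ltW.
    have : (c + b) / eps * q <= K0 * q.
      rewrite ler_wpM2r ?(ltW qp)//; apply: le_trans kk12; rewrite lerDl; exact: ltW.
    by rewrite !mulrDl; clr; lra.
  have esS : `|excess h / balls h| <= K0 * s.
    by apply: (le_trans es); rewrite ler_wpM2l// ltW.
  apply: (le_trans (next_mean_devY_cos W0_gt0 pW0 pW1 pB0 pB1 _ thK Ks1 tha ha esS)).
    by rewrite mulr_ge0// ltW.
  apply: (@le_trans _ _ (cos (th * s * devY h) * (1 - (th * s) ^+ 2 * sig2 / 2) + C * iN)).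
    by rewrite -addrA lerD2l err.
  apply: (le_trans (final _ _ cosge (lexx _) erefl)).
  rewrite ler_wpM2r ?(le_trans _ cosge) ?(ltW c1_gt0)// ler_expR lerD2l KiN; move: c1iN K0iN K02iN; clr; lra.
have esS : `|excess h / balls h| <= K0 * s.
  rewrite normrM normfV (gtr0_norm t0).
  apply: (@le_trans _ _ ((c / s + 4 * N * s + b) / balls h)).
    rewrite ler_wpM2r ?invr_ge0 ?(ltW t0)//.
    apply: (le_trans (norm_excess_devN W0 B0 pW0 pW1 pB0 pB1 h)).
    by rewrite !lerD.
  apply: (le_trans (divt _ _)); first by rewrite !addr_ge0.
  rewrite (_ : _ / _ = c / eps * q + 4 / eps * s + b / eps * iN); last first.
    by rewrite /q /iN; move: Nn0 sn0 en0; clr => *; field; apply/and3P.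
  have : b / eps * iN <= b / eps * s.
    by rewrite ler_wpM2l ?divr_ge0 ?(ltW e0)// (le_trans iNq).
  have : c / eps * q <= c / eps * s by rewrite ler_wpM2l ?divr_ge0 ?(ltW e0) ?(ltW c0).
  have : (c + b + 4) / eps * s <= K0 * s.
    by rewrite ler_wpM2r// -k1E.
  by rewrite !mulrDl; clr; lra.
have gs : `|added_mart h / (sig2 * (balls h + 1))| <= K0 * s.
  rewrite normrM normfV (gtr0_norm st1).
  apply: (@le_trans _ _ (4 * N * s / (sig2 * (eps * N)))).
    apply: ler_pM; [by []|by rewrite invr_ge0 ltW|by []|].
    by rewrite lef_pV2 ?posrE// ler_pM2l//; move: tN; clr; lra.
  rewrite (_ : _ / _ = k3 * s); first by rewrite ler_wpM2r.
  by rewrite k3E; move: Nn0 en0 sign0; clr => *; field; apply/and3P.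
have aeta : (c / s + 1) / (sig2 * balls h) <= K0 * q.
  apply: (@le_trans _ _ ((c / s + 1) / (sig2 * (eps * N)))).
    by rewrite ler_wpM2l ?addr_ge0// lef_pV2 ?posrE// ler_pM2l.
  rewrite (_ : _ / _ = c / (sig2 * eps) * q + 1 / (sig2 * eps) * iN); last first.
    by rewrite /q /iN; move: Nn0 sn0 en0 sign0; clr => *; field; apply/and4P.
  have : 1 / (sig2 * eps) * iN <= 1 / (sig2 * eps) * q.
    by rewrite ler_wpM2l ?divr_ge0// ltW.
  have : k4 * q <= K0 * q by rewrite ler_wpM2r ?(ltW qp).
  by rewrite k4E !mulrDl; clr; lra.
have eta2 : K0 * q <= 2^-1 by apply: le_trans sK; rewrite ler_wpM2l// ltW.
have HMz : `|devN h * added_mart h| / (sig2 * balls h * balls h) <= K0 * iN.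
  apply: (@le_trans _ _ (c / s * (4 * N * s) / (sig2 * (eps * N) * (eps * N)))).
    apply: ler_pM; [by []|by rewrite invr_ge0 ltW|by rewrite normrM ler_pM|].
    rewrite lef_pV2 ?posrE//; apply: ler_pM => //; try exact: ltW.
    by rewrite ler_pM2l.
  rewrite (_ : _ / _ = k5 * iN); first by rewrite ler_wpM2r ?(ltW iNp).
  by rewrite k5E /iN; move: Nn0 sn0 en0 sign0; clr => *; field; apply/and4P.
apply: (le_trans (next_mean_tilt W0_gt0 pW0 pW1 pB0 pB1 _ thK Ks1 tha ha esS gs aeta eta2 HMz)).
  by rewrite mulr_ge0// ltW.
(* The tilt removes [added_mart h / (balls h + 1)] from the drift, so [added_mart] survives only
   through the difference of [1 / balls h] and [1 / (balls h + 1)]. *)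
set e := excess h / balls h - _.
have eq : `|e| <= K0 * q.
  have -> : e = (rho * devN h + (W0%:R - (W0 + B0)%:R * v)) / balls h
      + added_mart h / (balls h * (balls h + 1)).
    rewrite /e excess_added_mart; move: (balls h) (b0 h) => t tp.
    by field; rewrite sign0 !gt_eqF// addr_gt0.
  apply: (le_trans (ler_normD _ _)).
  have E1 : `|(rho * devN h + (W0%:R - (W0 + B0)%:R * v)) / balls h| <= (c / s + b) / (eps * N).
    rewrite normrM normfV (gtr0_norm t0).
    apply: (le_trans _ (divt _ (addr_ge0 cs0 bge0))); rewrite ler_wpM2r ?invr_ge0 ?(ltW t0)//.
    by apply: (le_trans off); rewrite lerD2r.
  have E2 : `|added_mart h / (balls h * (balls h + 1))| <= 4 * N * s / (eps * N * (eps * N)).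
    rewrite normrM normfV (gtr0_norm tt1).
    apply: ler_pM; [by []|by rewrite invr_ge0 ltW|by []|].
    rewrite lef_pV2 ?posrE//; apply: ler_pM; rewrite ?(ltW eN0)//.
    by move: tN; clr; lra.
  apply: (le_trans (lerD E1 E2)).
  rewrite [leLHS](_ : _ = c / eps * q + b / eps * iN + k2 * (s * iN)); last first.
    by rewrite k2E /q /iN; move: Nn0 sn0 en0; clr => *; field; apply/and3P.
  have : b / eps * iN <= b / eps * q by rewrite ler_wpM2l ?divr_ge0// ltW.
  have : k2 * (s * iN) <= k2 * q.
    rewrite ler_wpM2l ?(ltW k2p)//; apply: le_trans iNq.
    by rewrite ler_piMl ?(ltW iNp).
  have : ((c + b) / eps + k2) * q <= K0 * q.
    by rewrite ler_wpM2r ?(ltW qp).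
  by rewrite !mulrDl; clr; lra.
rewrite /tilt.
apply: (@le_trans _ _ (expR (- (devN h * added_mart h / (sig2 * balls h)) + K0 * iN + (K0 * q) ^+ 2) *
  (expR (- (th ^+ 2 * sig2 / 2 * s ^+ 2) + C / c1 * iN) * cos (th * s * devN h)))).
  rewrite ler_wpM2l ?expR_ge0//; apply: le_trans (final _ _ cosge (lexx _) erefl).
  by rewrite -addrA lerD2l err.
rewrite [leLHS]mulrA [X in _ <= _ * X]mulrC [leRHS]mulrA.
rewrite ler_wpM2r ?(le_trans _ cosge) ?(ltW c1_gt0)// -!expRD ler_expR.
have : (K0 * q) ^+ 2 <= K0 ^+ 2 * iN by rewrite exprMn ler_wpM2l// ltW.
rewrite KiN; move: c1iN; clr; lra.
Qed.

End ConfinementUpper.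

(** * Exit of the martingale and the upper bound itself *)

Section ConfinementProbUpper.
Variables (R : realType) (W0 B0 : nat) (pW pB : R).
Hypothesis W0_gt0 : (0 < W0)%N.
Hypothesis pW0 : 0 < pW.
Hypothesis pW1 : pW < 1.
Hypothesis pB0 : 0 < pB.
Hypothesis pB1 : pB < 1.
Implicit Types (h : word).
Local Notation next_mean := (next_mean W0 B0 pW pB).
Local Notation mean_added := (mean_added pW pB).
Local Notation whites := (whites R W0).
Local Notation add_white_prob := (add_white_prob pW pB).
Local Notation word_prob := (word_prob W0 B0 pW pB).
Local Notation word_mean := (word_mean W0 B0 pW pB).
Local Notation sig2 := (limit_var pW pB).
Local Notation devN := (devN pW pB).
Local Notation devY := (devY W0 pW pB).
Local Notation added_mart := (added_mart W0 pW pB).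
Local Notation dev := (dev W0 pW pB).
Local Notation damped := (damped W0 B0 pW pB).

Lemma stay_and m (G1 G2 : pred word) h :
  stay m (fun h => G1 h && G2 h) h = stay m G1 h && stay m G2 h.
Proof.
elim: h => // c h IH /=; rewrite IH; case: (_ < _)%N => //=.
by case: (G1 _); case: (G2 _); rewrite /= ?andbF.
Qed.

Lemma stay_impl m (G1 G2 : pred word) h :
  (forall h, G1 h -> G2 h) -> stay m G1 h -> stay m G2 h.
Proof. by move=> G12 /stayP sG; apply/stayP => j jm; apply/G12/sG. Qed.

Lemma size_past m h : (m <= size h)%N -> size (past m h) = m.
Proof. by move=> mh; rewrite /past size_drop subKn. Qed.

Lemma next_mean_expR_added_mart eta h : `|eta| <= 2^-1 ->
  next_mean (fun h => expR (eta * added_mart h)) h <=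
  expR (eta * added_mart h) * expR (eta ^+ 2).
Proof.
move=> eta2.
have key (x : bool) : mean_added (fun h => expR (eta * added_mart h)) h x <=
    expR (eta * added_mart h) * expR (eta ^+ 2).
  rewrite /mean_added /= !added_mart_cons//= ?mulr1n ?mulr0n.
  rewrite [eta * (_ + (1 - _))]mulrDr [eta * (_ + (0 - _))]mulrDr !expRD.
  rewrite !(mulrCA (add_white_prob x)) (mulrCA (1 - _)) -mulrDr ler_wpM2l ?expR_ge0//.
  have := @mean_expR_added_le _ _ _ pW0 pW1 pB0 pB1 (- eta) x.
  by rewrite normrN sqrrN !mulNr !opprK => /(_ eta2).
have /andP[w0 w1] := white_prob01 R B0 W0_gt0 h.
apply: (le_trans (lerD (ler_wpM2l w0 (key true)) (ler_wpM2l _ (key false)))).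
  by rewrite subr_ge0.
by rewrite -mulrDl addrC subrK mul1r.
Qed.

Lemma added_mart_nil : added_mart [::] = 0.
Proof.
by rewrite /added_mart /devY /devN /whites /= addn0 mul0r !subr0 mulr0 subr0 subrr.
Qed.

Lemma added_mart_exit (eta B : R) n : `|eta| <= 2^-1 ->
  word_prob n (fun h => ~~ stay 0 (fun h => eta * added_mart h <= B) h) <=
  expR (eta ^+ 2 * n%:R - B).
Proof.
move=> eta2.
pose f h := expR (eta ^+ 2 * n%:R - B - eta ^+ 2 * (size h)%:R) * expR (eta * added_mart h).
pose G h := (size h == 0%N) || (eta * added_mart h <= B).
have e20 : 0 <= eta ^+ 2 by apply: sqr_ge0.
apply: (@le_trans _ _ (word_prob n (fun h => predT (past 0 h) && ~~ stay 0 G h))).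
  apply: word_prob_le => // h _; apply: contra => /stayP sG; apply/stayP => j /andP[j0 jh].
  have := sG j; rewrite j0 jh /G size_past// => /(_ isT).
  by rewrite (negbTE (lt0n_neq0 j0)).
pose phi (h : word) := size h == 0%N.
apply: (@le_trans _ _ (expR (eta ^+ 2 * n%:R - B) * word_prob 0 phi)); last first.
  by rewrite -[leRHS]mulr1 ler_wpM2l ?expR_ge0// word_prob_le1.
have phiG h : phi h -> G h by move=> /eqP h0; rewrite /G h0.
have f0 h : (0 <= size h <= n)%N -> 0 <= f h by rewrite mulr_ge0// expR_ge0.
have f1 h : (0 < size h <= n)%N -> ~~ G h -> 1 <= f h.
  move=> /andP[h0 hn]; rewrite /G negb_or -ltNge => /andP[_ Bh].
  rewrite /f -expRD -[leLHS]expR0 ler_expR.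
  have : eta ^+ 2 * (size h)%:R <= eta ^+ 2 * n%:R by rewrite ler_wpM2l// ler_nat.
  lra.
have f_super h : (0 <= size h < n)%N -> G h -> next_mean f h <= f h.
  move=> _ _; rewrite /f.
  pose e := expR (eta ^+ 2 * n%:R - B - eta ^+ 2 * (size h).+1%:R).
  apply: (@le_trans _ _ (next_mean (fun h => e * expR (eta * added_mart h)) h)).
    by apply: next_mean_le => // c; rewrite /e /f.
  rewrite next_meanZ; apply: (le_trans (ler_wpM2l _ (next_mean_expR_added_mart _ eta2))).
    exact: expR_ge0.
  rewrite mulrCA mulrC ler_wpM2r ?expR_ge0// /e -expRD ler_expR -(addn1 (size h)) natrD; lra.
have f_init h : size h = 0%N -> phi h -> f h <= expR (eta ^+ 2 * n%:R - B).
  case: h => //= _ _.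
  by rewrite /f added_mart_nil !mulr0 subr0 expR0 mulr1.
apply: (le_trans _ (exit_prob_le W0_gt0 pW0 pW1 pB0 pB1
  (leq0n n) phiG f0 f1 f_super f_init)).
by apply: word_prob_le => // h _ /andP[_ ->]; rewrite /phi size_past.
Qed.

(** Take [eta = 2 * s] up to sign and [B = 8 * N * s ^+ 2]. When [N * s ^+ 2] is [lnln n], the bound
    is [2 * (ln n) ^ (- 4)], more than summable along geometric times. *)
Lemma added_mart_exit_abs (N s : R) n : N = n%:R -> 0 < s -> 4 * s <= 1 ->
  word_prob n (fun h => ~~ stay 0 (fun h => `|added_mart h| <= 4 * N * s) h) <=
  2 * expR (- (4 * (N * s ^+ 2))).
Proof.
move=> -> s0 s1.
have exit sg : `|sg| = 1 :> R -> word_prob n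
    (fun h => ~~ stay 0 (fun h => sg * 2 * s * added_mart h <= 8 * n%:R * s ^+ 2) h)
    <= expR (- (4 * (n%:R * s ^+ 2))).
  move=> sg1; apply: (le_trans (added_mart_exit _ _ _)).
    by rewrite !normrM sg1 !ger0_norm//; lra.
  have sg2 : sg ^+ 2 = 1 by rewrite -[LHS]ger0_norm ?sqr_ge0// normrX sg1 expr1n.
  by rewrite ler_expR !exprMn sg2; lra.
apply: (@le_trans _ _ (word_prob n (fun h =>
    ~~ stay 0 (fun h => 1 * 2 * s * added_mart h <= 8 * n%:R * s ^+ 2) h ||
    ~~ stay 0 (fun h => - 1 * 2 * s * added_mart h <= 8 * n%:R * s ^+ 2) h))).
  apply: word_prob_le => // h _; rewrite -negb_and; apply: contra.
  rewrite -stay_and; apply: stay_impl => h' /andP[h1 h2].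
  have s2 : 0 < 2 * s by lra.
  have e8 : 8 * n%:R * s ^+ 2 = 2 * s * (4 * n%:R * s) by ring.
  rewrite ler_norml lerNl; move: h1 h2.
  by rewrite e8 mul1r !mulNr mul1r -mulrN !ler_pM2l// => -> ->.
apply: (le_trans (@word_probU R W0 B0 pW pB W0_gt0 pW0 pW1 pB0 pB1 n _ _)).
have e1 := exit 1 (normr1 R); have e2 := exit (- 1) (normrN1 R).
by apply: (le_trans (lerD e1 e2)); lra.
Qed.

(** Of the three factors [1 - delta], two come from the frequency, kept below [pi / (2 * c)], and
    one from the first [delta * n] stages, which are discarded. One [K] bounds [damped] from above
    at the start, one bounds it from below at the end, and one collects the errors [K / n] of the
    steps. *)
Lemma confinement_upper (c delta : R) : 0 < c -> 0 < delta < 1 ->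
  exists K s0 : R, 0 < s0 /\ forall kd n s,
    0 < s <= s0 -> 1 <= n%:R * s ^+ 2 -> n%:R * s ^+ 3 <= 1 ->
    word_prob n (stay 0 (fun h => `|dev kd h| <= c / s)) <=
    expR (K - (1 - delta) ^+ 3 * (pi ^+ 2 * sig2 / (8 * c ^+ 2)) * (n%:R * s ^+ 2))
    + 2 * expR (- (4 * (n%:R * s ^+ 2))).
Proof.
move=> c0 /andP[d0 d1]; have pi0 := pi_gt0 R.
pose th := (1 - delta) * pi / (2 * c).
have th0 : 0 < th by rewrite divr_gt0 ?mulr_gt0// subr_gt0.
have thcE : th * c = (1 - delta) * (pi / 2) by rewrite /th; field; rewrite gt_eqF.
have thc : th * c < pi / 2.
  by rewrite thcE gtr_pMl ?divr_gt0// gtrBl.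
have [K [s0 [K0 s00 step]]] := @damped_step R W0 B0 pW pB W0_gt0 pW0 pW1 pB0 pB1 c delta th c0 d0 th0 thc.
exists (K + K + K), (Num.min s0 (Num.min delta 4^-1)); split.
  by rewrite !lt_min s00 d0 invr_gt0 ltr0n.
move=> kd n s /andP[sp]; rewrite !le_min => /and3P[ss0 sd s4] ns2 ns3.
have n0 : 0 < n%:R :> R.
  rewrite ltr0n lt0n; apply/negP => /eqP nE.
  by move: ns2; rewrite nE mul0r ler10.
have ss : 0 < s <= s0 by rewrite sp.
pose m := Num.truncn (delta * n%:R).
have dn0 : 0 <= delta * n%:R by rewrite mulr_ge0// ltW.
have /andP[mdn dnm] := truncn_itv dn0; rewrite -/m in mdn dnm.
have mn : (m <= n)%N by rewrite -(ler_nat R) (le_trans mdn)// ler_piMl// ltW.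
have m0 : (0 < m)%N.
  rewrite truncn_gt0; apply: (le_trans ns2); rewrite mulrC ler_wpM2r//.
  by apply: le_trans sd; rewrite expr2 ler_piMr ?(ltW sp)//; lra.
pose G1 h := `|dev kd h| <= c / s.
pose GM h := `|added_mart h| <= 4 * n%:R * s.
pose G h := G1 h && GM h.
have bounds h : (m <= size h)%N -> G h ->
   [/\ expR (- K) <= damped kd (th * s) h <= expR K,
        forall c, 0 <= damped kd (th * s) (c :: h) &
        next_mean (damped kd (th * s)) h <=
          expR (- (th ^+ 2 * sig2 / 2 * s ^+ 2) + K / n%:R) * damped kd (th * s) h].
  move=> mh /andP[h1 h2]; apply: step => //.
  (* The truncation may leave [m] less than one unit below [delta * n]; the initial balls make up
     for it. *)
  apply/ltW/(lt_le_trans dnm); rewrite ler_nat.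
  by rewrite (leq_ltn_trans mh)// -[X in (X < _)%N]add0n ltn_add2r addn_gt0 W0_gt0.
set lam := expR (- (th ^+ 2 * sig2 / 2 * s ^+ 2) + K / n%:R) in bounds.
have super := @stay_supersolution R W0 B0 pW pB W0_gt0 pW0 pW1 pB0 pB1 m n G G
  (damped kd (th * s)) lam mn (expR_ge0 _) (fun _ x => x) _.
have {super} : word_mean n (fun h => (G (past m h) && stay m G h)%:R * damped kd (th * s) h)
    <= lam ^+ (n - m) * expR K.
  apply: (le_trans (super _)).
    move=> h /andP[mh _] Gh; have [_ pos sup] := bounds h mh Gh.
    apply: le_trans sup; apply: next_mean_le => // c'.
    by case: (G _); rewrite ?mul1r// mul0r.
  rewrite ler_wpM2l ?exprn_ge0 ?expR_ge0// -[leRHS](@word_mean_cst R W0 B0 pW pB W0_gt0 pW0 pW1 pB0 pB1 m).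
  apply: word_mean_le => // h hm; case: (boolP (G h)) => Gh; last by rewrite mul0r expR_ge0.
  by rewrite mul1r; have [|/andP[_ ->]//] := bounds h _ Gh; rewrite hm.
move=> super.
have stayG : word_prob n (stay 0 G) <= expR K * (lam ^+ (n - m) * expR K).
  apply: (le_trans _ (ler_wpM2l (expR_ge0 K) super)).
  rewrite -word_meanZ//; apply: word_mean_le => // h hn.
  case: (boolP (stay 0 G h)) => [sG|_]; last first.
    case: (boolP (_ && _)) => [sG|_]; last by rewrite mul0r mulr0.
    have Gh : G h by apply: (@stay_last m G h G) => //; rewrite hn.
    rewrite mul1r mulr_ge0 ?expR_ge0//.
    by have [|/andP[+ _] _ _] := bounds h _ Gh; [rewrite hn|apply: le_trans; exact: expR_ge0].
  have Gj j : (0 < j <= size h)%N -> G (past j h) by move/stayP: sG; apply.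
  have -> : G (past m h) by apply: Gj; rewrite m0 hn.
  have -> : stay m G h.
    by apply/stayP => j /andP[mj jh]; apply: Gj; rewrite jh (leq_trans _ mj).
  have Gh : G h by rewrite -[h]past_size Gj// leqnn hn (leq_trans m0).
  rewrite mul1r; have [|/andP[low _] _ _] := bounds h _ Gh; first by rewrite hn.
  apply: (le_trans _ (ler_wpM2l (expR_ge0 K) low)).
  by rewrite -expRD subrr expR0.
have s1 : 4 * s <= 1 by lra.
have exitM := added_mart_exit_abs (erefl n%:R) sp s1.
apply: (le_trans _ (lerD (le_trans stayG _) exitM)); last first.
  rewrite /lam -expRM_natr -!expRD ler_expR natrB//.
  set A := pi ^+ 2 * sig2 / _.
  have thE : th ^+ 2 * sig2 / 2 = (1 - delta) ^+ 2 * A.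
    by rewrite /th /A; field; rewrite gt_eqF.
  have A0 : 0 <= (1 - delta) ^+ 2 * A * s ^+ 2.
    have sig0 : 0 <= sig2 by apply: ltW; exact: limit_var_gt0.
    apply: mulr_ge0 (sqr_ge0 s); apply: (mulr_ge0 (sqr_ge0 _)).
    exact: divr_ge0 (mulr_ge0 (sqr_ge0 _) sig0) (mulr_ge0 (ler0n _ 8) (sqr_ge0 _)).
  have KK : K / n%:R * (n%:R - m%:R) <= K.
    rewrite -mulrA ler_piMr ?(ltW K0)// ler_pdivrMl// mulr1.
    by rewrite gerBl.
  have : (1 - delta) ^+ 2 * A * s ^+ 2 * ((1 - delta) * n%:R) <=
         (1 - delta) ^+ 2 * A * s ^+ 2 * (n%:R - m%:R).
    by rewrite ler_wpM2l//; lra.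
  rewrite thE; lra.
apply: (@le_trans _ _ (word_prob n (fun h => stay 0 G h || ~~ stay 0 GM h))).
  apply: word_prob_le => // h _ sG1; rewrite /G stay_and sG1/=.
  by case: (stay 0 GM h).
by apply: (@word_probU R W0 B0 pW pB W0_gt0 pW0 pW1 pB0 pB1 n).
Qed.

End ConfinementProbUpper.

(** * The Lyapunov function *)

Section DriftAlgebra.
Variable R : realType.
Implicit Types al t x y r C : R.

Lemma drift_cross al t x y : 0 < al -> 0 < t ->
  2 * (y * x) <= al / t * y ^+ 2 + al^-1 / t * (x * t) ^+ 2.
Proof.
move=> al0 t0.
have : 0 <= al / t * (y - x * t / al) ^+ 2.
  by apply: mulr_ge0 (sqr_ge0 _); apply: divr_ge0; exact: ltW.
have -> : al / t * (y - x * t / al) ^+ 2 =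
    al / t * y ^+ 2 + al^-1 / t * (x * t) ^+ 2 - 2 * (y * x).
  by field; rewrite !gt_eqF.
by rewrite subr_ge0.
Qed.

Lemma drift_excess al r C t x : t != 0 ->
  C * (2 * (r * (x * t * x))) + C * (al - 2 * r) / t * (x * t) ^+ 2 =
  al / t * (C * (x * t) ^+ 2).
Proof. by move=> t0; field. Qed.

Lemma drift_const C al u ua : u != 0 -> ua != 0 -> 1 - al != 0 ->
  2 * (1 + C) / (1 - al) * (u / ua * ((1 - al) / u / 2)) = ua^-1 * (1 + C).
Proof. by move=> u0 ua0 al0; field; rewrite u0 ua0 al0. Qed.

End DriftAlgebra.

Section Lyapunov.
Variables (R : realType) (W0 B0 : nat) (pW pB : R).
Hypothesis W0_gt0 : (0 < W0)%N.
Hypothesis B0_gt0 : (0 < B0)%N.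
Hypothesis pW0 : 0 < pW.
Hypothesis pW1 : pW < 1.
Hypothesis pB0 : 0 < pB.
Hypothesis pB1 : pB < 1.
Implicit Types (h : word).
Local Notation next_mean := (next_mean W0 B0 pW pB).
Local Notation mean_added := (mean_added pW pB).
Local Notation white_prob := (white_prob R W0 B0).
Local Notation balls := (balls R W0 B0).
Local Notation add_white_prob := (add_white_prob pW pB).
Local Notation word_prob := (word_prob W0 B0 pW pB).
Local Notation rho := (rho pW pB).
Local Notation v := (limit_frac pW pB).
Local Notation devN := (devN pW pB).
Local Notation excess := (excess W0 B0 pW pB).
Hypothesis rho_half : rho < 2^-1.

Let b0 h : 0 < balls h. Proof. exact: balls_gt0. Qed.
Let v0 : 0 < v. Proof. by have /andP[] := limit_frac01 pW0 pW1 pB0 pB1. Qed.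
Let v1 : v < 1. Proof. by have /andP[] := limit_frac01 pW0 pW1 pB0 pB1. Qed.

(* The drift makes [lyap] grow like [balls ^ lyap_exp], which is dominated by the linear
   contribution of the noise because [lyap_exp < 1]; this is where [rho < 1 / 2] enters. *)
Definition lyap_exp : R := (1 + Num.max (2 * rho) 0) / 2.
Local Notation alpha := lyap_exp.

Lemma lyap_exp_bounds : [/\ 0 < alpha, alpha < 1 & 2 * rho < alpha].
Proof.
rewrite /alpha; move: rho_half; case: (leP (2 * rho) 0) => r0 rh; split; lra.
Qed.

Let a0 : 0 < alpha. Proof. by have [] := lyap_exp_bounds. Qed.
Let a1 : alpha < 1. Proof. by have [] := lyap_exp_bounds. Qed.
Let ar : 2 * rho < alpha. Proof. by have [] := lyap_exp_bounds. Qed.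

(* Chosen so that the cross term produced by the drift of [devN] is absorbed by the
   arithmetic-geometric inequality. *)
Definition lyap_coef : R := (alpha * (alpha - 2 * rho))^-1.
Local Notation C := lyap_coef.

Lemma lyap_coef_gt0 : 0 < C.
Proof. by rewrite invr_gt0 mulr_gt0// subr_gt0. Qed.

Definition lyap h : R := devN h ^+ 2 + C * excess h ^+ 2.

Lemma next_mean_lyap h : next_mean lyap h <= (1 + alpha / balls h) * lyap h + (1 + C).
Proof.
have C0 := lyap_coef_gt0.
have CE : C * (alpha - 2 * rho) = alpha^-1.
  rewrite /C invfM -mulrA mulVf ?mulr1// gt_eqF// subr_gt0; exact: ar.
have := white_prob_drift B0 pW pB W0_gt0 h; set e := excess h; set t := balls h => wE.
have t0 : 0 < t := b0 h.
have /andP[w0 w1] := white_prob01 R B0 W0_gt0 h.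
set w := white_prob h in wE w0 w1.
rewrite /next_mean /mean_added /lyap !devN_cons !excess_cons !add_white_probE//= -/e -/w.
rewrite ?mulr1n ?mulr0n.
set H := devN h; have V0 := v0; have V1 := v1.
set x := w - v in wE; have xE : w = x + v by rewrite /x; ring.
have et : e = x * t by rewrite wE mulfVK// gt_eqF.
have r1 : `|rho| <= 1 by apply: rho_norm.
have -> : w * ((v + rho * (1 - v)) * ((H + (1 - v)) ^+ 2 + C * (e + (1 - v)) ^+ 2) +
   (1 - (v + rho * (1 - v))) * ((H + (1 - v)) ^+ 2 + C * (e + (0 - v)) ^+ 2)) +
  (1 - w) * ((v + rho * (0 - v)) * ((H + (0 - v)) ^+ 2 + C * (e + (1 - v)) ^+ 2) +
   (1 - (v + rho * (0 - v))) * ((H + (0 - v)) ^+ 2 + C * (e + (0 - v)) ^+ 2)) =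
  H ^+ 2 + 2 * (H * x) + (w * (1 - v) ^+ 2 + (1 - w) * v ^+ 2)
  + C * (e ^+ 2 + 2 * (rho * (e * x)) + ((v + rho * x) * (1 - v) ^+ 2 + (1 - (v + rho * x)) * v ^+ 2)).
  by rewrite xE; ring.
have p0 : 0 <= v + rho * x <= 1.
  have /andP[q0 q1] := add_white_prob01 pW0 pW1 pB0 pB1 true.
  have /andP[q2 q3] := add_white_prob01 pW0 pW1 pB0 pB1 false.
  have -> : v + rho * x = add_white_prob true * w + add_white_prob false * (1 - w).
    by rewrite !add_white_probE// /x /= ?mulr1n ?mulr0n; ring.
  move: w0 w1 q0 q1 q2 q3; move: (add_white_prob _) (add_white_prob _) w {wE xE x et} => p q w.
  by move=> *; apply/andP; split; nra.
have var y : 0 <= y <= 1 -> y * (1 - v) ^+ 2 + (1 - y) * v ^+ 2 <= 1.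
  move=> /andP[y0 y1]; have : v ^+ 2 <= 1 by rewrite expr_le1// ltW.
  have : (1 - v) ^+ 2 <= 1 by rewrite expr_le1//; move: V0 V1; lra.
  by move: y0 y1; move: (v ^+ 2) ((1 - v) ^+ 2) => *; nra.
have var1 := var w; have var2 := ler_wpM2l (ltW C0) (var _ p0).
have {var1} var1 := var1 (introT andP (conj w0 w1)).
have cross : 2 * (H * x) <= alpha / t * H ^+ 2 + alpha^-1 / t * e ^+ 2.
  rewrite et; exact: drift_cross.
(* By the choice of [C], the coefficient of [e ^+ 2] is exactly the one that growth at rate
   [alpha / t] allows. *)
have ee : C * (2 * (rho * (e * x))) + alpha^-1 / t * e ^+ 2 = alpha / t * (C * e ^+ 2).
  by rewrite -CE et; apply: drift_excess; rewrite gt_eqF.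
move: var1 var2 cross ee.
set V1' := _ + _ * v ^+ 2; set V2' := _ + _ * v ^+ 2.
rewrite (mulrDl 1 (alpha / t)) mul1r [alpha / t * (_ + _)]mulrDr.
rewrite !(mulrDr C); lra.
Qed.

Lemma powR_pred_le (u beta : R) : 1 < u -> 0 <= beta ->
  (u - 1) `^ beta <= u `^ beta * expR (- (beta / u)).
Proof.
move=> u1 be0; have u0 : 0 < u by lra.
rewrite /powR !gt_eqF ?subr_gt0// -expRD ler_expR -mulrN -mulrDr ler_wpM2l//.
have -> : u - 1 = u * (1 - u^-1) by rewrite mulrBr mulr1 divff// gt_eqF.
have u1' : u^-1 < 1 by rewrite invf_lt1.
rewrite lnM ?posrE ?subr_gt0// lerD2l.
by apply: le_ln1Dx; rewrite ltrNl opprK.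
Qed.

(** With this factor the increment of [balls] to the power [1 - alpha] over one step dominates the
    noise [1 + C]. The 2 comes from the crude bound [expR (- z) <= 1 - z / 2]. *)
Definition lyap_rest : R := 2 * (1 + C) / (1 - alpha).
Local Notation Kc := lyap_rest.

Lemma lyap_rest_gt0 : 0 < Kc.
Proof.
have C0 := lyap_coef_gt0.
by rewrite divr_gt0 ?subr_gt0 ?mulr_gt0// addr_gt0.
Qed.

(** Variation of constants in [next_mean_lyap]: [f] divides [lyap] by its homogeneous growth and
    adds the noise still to come before the horizon [N]. The prefactor makes [f] at least 1 once
    [lyap] exceeds [x]. Powers are taken of [balls - 1] so that after one step the base is the
    present [balls]. *)
Lemma lyap_exit m n (phi : pred word) (x y N : R) : (m <= n)%N -> 0 < x ->
  N = (W0 + B0 + n)%:R - 1 ->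
  (forall h, phi h -> lyap h <= x) ->
  (forall h, size h = m -> phi h -> lyap h <= y) ->
  word_prob n (fun h => phi (past m h) && ~~ stay m (fun h => lyap h <= x) h) <=
  (N `^ alpha / ((W0 + B0 + m)%:R - 1) `^ alpha * y + Kc * N) / x * word_prob m phi.
Proof.
move=> mn x0 NE phix phiy.
have C0 := lyap_coef_gt0.
have Kc0 := lyap_rest_gt0.
have bal1 h : 1 <= balls h - 1.
  rewrite lerBrDr -(natrD _ 1 1) ler_nat -(addn0 (1 + 1)%N) leq_add//.
  exact: leq_add W0_gt0 B0_gt0.
have bal0 h : 0 < balls h - 1 by apply: lt_le_trans (bal1 h).
pose tp h := (balls h - 1) `^ alpha.
pose tq h := (balls h - 1) `^ (1 - alpha).
have tp0 h : 0 < tp h by apply: powR_gt0.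
pose f h := N `^ alpha * (lyap h / tp h + Kc * (N `^ (1 - alpha) - tq h)) / x.
have ballsN h : (size h <= n)%N -> balls h - 1 <= N by move=> hn; rewrite NE lerD2r ler_nat leq_add2l.
have lyap0 h : 0 <= lyap h by rewrite addr_ge0 ?sqr_ge0// mulr_ge0 ?sqr_ge0// ltW.
have N0 : 0 < N by have := bal0 (nseq n (true, true)); rewrite /balls size_nseq NE.
have Na0 : 0 < N `^ alpha by apply: powR_gt0.
have rest h : (size h <= n)%N -> 0 <= N `^ (1 - alpha) - tq h.
  move=> hn; rewrite subr_ge0 ge0_ler_powR ?nnegrE ?subr_ge0 ?(ltW (bal0 h)) ?(ltW N0) ?(ltW a1)//.
    by have := bal1 h; lra.
  exact: ballsN.
have f0 h : (m <= size h <= n)%N -> 0 <= f h.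
  move=> /andP[_ hn]; rewrite /f mulr_ge0 ?invr_ge0 ?(ltW x0)// mulr_ge0 ?(ltW Na0)//.
  by rewrite addr_ge0 ?divr_ge0 ?(ltW (tp0 h))// mulr_ge0 ?(ltW Kc0)// rest.
have f1 h : (m < size h <= n)%N -> ~~ (lyap h <= x) -> 1 <= f h.
  move=> /andP[_ hn]; rewrite -ltNge => xl.
  rewrite /f ler_pdivlMr// mul1r; apply: (le_trans (ltW xl)).
  rewrite mulrDr mulrA; apply: ler_wpDr.
    by apply: mulr_ge0; [exact: ltW|apply: mulr_ge0; [exact: ltW|exact: rest]].
  rewrite ler_pdivlMr// mulrC ler_wpM2r// ge0_ler_powR ?nnegrE ?(ltW a0) ?(ltW (bal0 h)) ?(ltW N0)//.
  exact: ballsN.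
have f_super h : (m <= size h < n)%N -> lyap h <= x -> next_mean f h <= f h.
  move=> /andP[_ hn] _.
  pose u := balls h; have u1 : 1 < u by have := bal0 h; rewrite /u; lra.
  have u0 : 0 < u by lra.
  pose e := N `^ alpha / x.
  apply: (@le_trans _ _ (next_mean (fun h' => e / u `^ alpha * lyap h' +
     e * (Kc * (N `^ (1 - alpha) - u `^ (1 - alpha)))) h)).
    apply: next_mean_le => // c; rewrite /f /tp /tq balls_cons addrK -/u /e.
    by rewrite le_eqVlt; apply/orP; left; apply/eqP; ring.
  rewrite next_meanD next_meanZ next_mean_cst.
  have e0 : 0 < e by rewrite divr_gt0.
  have ua0 : 0 < u `^ alpha by rewrite powR_gt0.
  have -> : f h = e * (lyap h / tp h + Kc * (N `^ (1 - alpha) - tq h)) by rewrite /f /e; ring.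
  rewrite -mulrA -mulrDr ler_pM2l//.
  apply: (le_trans (lerD (ler_wpM2l _ (next_mean_lyap h)) (lexx _))).
    by rewrite invr_ge0 ltW.
  rewrite -/u.
  have c1 : (u `^ alpha)^-1 * ((1 + alpha / u) * lyap h) <= lyap h / tp h.
    rewrite mulrA [leRHS]mulrC ler_wpM2r// ler_pdivrMl// ler_pdivlMr//.
    have := powR_pred_le u1 (ltW a0); rewrite -/(tp h) => le1.
    have le2 : 1 + alpha / u <= expR (alpha / u) by apply: expR_ge1Dx.
    have g1 : 0 <= 1 + alpha / u.
      by apply: addr_ge0 => //; apply: divr_ge0; apply: ltW => //; exact: a0.
    apply: (le_trans (ler_pM g1 (ltW (tp0 h)) le2 le1)).
    by rewrite mulrCA expRN divff ?mulr1// gt_eqF// expR_gt0.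
  have c2 : (u `^ alpha)^-1 * (1 + C) <= Kc * (u `^ (1 - alpha) - tq h).
    have b1 : 0 <= 1 - alpha by rewrite subr_ge0 ltW.
    have := powR_pred_le u1 b1; rewrite -/(tq h) => le1.
    have ub0 : 0 < u `^ (1 - alpha) by rewrite powR_gt0.
    have uE : u `^ (1 - alpha) = u / u `^ alpha.
      by rewrite powRB ?powRr1// ?(ltW u0)// gt_eqF// implybT.
    set z := (1 - alpha) / u in le1.
    have z0 : 0 <= z by rewrite divr_ge0// ltW.
    have z1 : z <= 1 by rewrite ler_pdivrMr// mul1r; have := a0; lra.
    have le2 : expR (- z) <= 1 - z / 2.
      apply: (le_trans (expRN_le_quadratic z0)); rewrite expr2.
      have : z * z <= z * 1 by rewrite ler_wpM2l.
      lra.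
    have le3 : u `^ (1 - alpha) * (z / 2) <= u `^ (1 - alpha) - tq h.
      have := ler_wpM2l (ltW ub0) le2; lra.
    apply: (le_trans _ (ler_wpM2l (ltW Kc0) le3)).
    have -> : Kc * (u `^ (1 - alpha) * (z / 2)) = (u `^ alpha)^-1 * (1 + C).
      by rewrite uE; apply: drift_const; rewrite gt_eqF// subr_gt0; exact: a1.
    exact: lexx.
  rewrite mulrDr; lra.
have f_init h : size h = m -> phi h ->
    f h <= (N `^ alpha / ((W0 + B0 + m)%:R - 1) `^ alpha * y + Kc * N) / x.
  move=> hm ph; rewrite /f ler_wpM2r ?invr_ge0 ?(ltW x0)// mulrDr.
  have hb : balls h = (W0 + B0 + m)%:R by rewrite /balls hm.
  apply: lerD.
    rewrite /tp hb mulrCA [leRHS]mulrC ler_wpM2r// ?phiy//.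
    by rewrite divr_ge0 ?powR_ge0.
  rewrite mulrCA ler_wpM2l ?(ltW Kc0)// mulrBr -powRD ?(addrC alpha) ?subrK ?powRr1 ?(ltW N0)//.
    by rewrite gerBl mulr_ge0 ?powR_ge0.
  by rewrite gt_eqF// implybT.
exact: (exit_prob_le W0_gt0 pW0 pW1 pB0 pB1 mn phix f0 f1 f_super f_init).
Qed.

Lemma lyap_exit_root : exists2 K : R, 0 < K & forall n (x : R), (0 < n)%N -> 0 < x ->
  word_prob n (fun h => ~~ stay 0 (fun h => lyap h <= x) h) <= K * n%:R / x.
Proof.
have C0 := lyap_coef_gt0; have Kc0 := lyap_rest_gt0.
set y := lyap [::].
have y0 : 0 <= y by rewrite addr_ge0 ?sqr_ge0// mulr_ge0 ?sqr_ge0// ltW.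
set b : R := (W0 + B0)%:R.
have b2 : 2 <= b by rewrite ler_nat (leq_add W0_gt0 B0_gt0).
exists ((y + Kc) * b) => [|n x n0 x0].
  by rewrite mulr_gt0//; lra.
have n1 : 1 <= n%:R :> R by rewrite ler1n.
(* If [x] is below the initial value [y], the right-hand side is at least 1. *)
have [yx|/ltW xy] := leP y x; last first.
  have p1 g : word_prob n g <= 1 by apply: word_prob_le1.
  apply: (le_trans (p1 _)).
  rewrite ler_pdivlMr// mul1r; apply: (le_trans xy).
  have : y * 1 <= y * (b * n%:R) by rewrite ler_wpM2l// mulr_ege1//; lra.
  have : 0 <= Kc * (b * n%:R) by rewrite mulr_ge0 ?(ltW Kc0)// mulr_ge0//; lra.
  lra.
pose phi (h : word) := size h == 0%N.
have phix h : phi h -> lyap h <= x by case: h.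
have phiy h : size h = 0%N -> phi h -> lyap h <= y by case: h.
have := lyap_exit (leq0n n) x0 erefl phix phiy; rewrite addn0.
set N := (_ + n)%:R - 1.
have N1 : 1 <= N by rewrite /N natrD -/b; lra.
have Nbn : N <= b * n%:R.
  rewrite /N natrD -/b; have : 0 <= (b - 1) * (n%:R - 1) by rewrite mulr_ge0//; lra.
  by rewrite mulrBl !mulrBr; lra.
have Na : N `^ alpha / (b - 1) `^ alpha <= N.
  rewrite ler_pdivrMr ?powR_gt0//; last lra.
  rewrite -[leLHS]mulr1; apply: ler_pM; rewrite ?powR_ge0//.
    by apply: ler1_powR => //; apply: ltW; exact: a1.
  have one_alpha : 1 `^ alpha = 1 :> R by rewrite powR1.
  rewrite -[X in X <= _]one_alpha.
  by apply: ge0_ler_powR; rewrite ?nnegrE ?(ltW a0)//; lra.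
set p0 := word_prob 0 phi => exit.
have p01 : p0 <= 1 by apply: word_prob_le1.
have p00 : 0 <= p0 by apply: word_prob_ge0.
apply: (@le_trans _ _ ((N * y + Kc * N) / x)); last first.
  rewrite ler_pM2r ?invr_gt0// -mulrA (mulrC N) -mulrDl ler_wpM2l//.
  by rewrite addr_ge0// ltW.
apply: (@le_trans _ _ ((N `^ alpha / (b - 1) `^ alpha * y + Kc * N) / x * p0)).
  apply: le_trans exit; apply: word_prob_le => // h _ ->.
  by rewrite /phi size_past.
apply: (@le_trans _ _ ((N * y + Kc * N) / x * p0)).
  rewrite ler_wpM2r// ler_pM2r ?invr_gt0// lerD2r.
  by rewrite ler_wpM2r.
rewrite ler_piMr// divr_ge0 ?(ltW x0)//.
by rewrite addr_ge0// mulr_ge0// ?(ltW Kc0)//; lra.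
Qed.

End Lyapunov.

(** * Lower bound on the confinement probability *)

Section ConfinementLower.
Variables (R : realType) (W0 B0 : nat) (pW pB : R).
Hypothesis W0_gt0 : (0 < W0)%N.
Hypothesis pW0 : 0 < pW.
Hypothesis pW1 : pW < 1.
Hypothesis pB0 : 0 < pB.
Hypothesis pB1 : pB < 1.
Implicit Types (h : word) (kappa theta : R) (kd : bool).
Local Notation next_mean := (next_mean W0 B0 pW pB).
Local Notation mean_added := (mean_added pW pB).
Local Notation white_prob := (white_prob R W0 B0).
Local Notation balls := (balls R W0 B0).
Local Notation add_white_prob := (add_white_prob pW pB).
Local Notation word_prob := (word_prob W0 B0 pW pB).
Local Notation word_mean := (word_mean W0 B0 pW pB).
Local Notation rho := (rho pW pB).
Local Notation v := (limit_frac pW pB).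
Local Notation sig2 := (limit_var pW pB).
Local Notation devN := (devN pW pB).
Local Notation devY := (devY W0 pW pB).
Local Notation excess := (excess W0 B0 pW pB).
Local Notation added_mart := (added_mart W0 pW pB).
Local Notation dev := (dev W0 pW pB).

Let b0 h : 0 < balls h. Proof. exact: balls_gt0. Qed.
Let sig0 : 0 < sig2. Proof. by apply: limit_var_gt0. Qed.
Let v0 : 0 < v. Proof. by have /andP[] := limit_frac01 pW0 pW1 pB0 pB1. Qed.
Let v1 : v < 1. Proof. by have /andP[] := limit_frac01 pW0 pW1 pB0 pB1. Qed.

(** For [devN] the martingale is confined too, as it enters the drift. Its strip will be wider by a
    factor [K] ([theta' = theta / K]), at the price of [1 / K ^+ 2] in the rate. *)
Definition bump_dev kd kappa theta (theta' : R) h : R :=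
  cos_bump kappa (theta * dev kd h) *
  (if kd then cos_bump kappa (theta' * added_mart h) else 1).

Definition in_strip kd theta (theta' : R) : pred word := fun h =>
  (`|theta * dev kd h| < pi / 2) && (kd ==> (`|theta' * added_mart h| < pi / 2)).

(** The rate in [cos_bump_step] per unit of variance and of [theta ^+ 2]; the cosine alone has
    [2^-1]. *)
Definition bump_rate (kappa : R) : R := 2^-1 + 4 * kappa + 4 * kappa ^+ 2.

Lemma bump_rate_gt0 kappa : 0 < kappa -> 0 < bump_rate kappa.
Proof.
by move=> k0; rewrite /bump_rate; have := exprn_gt0 2 k0; move: k0; lra.
Qed.

(** Because of the cut-off, killing the walk outside the strip costs nothing. *)
Lemma in_strip_bump_dev kd kappa theta theta' h :
  (in_strip kd theta theta' h)%:R * bump_dev kd kappa theta theta' h =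
  bump_dev kd kappa theta theta' h.
Proof.
rewrite /in_strip /bump_dev; case: ltP => [_|x2] /=; last first.
  by rewrite mul0r /cos_bump ltNge x2 mul0r.
case: kd => /=; last by rewrite mul1r.
case: ltP => [_|x2]; first by rewrite mul1r.
by rewrite mul0r [X in _ * X]/cos_bump ltNge x2 mulr0.
Qed.

(** A lower bound, uniform in the colour drawn, for the variance of the added ball. *)
Definition min_add_var : R := Num.min (pW * (1 - pW)) (pB * (1 - pB)).

Lemma min_add_var_gt0 : 0 < min_add_var.
Proof. by rewrite lt_min !mulr_gt0 ?subr_gt0. Qed.

Lemma min_add_var_le x : min_add_var <= add_white_prob x * (1 - add_white_prob x).
Proof.
rewrite /min_add_var ge_min; case: x => /=; first by rewrite lexx.
by apply/orP; right; rewrite opprB addrCA subrr addr0 mulrC.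
Qed.

Lemma bump_added_mart_le kappa theta (x : bool) h :
  0 < kappa -> 0 < theta -> 2 * theta <= 1 -> 2 * kappa * theta <= 1 ->
  (2 + 17 * kappa + 4 * kappa ^+ 2) * theta <= kappa * min_add_var ->
  (1 - bump_rate kappa * theta ^+ 2) * cos_bump kappa (theta * added_mart h) <=
  add_white_prob x * cos_bump kappa (theta * added_mart h + theta * (1 - add_white_prob x))
  + (1 - add_white_prob x) *
    cos_bump kappa (theta * added_mart h + theta * (0 - add_white_prob x)).
Proof.
move=> k0 th0 th1 kth Cth.
have /andP[p0 p1] := add_white_prob01 pW0 pW1 pB0 pB1 x.
set p := add_white_prob x in p0 p1 *.
have p01 : 0 <= p <= 1 by rewrite !ltW.
have pp0 : 0 < p * (1 - p) by rewrite mulr_gt0// subr_gt0.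
have pp1 : p * (1 - p) <= 1 by rewrite mulr_ile1 ?gerBl ?subr_ge0// ltW.
have Cthp : (2 + 17 * kappa + 4 * kappa ^+ 2) * theta <= kappa * (p * (1 - p)).
  by apply: (le_trans Cth); rewrite ler_pM2l// min_add_var_le.
have drift0 : `|p - p| <= kappa * (p * (1 - p)) * theta.
  by rewrite subrr normr0 ltW// mulr_gt0// mulr_gt0.
apply: le_trans (cos_bump_step (theta * added_mart h) k0 th0 th1 kth Cthp p01 p01 drift0).
rewrite ler_wpM2r ?cos_bump_ge0 ?(ltW k0)// lerD2l lerN2 -/(bump_rate kappa).
by rewrite -mulrA ler_piMl// mulr_ge0 ?sqr_ge0// ltW// bump_rate_gt0.
Qed.

(** For [devN], the added ball is averaged first, given the drawn one: it has no drift and yields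
    the factor [lam']. The drawn ball is averaged next, and the product of the two factors is at
    least 1 minus the sum of the losses. *)
Lemma next_mean_bump_dev kd kappa theta K h :
  0 < kappa -> 0 < theta -> 1 <= K -> 2 * theta <= 1 -> 2 * kappa * theta <= 1 ->
  (2 + 17 * kappa + 4 * kappa ^+ 2) * theta <= kappa * sig2 ->
  (2 + 17 * kappa + 4 * kappa ^+ 2) * theta <= kappa * min_add_var ->
  `|excess h / balls h| <= kappa * sig2 * theta ->
  (sig2 + 1 / K ^+ 2) * bump_rate kappa * theta ^+ 2 <= 1 ->
  (1 - (sig2 + 1 / K ^+ 2) * bump_rate kappa * theta ^+ 2)
    * bump_dev kd kappa theta (theta / K) h <=
  next_mean (fun h => (in_strip kd theta (theta / K) h)%:R *
                      bump_dev kd kappa theta (theta / K) h) h.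
Proof.
move=> k0 th0 K1 th1 kth Cth Cth' drift lam1.
have K0 : 0 < K by apply: lt_le_trans K1.
have rate0 := ltW (bump_rate_gt0 k0).
have th2 : 0 <= theta ^+ 2 by apply: sqr_ge0.
have sr0 : 0 <= sig2 * bump_rate kappa * theta ^+ 2.
  by apply: mulr_ge0 => //; apply: mulr_ge0 => //; exact: ltW.
have Kr0 : 0 <= 1 / K ^+ 2 * bump_rate kappa * theta ^+ 2.
  exact: mulr_ge0 (mulr_ge0 (divr_ge0 ler01 (sqr_ge0 _)) rate0) th2.
apply: (@le_trans _ _ (next_mean (bump_dev kd kappa theta (theta / K)) h)); last first.
  by apply: next_mean_le => // c; rewrite in_strip_bump_dev.
have /andP[w0 w1] := white_prob01 R B0 W0_gt0 h.
have wdrift := white_prob_drift B0 pW pB W0_gt0 h.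
have v01 : 0 <= v <= 1 by rewrite !ltW.
move: Cth drift; rewrite limit_varE => Cth drift.
case: kd; last first.
  rewrite /bump_dev.
  apply: (@le_trans _ _ (next_mean (fun h => cos_bump kappa (theta * devY h)) h)); last first.
    by apply: next_mean_le => // c; rewrite mulr1.
  rewrite (next_mean_added W0 B0 pW1 pB1 (fun z => cos_bump kappa (theta * z))).
  rewrite mulr1 [theta * (_ + (1 - v))]mulrDr [theta * (_ + (0 - v))]mulrDr.
  set p := v + rho * (white_prob h - v).
  have p01 : 0 <= p <= 1.
    have pE : p = add_white_prob true * white_prob h + add_white_prob false * (1 - white_prob h).
      by rewrite !add_white_probE// /p /= ?mulr1n ?mulr0n; ring.
    have /andP[? ?] := add_white_prob01 pW0 pW1 pB0 pB1 true.
    have /andP[? ?] := add_white_prob01 pW0 pW1 pB0 pB1 false.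
    by rewrite pE; apply/andP; split; nra.
  have pv : `|p - v| <= kappa * (v * (1 - v)) * theta.
    apply: le_trans drift; rewrite /p addrC addKr wdrift normrM.
    by rewrite ler_piMl// rho_norm.
  apply: le_trans (cos_bump_step (theta * devY h) k0 th0 th1 kth Cth p01 v01 pv).
  rewrite ler_wpM2r ?cos_bump_ge0 ?(ltW k0)// lerD2l lerN2 -limit_varE -/(bump_rate kappa).
  by rewrite !mulrDl lerDl.
have thK0 : 0 < theta / K by rewrite divr_gt0.
have thK : theta / K <= theta by rewrite ler_pdivrMr// ler_peMr// ltW.
have thK1 : 2 * (theta / K) <= 1 by apply: le_trans th1; rewrite ler_pM2l.
have kthK : 2 * kappa * (theta / K) <= 1 by apply: le_trans kth; rewrite ler_pM2l// mulr_gt0.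
have CthK : (2 + 17 * kappa + 4 * kappa ^+ 2) * (theta / K) <= kappa * min_add_var.
  apply: le_trans Cth'; rewrite ler_wpM2l// !addr_ge0 ?mulr_ge0 ?sqr_ge0//; exact: ltW.
set lam' := 1 - bump_rate kappa * (theta / K) ^+ 2.
have lam'E : lam' = 1 - 1 / K ^+ 2 * bump_rate kappa * theta ^+ 2.
  by rewrite /lam' expr_div_n; congr (1 - _); field; rewrite gt_eqF.
have lam'0 : 0 <= lam' by rewrite lam'E; move: lam1 sr0; rewrite !mulrDl; lra.
set bM := cos_bump kappa (theta / K * added_mart h).
have bM0 : 0 <= bM by rewrite cos_bump_ge0// ltW.
have key (x : bool) : cos_bump kappa (theta * devN h + theta * (x%:R - v)) * (lam' * bM) <=
    mean_added (bump_dev true kappa theta (theta / K)) h x.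
  have := bump_added_mart_le x h k0 thK0 thK1 kthK CthK.
  rewrite -/lam' -/bM => H.
  have B0' : 0 <= cos_bump kappa (theta * devN h + theta * (x%:R - v)) by rewrite cos_bump_ge0// ltW.
  apply: (le_trans (ler_wpM2l B0' H)).
  rewrite /mean_added /bump_dev /= !devN_cons !added_mart_cons//= ?mulr1n ?mulr0n.
  rewrite [theta * (devN h + _)]mulrDr [theta / K * (_ + (1 - _))]mulrDr.
  rewrite [theta / K * (_ + (0 - _))]mulrDr.
  by rewrite le_eqVlt; apply/orP; left; apply/eqP; ring.
have w1' : 0 <= 1 - white_prob h by rewrite subr_ge0.
apply: (le_trans _ (lerD (ler_wpM2l w0 (key true)) (ler_wpM2l w1' (key false)))).
rewrite /= ?mulr1n ?mulr0n.
have w01 : 0 <= white_prob h <= 1 by rewrite w0.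
have pv : `|white_prob h - v| <= kappa * (v * (1 - v)) * theta by rewrite wdrift.
have := cos_bump_step (theta * devN h) k0 th0 th1 kth Cth w01 v01 pv.
rewrite -limit_varE -/(bump_rate kappa) => H.
rewrite (mulrA (white_prob h)) (mulrA (1 - white_prob h)) -mulrDl.
have lbM : 0 <= lam' * bM by rewrite mulr_ge0.
apply: (le_trans _ (ler_wpM2r lbM H)).
rewrite /bump_dev /= -/bM.
have -> : (1 - sig2 * bump_rate kappa * theta ^+ 2) * cos_bump kappa (theta * devN h) * (lam' * bM) =
  (1 - sig2 * bump_rate kappa * theta ^+ 2) * lam' * (cos_bump kappa (theta * devN h) * bM) by ring.
have Bb : 0 <= cos_bump kappa (theta * devN h) * bM by rewrite mulr_ge0// cos_bump_ge0// ltW.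
rewrite ler_wpM2r// lam'E.
rewrite -subr_ge0; set z := 1 / K ^+ 2 * bump_rate kappa * theta ^+ 2 in Kr0 *.
rewrite [X in 0 <= X](_ : _ = sig2 * bump_rate kappa * theta ^+ 2 * z); last by rewrite /z; ring.
exact: mulr_ge0.
Qed.

Lemma expRN_le_linear (kappa x : R) : 0 < kappa -> 0 <= x ->
  x * (1 + kappa) ^+ 2 <= 2 * kappa -> expR (- ((1 + kappa) * x)) <= 1 - x.
Proof.
move=> k0 x0 xk; have y0 : 0 <= (1 + kappa) * x by rewrite mulr_ge0//; lra.
apply: (le_trans (expRN_le_quadratic y0)).
have := ler_wpM2l x0 xk; rewrite exprMn; lra.
Qed.

Lemma bump_dev_ge kd kappa theta theta' h : 0 <= kappa ->
  `|theta * dev kd h| <= pi / 4 -> (kd -> `|theta' * added_mart h| <= pi / 4) ->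
  4^-1 <= bump_dev kd kappa theta theta' h.
Proof.
move=> k0 h1 h2; have b1 := cos_bump_ge_half k0 h1.
rewrite /bump_dev (_ : 4^-1 = 2^-1 * 2^-1); last by rewrite -invfM; congr _^-1; lra.
apply: ler_pM => //; case: kd {h1 b1} h2 => [h2|_]; last lra.
exact: cos_bump_ge_half (h2 isT).
Qed.

Lemma bump_dev_le kd kappa theta theta' h : 0 <= kappa ->
  bump_dev kd kappa theta theta' h <= (1 + 2 * kappa) ^+ 2.
Proof.
move=> k0; rewrite /bump_dev expr2; apply: ler_pM; rewrite ?cos_bump_ge0 ?cos_bump_le//.
  by case: kd => //; rewrite cos_bump_ge0.
by case: kd; rewrite ?cos_bump_le//; lra.
Qed.

(** The lower bound on [theta ^+ 2 * m] is what makes the drift at most [kappa * sig2 * theta] from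
    time [m] on. The prefactor compares the bump, at least [4^-1] at the start, with its maximum
    [(1 + 2 * kappa) ^+ 2] at the end. *)
Lemma strip_phase kappa K : 0 < kappa -> 1 <= K ->
  exists2 theta0 : R, 0 < theta0 & forall kd theta m n (phi : pred word),
    0 < theta <= theta0 -> (m <= n)%N -> 5 * K / (kappa * sig2) <= theta ^+ 2 * m%:R ->
    (forall h, phi h -> `|theta * dev kd h| <= pi / 4 /\ (kd -> `|theta / K * added_mart h| <= pi / 4)) ->
    expR (- ((1 + kappa) * ((sig2 + 1 / K ^+ 2) * bump_rate kappa * theta ^+ 2) * n%:R))
      / (4 * (1 + 2 * kappa) ^+ 2) * word_prob m phi <=
    word_prob n (fun h => phi (past m h) && stay m (in_strip kd theta (theta / K)) h).
Proof.
move=> k0 K1; have K0 : 0 < K by apply: lt_le_trans K1.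
have [Lam LamE] : {L | L = (sig2 + 1 / K ^+ 2) * bump_rate kappa} by exists ((sig2 + 1 / K ^+ 2) * bump_rate kappa).
have Lam0 : 0 < Lam.
  by rewrite LamE mulr_gt0 ?bump_rate_gt0// addr_gt0// divr_gt0// exprn_gt0.
have pp := pi_gt0 R; have p2 : pi / 2 < 2 :> R by apply: pihalf_lt2.
have [Ck CkE] : {L | L = 2 + 17 * kappa + 4 * kappa ^+ 2} by exists (2 + 17 * kappa + 4 * kappa ^+ 2).
have Ck0 : 0 < Ck by rewrite CkE; have := exprn_gt0 2 k0; lra.
have b2 : 0 < (W0 + B0)%:R :> R by rewrite ltr0n addn_gt0 W0_gt0.
have k12 : 0 < (1 + kappa) ^+ 2 by rewrite exprn_gt0//; lra.
(* [t1] to [t4] serve the hypotheses of [next_mean_bump_dev], [t5] bounds the initial composition by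
   [1 / theta], and [t6] is for [expRN_le_linear]. *)
pose t1 : R := 1 / 2; pose t2 := 1 / (2 * kappa); pose t3 := kappa * sig2 / Ck.
pose t4 := kappa * min_add_var / Ck; pose t5 := 1 / (W0 + B0)%:R : R.
pose t6 := 2 * kappa / (Lam * (1 + kappa) ^+ 2).
pose theta0 := Num.min (Num.min t1 (Num.min t2 t3)) (Num.min t4 (Num.min t5 t6)).
exists theta0.
  rewrite /theta0 !lt_min; have := min_add_var_gt0 => mv; have := sig0 => s0.
  rewrite /t1 /t2 /t3 /t4 /t5 /t6.
  by do 5 ?[apply/andP; split]; apply: divr_gt0 => //; exact: mulr_gt0.
move=> kd theta m n phi /andP[th0]; rewrite !le_min.
move=> /andP[/andP[h1 /andP[h2 h3]] /andP[h4 /andP[h5 h6]]] mn mth phiG.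
have {h1} c1 : 2 * theta <= 1 by move: h1; rewrite /t1; lra.
have {h2} c2 : 2 * kappa * theta <= 1 by move: h2; rewrite ler_pdivlMr ?mulr_gt0// mulrC.
have {h3} c3 : Ck * theta <= kappa * sig2 by move: h3; rewrite ler_pdivlMr// mulrC.
have {h4} c4 : Ck * theta <= kappa * min_add_var by move: h4; rewrite ler_pdivlMr// mulrC.
have {h5} c5 : (W0 + B0)%:R * theta <= 1 by move: h5; rewrite ler_pdivlMr// mulrC.
have {h6} c6 : Lam * theta ^+ 2 * (1 + kappa) ^+ 2 <= 2 * kappa.
  have Lk := mulr_gt0 Lam0 k12.
  move: h6; rewrite ler_pdivlMr// => h6; apply: le_trans h6.
  rewrite -subr_ge0 [X in 0 <= X](_ : _ = Lam * (1 + kappa) ^+ 2 * (theta * (1 - theta))).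
    by apply: mulr_ge0 (ltW Lk) (mulr_ge0 (ltW th0) _); lra.
  by ring.
rewrite CkE in c3 c4; rewrite -LamE.
set G := in_strip kd theta (theta / K).
set x := Lam * theta ^+ 2 in c6 *.
have x0 : 0 < x by rewrite mulr_gt0// exprn_gt0.
have ex := expRN_le_linear k0 (ltW x0) c6.
have x1 : x <= 1.
  have := expR_gt0 (- ((1 + kappa) * x)); lra.
have th2 : 0 < theta ^+ 2 by rewrite exprn_gt0.
have phiG' h : phi h -> G h.
  move=> /phiG[g1 g2]; rewrite /G /in_strip (le_lt_trans g1) /=; last lra.
  by apply/implyP => /g2 {}g2; apply: (le_lt_trans g2); lra.
(* At most 2 comes from [dev], [2 * K] from [added_mart] and 1 from the initial composition; 5 is
   then enough since [1 <= K]. *)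
have thexc h : G h -> theta * `|excess h| <= 5 * K.
  rewrite /G /in_strip => /andP[g1 g2].
  have thn x' : `|theta * x'| = theta * `|x'| by rewrite normrM gtr0_norm.
  case: kd @G g1 g2 phiG phiG' => G /= g1 g2 _ _.
    have := ler_wpM2l (ltW th0) (norm_excess_devN W0 B0 pW0 pW1 pB0 pB1 h).
    move: g1 g2; rewrite thn normrM gtr0_norm ?divr_gt0// mulrAC ltr_pdivrMr// => g1 g2.
    have : pi / 2 * K <= 2 * K by apply: ler_wpM2r; exact: ltW.
    rewrite !mulrDr; lra.
  have := ler_wpM2l (ltW th0) (norm_excess_devY W0 B0 pW0 pW1 pB0 pB1 h).
  move: g1; rewrite thn mulrDr; lra.
have sub h : (m <= size h < n)%N -> G h ->
    (1 - x) * bump_dev kd kappa theta (theta / K) h <=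
    next_mean (fun h => (G h)%:R * bump_dev kd kappa theta (theta / K) h) h.
  move=> /andP[mh _] Gh.
  have drift : `|excess h / balls h| <= kappa * sig2 * theta.
    rewrite normrM normfV (gtr0_norm (b0 h)) ler_pdivrMr// -(ler_pM2l th0).
    apply: (le_trans (thexc h Gh)).
    have ks0 : 0 < kappa * sig2 by rewrite mulr_gt0.
    move: mth; rewrite ler_pdivrMr// => mth; apply: (le_trans mth).
    have mt : m%:R <= balls h.
      by rewrite ler_nat (leq_trans mh)// leq_addl.
    rewrite [leRHS](_ : _ = theta ^+ 2 * balls h * (kappa * sig2)); last by ring.
    by rewrite ler_wpM2r ?(ltW ks0)// ler_wpM2l// ltW.
  have := @next_mean_bump_dev kd kappa theta K h k0 th0 K1 c1 c2 c3 c4 drift.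
  by rewrite -LamE -/x; apply.
have x10 : 0 <= 1 - x by rewrite subr_ge0.
have := @stay_subsolution R W0 B0 pW pB W0_gt0 pW0 pW1 pB0 pB1 m n phi G
  (bump_dev kd kappa theta (theta / K)) (1 - x) mn x10 phiG' sub => H.
have q0 : 0 < (1 + 2 * kappa) ^+ 2 by rewrite exprn_gt0//; lra.
have up : word_mean n (fun h => (phi (past m h) && stay m G h)%:R *
      bump_dev kd kappa theta (theta / K) h) <=
    (1 + 2 * kappa) ^+ 2 * word_prob n (fun h => phi (past m h) && stay m G h).
  rewrite /word_prob -word_meanZ//; apply: word_mean_le => // h _.
  by rewrite mulrC ler_wpM2r// bump_dev_le// ltW.
have low : 4^-1 * word_prob m phi <=
    word_mean m (fun h => (phi h)%:R * bump_dev kd kappa theta (theta / K) h).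
  rewrite /word_prob -word_meanZ//; apply: word_mean_le => // h _.
  case: (boolP (phi h)) => [/phiG[g1 g2]|_]; rewrite ?mulr0 ?mul0r// mulr1 mul1r.
  by apply: bump_dev_ge => //; exact: ltW.
have pw : expR (- ((1 + kappa) * x * n%:R)) <= (1 - x) ^+ (n - m).
  apply: (@le_trans _ _ (expR (- ((1 + kappa) * x)) ^+ (n - m))); last first.
    by rewrite lerXn2r// nnegrE// expR_ge0.
  rewrite -expRM_natr mulNr ler_expR lerN2 ler_wpM2l//.
    by rewrite mulr_ge0 ?(ltW x0)//; lra.
  by rewrite ler_nat leq_subr.
have wp0 : 0 <= word_prob m phi by apply: word_prob_ge0.
have low' := ler_pM (expR_ge0 _) (mulr_ge0 (ltW (_ : 0 < 4^-1 :> R)) wp0) pw low.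
have := le_trans (low' _) (le_trans H up).
rewrite -/G invfM => fin.
rewrite -(ler_pM2l q0); apply: le_trans (fin _); last by rewrite invr_gt0.
rewrite le_eqVlt; apply/orP; left; apply/eqP; field.
by rewrite gt_eqF//; lra.
Qed.

End ConfinementLower.

Lemma past_past j m (h : word) : (j <= m)%N -> (m <= size h)%N -> past j (past m h) = past j h.
Proof.
move=> jm mh; rewrite /past drop_drop size_drop subKn//; congr drop.
by rewrite addnC addnBA// subnK.
Qed.

(** * The initial phase, confined by the Lyapunov function *)

Section ConfinementLowerBound.
Variables (R : realType) (W0 B0 : nat) (pW pB : R).
Hypothesis W0_gt0 : (0 < W0)%N.
Hypothesis B0_gt0 : (0 < B0)%N.
Hypothesis pW0 : 0 < pW.
Hypothesis pW1 : pW < 1.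
Hypothesis pB0 : 0 < pB.
Hypothesis pB1 : pB < 1.
Implicit Types (h : word).
Local Notation word_prob := (word_prob W0 B0 pW pB).
Local Notation rho := (rho pW pB).
Local Notation v := (limit_frac pW pB).
Local Notation sig2 := (limit_var pW pB).
Local Notation devN := (devN pW pB).
Local Notation devY := (devY W0 pW pB).
Local Notation excess := (excess W0 B0 pW pB).
Local Notation added_mart := (added_mart W0 pW pB).
Local Notation dev := (dev W0 pW pB).
Hypothesis rho_half : rho < 2^-1.
Local Notation lyap := (lyap W0 B0 pW pB).
Local Notation alpha := (lyap_exp pW pB).
Local Notation C := (lyap_coef pW pB).
Local Notation Kc := (lyap_rest pW pB).

Let sig0 : 0 < sig2. Proof. by apply: limit_var_gt0. Qed.

Ltac clr := repeat match goal with H : _ |- _ => lazymatch H with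
  | R => fail | W0 => fail | B0 => fail | pW => fail | pB => fail
  | W0_gt0 => fail | B0_gt0 => fail | pW0 => fail | pW1 => fail | pB0 => fail | pB1 => fail
  | rho_half => fail | sig0 => fail | _ => clear H end end.

(** Since 256 is the square of 16, [lyap h <= a ^+ 2 * lyap_frac] bounds both [devN] and [excess] by
    [a / 16]; the minimum accounts for the weight [C] of [excess]. *)
Definition lyap_frac : R := Num.min 1 C / 256.

Lemma lyap_small h (a : R) : 0 < a -> 16 * (W0 + B0)%:R <= a ->
  lyap h <= a ^+ 2 * lyap_frac ->
  (forall kd, `|dev kd h| <= a / 4) /\ `|added_mart h| <= a / 4.
Proof.
move=> a0 ba; have C0 := lyap_coef_gt0 rho_half.
set b : R := (W0 + B0)%:R in ba *.
rewrite /lyap /lyap_frac => ly.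
have mC : Num.min 1 C <= C by rewrite ge_min lexx orbT.
have m1 : Num.min 1 C <= 1 by rewrite ge_min lexx.
have a20 : 0 <= a ^+ 2 / 256 by rewrite divr_ge0// sqr_ge0.
have HN : devN h ^+ 2 <= (a / 16) ^+ 2.
  have : 0 <= C * excess h ^+ 2 by rewrite mulr_ge0 ?sqr_ge0// ltW.
  have := ler_wpM2l a20 m1; lra.
have HE : excess h ^+ 2 <= (a / 16) ^+ 2.
  rewrite -(ler_pM2l C0).
  have := sqr_ge0 (devN h); have := ler_wpM2l a20 mC; lra.
have sq y : y ^+ 2 <= (a / 16) ^+ 2 -> `|y| <= a / 16.
  by move=> hy; rewrite -(@ler_pXn2r _ 2) ?nnegrE//; [rewrite real_normK ?num_real|lra].
have {HN} HN := sq _ HN; have {HE sq} HE := sq _ HE.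
have b0 : 0 <= b by [].
have v01 := limit_frac01 pW0 pW1 pB0 pB1.
have bv : 0 <= b * v <= b.
  by case/andP: v01 => v0 v1; rewrite mulr_ge0 ?(ltW v0)//= ler_piMr// ltW.
have offb := norm_offset W0 B0 pW0 pW1 pB0 pB1; rewrite -/b in offb.
split=> [kd|].
  case: kd => /=; first lra.
  have -> : devY h = excess h + b * v by rewrite excessE -/b; ring.
  apply: (le_trans (ler_normD _ _)); case/andP: bv => bv0 bv1.
  by rewrite (ger0_norm bv0); lra.
have -> : added_mart h = excess h - rho * devN h - (W0%:R - b * v).
  by rewrite excess_added_mart -/b; ring.
have rN : `|rho * devN h| <= a / 16.
  apply: le_trans HN; rewrite normrM ler_piMl//; exact: rho_norm.
apply: (le_trans (ler_normB _ _)); apply: (le_trans (lerD (ler_normB _ _) (lexx _))).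
lra.
Qed.

Lemma powRV (x r : R) : 0 <= x -> x^-1 `^ r = (x `^ r)^-1.
Proof. by move=> x0; rewrite -powR_inv1// -powRrM mulN1r powRN. Qed.

(** Up to twice [lyap_time * a ^+ 2], the noise term [Kc * N] of [lyap_exit] stays below a quarter
    of the level [a ^+ 2 * lyap_frac]. The hypothesis on [y] in [lyap_phase] keeps the other term
    below a quarter as well, whence its factor [2^-1]. *)
Definition lyap_time : R := lyap_frac / (8 * Kc).

Lemma lyap_frac_gt0 : 0 < lyap_frac.
Proof. by rewrite divr_gt0// lt_min ltr01; apply: lyap_coef_gt0. Qed.

Lemma lyap_time_gt0 : 0 < lyap_time.
Proof. by rewrite divr_gt0 ?lyap_frac_gt0// mulr_gt0//; apply: lyap_rest_gt0. Qed.

Lemma lyap_phase (a y : R) m (phi : pred word) : 0 < a ->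
  (W0 + B0)%:R + 2 <= lyap_time * a ^+ 2 -> m%:R <= lyap_time * a ^+ 2 / 2 ->
  (forall h, size h = m -> phi h -> lyap h <= y) -> 0 <= y -> y <= a ^+ 2 * lyap_frac ->
  (2 * (lyap_time * a ^+ 2) / m.+1%:R) `^ alpha * y <= a ^+ 2 * lyap_frac / 4 ->
  2^-1 * word_prob m phi <= word_prob (Num.truncn (lyap_time * a ^+ 2)) (fun h =>
    ((size (past m h) == m) && phi (past m h)) &&
      stay m (fun h => lyap h <= a ^+ 2 * lyap_frac) h).
Proof.
move=> a0 da ma phiy y0 yx yq.
have Kc0 := lyap_rest_gt0 rho_half; have dl0 := lyap_time_gt0.
have [al0 al1 _] := lyap_exp_bounds rho_half.
have e20 := lyap_frac_gt0.
have a20 : 0 < a ^+ 2 by rewrite exprn_gt0.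
have [x xE] : {x | x = a ^+ 2 * lyap_frac} by exists (a ^+ 2 * lyap_frac).
rewrite -xE in yx yq *.
have x0 : 0 < x by rewrite xE mulr_gt0.
have [b bE] : {b : R | b = (W0 + B0)%:R} by exists (W0 + B0)%:R.
rewrite -bE in da.
have b2 : 2 <= b by rewrite bE ler_nat (leq_add W0_gt0 B0_gt0).
have [A AE] : {A | A = lyap_time * a ^+ 2} by exists (lyap_time * a ^+ 2).
rewrite -AE in da ma yq *.
set m1 := Num.truncn A.
have /truncn_itv/andP[m1l m1u] : 0 <= A by rewrite AE mulr_ge0 ?ltW.
rewrite -/m1 in m1l m1u.
rewrite -addn1 natrD in m1u.
have mm1 : (m <= m1)%N.
  by rewrite -(ler_nat R); apply: (le_trans ma); move: m1u da b2; clr; lra.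
(* [phi] bounds [lyap] only on words of length [m], while [lyap_exit] requires the inclusion for all
   words. *)
pose phi0 (h : word) := (size h == m) && phi h.
have phi0x h : phi0 h -> lyap h <= x.
  by move=> /andP[/eqP hm ph]; apply: le_trans yx; exact: phiy.
have phi0y h : size h = m -> phi0 h -> lyap h <= y by move=> hm /andP[_]; exact: phiy.
have phi0E : word_prob m phi = word_prob m phi0.
  by apply: eq_word_mean => // h hm; rewrite /phi0 hm eqxx.
have := lyap_exit W0_gt0 B0_gt0 pW0 pW1 pB0 pB1 rho_half mm1 x0 (erefl _) phi0x phi0y.
rewrite !natrD -!natrD !(natrD _ (W0 + B0)) -bE; set N := b + m1%:R - 1.
have m1_0 : 0 <= m1%:R :> R by [].
have N0 : 0 < N by rewrite /N; move: m1_0 b2; clr; lra.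
have Nd : N <= 2 * A by rewrite /N; move: m1l da b2; clr; lra.
have m0 : 0 <= m%:R :> R by [].
have t0 : 0 < b + m%:R - 1 by move: m0 b2; clr; lra.
have half : (N `^ alpha / (b + m%:R - 1) `^ alpha * y + Kc * N) / x <= 2^-1.
  rewrite ler_pdivrMr//.
  have KN : Kc * N <= x / 4.
    apply: (le_trans (ler_wpM2l (ltW Kc0) Nd)); rewrite xE AE /lyap_time.
    by move: (gt_eqF Kc0); clr => Kn; rewrite le_eqVlt; apply/orP; left; apply/eqP; field; rewrite Kn.
  have : N `^ alpha / (b + m%:R - 1) `^ alpha * y <= x / 4.
    apply: le_trans yq; rewrite ler_wpM2r// -powRV ?(ltW t0)// -powRM ?invr_ge0 ?(ltW t0) ?(ltW N0)//.
    rewrite ge0_ler_powR ?nnegrE ?(ltW al0) ?mulr_ge0 ?invr_ge0 ?(ltW t0) ?(ltW N0)//.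
      by move: Nd N0; clr; lra.
    rewrite ler_pM ?invr_ge0 ?(ltW t0) ?(ltW N0)// lef_pV2 ?posrE//.
    by rewrite -addn1 natrD; move: b2; clr; lra.
  by move: KN; clr; lra.
move=> exit; rewrite phi0E.
have wp0 : 0 <= word_prob m phi0 by apply: word_prob_ge0.
have {}exit := le_trans exit (ler_wpM2r wp0 half).
have := @word_probC R W0 B0 pW pB W0_gt0 pW0 pW1 pB0 pB1 m1 (fun h => phi0 (past m h)) (stay m (fun h => lyap h <= x)).
rewrite word_prob_past// => pE; rewrite pE in exit.
by rewrite -/(phi0 _); move: exit; clr; lra.
Qed.

End ConfinementLowerBound.

(** * Lower bound given the past, in three phases *)

Section ConfinementThreePhases.
Variables (R : realType) (W0 B0 : nat) (pW pB : R).
Hypothesis W0_gt0 : (0 < W0)%N.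
Hypothesis B0_gt0 : (0 < B0)%N.
Hypothesis pW0 : 0 < pW.
Hypothesis pW1 : pW < 1.
Hypothesis pB0 : 0 < pB.
Hypothesis pB1 : pB < 1.
Implicit Types (h : word).
Local Notation word_prob := (word_prob W0 B0 pW pB).
Local Notation rho := (rho pW pB).
Local Notation sig2 := (limit_var pW pB).
Local Notation added_mart := (added_mart W0 pW pB).
Local Notation dev := (dev W0 pW pB).
Hypothesis rho_half : rho < 2^-1.
Local Notation lyap := (lyap W0 B0 pW pB).
Local Notation alpha := (lyap_exp pW pB).
Local Notation in_strip := (in_strip W0 pW pB).
Local Notation lyap_frac := (lyap_frac pW pB).
Local Notation lyap_time := (lyap_time pW pB).

Let sig0 : 0 < sig2. Proof. by apply: limit_var_gt0. Qed.

Ltac clr := repeat match goal with H : _ |- _ => lazymatch H with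
  | R => fail | W0 => fail | B0 => fail | pW => fail | pB => fail
  | W0_gt0 => fail | B0_gt0 => fail | pW0 => fail | pW1 => fail | pB0 => fail | pB1 => fail
  | rho_half => fail | sig0 => fail | _ => clear H end end.

(** This [K] makes the cost of confining the martingale at most [k * sig2]. The constant 67 comes
    from [(1 + 3 * k) * (2^-1 + 8 * k) <= (1 + 67 * k) / 2], valid for [k <= 1]. *)
Lemma rate_le (k eta K : R) : 0 < k -> k <= 1 -> 67 * k <= eta -> K = 1 / (k * sig2) ->
  (1 + k) * ((sig2 + 1 / K ^+ 2) * bump_rate k) <= (1 + eta) * sig2 / 2.
Proof.
move=> k0 k1 ke KE; have s0 := sig0; have s1 := limit_var_le1 pW0 pW1 pB0 pB1.
have ks0 : 0 < k * sig2 by rewrite mulr_gt0.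
have KV : 1 / K ^+ 2 <= k * sig2.
  rewrite KE !div1r exprVn invrK expr2 ler_piMr ?(ltW ks0)//.
  by rewrite mulr_ile1// ltW.
have r0 := ltW (bump_rate_gt0 k0).
have kk : k ^+ 2 <= k by rewrite expr2 ler_piMr// ltW.
have k20 : 0 <= k ^+ 2 by rewrite sqr_ge0.
apply: (@le_trans _ _ ((1 + k) * ((sig2 + k * sig2) * bump_rate k))).
  by rewrite ler_wpM2l ?ler_wpM2r ?lerD2l//; move: k0; clr; lra.
have -> : (1 + k) * ((sig2 + k * sig2) * bump_rate k) = sig2 * ((1 + k) ^+ 2 * bump_rate k) by ring.
have -> : (1 + eta) * sig2 / 2 = sig2 * ((1 + eta) / 2) by ring.
rewrite ler_wpM2l ?(ltW s0)//.
apply: (@le_trans _ _ ((1 + 3 * k) * (2^-1 + 8 * k))).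
  apply: ler_pM => //; first by rewrite sqr_ge0.
    by rewrite sqrrD expr1n mul1r; move: kk; clr; lra.
  by rewrite /bump_rate; move: kk; clr; lra.
have -> : (1 + 3 * k) * (2^-1 + 8 * k) = 2^-1 + (8 + 3 / 2) * k + 24 * k ^+ 2 by field.
by move: kk ke; clr; lra.
Qed.

Lemma strip_dev kd (a theta' : R) h : 0 < a -> in_strip kd (pi / a) theta' h ->
  `|dev kd h| < a / 2.
Proof.
move=> a0 /andP[+ _]; have pi0 := pi_gt0 R.
rewrite normrM gtr0_norm ?divr_gt0// mulrAC ltr_pdivrMr// => h1.
by rewrite -(ltr_pM2l pi0); move: h1; lra.
Qed.

Lemma scaled_le (a x z : R) : 0 < a -> `|x| <= a / 4 * z -> 0 < z ->
  `|pi / a / z * x| <= pi / 4.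
Proof.
move=> a0 xa z0; have pi0 := pi_gt0 R.
rewrite normrM gtr0_norm ?divr_gt0//.
have := ler_wpM2l (ltW (divr_gt0 (divr_gt0 pi0 a0) z0)) xa; move=> /le_trans; apply.
by rewrite le_eqVlt; apply/orP; left; apply/eqP; field; rewrite !gt_eqF.
Qed.

(** The power of [s ^+ 2 * m.+1] is the growth of [lyap] between time [m] and times of order
    [1 / s ^+ 2]: the state at time [m], so magnified, must remain small against the squared width
    of the strip. *)
Lemma confinement_lower (c eta : R) : 0 < c -> 0 < eta ->
  exists q p s0 B : R, [/\ 0 < q, 0 < p, 0 < s0 &
    forall kd n m s y (phi : pred word),
    0 < s <= s0 -> m%:R <= q / s ^+ 2 -> B <= n%:R * s ^+ 2 ->
    (forall h, size h = m -> phi h -> lyap h <= y) -> 0 <= y ->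
    y * (s ^+ 2 * m.+1%:R)^-1 `^ alpha <= q / s ^+ 2 ->
    p * expR (- ((1 + eta) * (pi ^+ 2 * sig2 / (8 * c ^+ 2)) * (n%:R * s ^+ 2)))
      * word_prob m phi <=
    word_prob n (fun h => phi (past m h) && stay m (fun h => `|dev kd h| <= c / s) h)].
Proof.
move=> c0 eta0; have pi0 := pi_gt0 R; have pi2 := pi_ge2 R.
have [al0 al1 _] := lyap_exp_bounds rho_half.
have [b bE] : {b : R | b = (W0 + B0)%:R} by exists (W0 + B0)%:R.
have b2 : 2 <= b by rewrite bE ler_nat (leq_add W0_gt0 B0_gt0).
have [e2 e2E] : {e | e = lyap_frac} by exists lyap_frac.
have e20 : 0 < e2 by rewrite e2E; apply: lyap_frac_gt0.
have [dl dlE] : {e | e = lyap_time} by exists lyap_time.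
have dl0 : 0 < dl by rewrite dlE; apply: lyap_time_gt0.
have [k3 k3E] : {e | e = Num.min 1 (eta / 67)} by exists (Num.min 1 (eta / 67)).
have k30 : 0 < k3 by rewrite k3E lt_min ltr01 divr_gt0.
have k31 : k3 <= 1 by rewrite k3E ge_min lexx.
have k3eta : 67 * k3 <= eta.
  have : k3 <= eta / 67 by rewrite k3E ge_min lexx orbT.
  by clr; lra.
have ks0 : 0 < k3 * sig2 by rewrite mulr_gt0.
have s2le1 : sig2 <= 1 by apply: limit_var_le1.
have ks1 : k3 * sig2 <= 1 by rewrite mulr_ile1// ltW.
have [K KE] : {e | e = 1 / (k3 * sig2)} by exists (1 / (k3 * sig2)).
have K1 : 1 <= K by rewrite KE ler_pdivlMr// mul1r.
have K0 : 0 < K by apply: lt_le_trans K1.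
have rate3 := rate_le k30 k31 k3eta KE.
(* With this value the drift condition of the middle phase reads [dl * (5 / 3) <= th2 ^+ 2 * m1],
   where the right-hand side is at least [dl * pi ^+ 2 / 2]. *)
have [k2 k2E] : {e | e = 3 * K / (sig2 * dl)} by exists (3 * K / (sig2 * dl)).
have sdl0 : 0 < sig2 * dl by rewrite mulr_gt0.
have k20 : 0 < k2 by rewrite k2E divr_gt0// mulr_gt0.
(* [Bq] gives the drift condition of the last phase: [th3 ^+ 2 * m2] is at least [Bq * pi ^+ 2 / 8],
   hence at least [Bq / 2]. The summand [dl] ensures that [m1 <= m2]. *)
have [Bq BqE] : {e | e = 10 * K / (k3 * sig2) + dl} by exists (10 * K / (k3 * sig2) + dl).
have Bq1 : 0 < 10 * K / (k3 * sig2) by rewrite divr_gt0// mulr_gt0.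
have Bq0 : 0 < Bq by rewrite BqE addr_gt0.
have [t2 t20 phase2] := @strip_phase R W0 B0 pW pB W0_gt0 pW0 pW1 pB0 pB1 k2 K k20 K1.
have [t3 t30 phase3] := @strip_phase R W0 B0 pW pB W0_gt0 pW0 pW1 pB0 pB1 k3 K k30 K1.
have [L2 L2E] : {e | e = (sig2 + 1 / K ^+ 2) * bump_rate k2} by exists ((sig2 + 1 / K ^+ 2) * bump_rate k2).
have L20 : 0 < L2.
  by rewrite L2E mulr_gt0 ?bump_rate_gt0// addr_gt0// divr_gt0// exprn_gt0.
have [P2 P2E] : {e | e = (2 * dl * c ^+ 2) `^ alpha} by exists ((2 * dl * c ^+ 2) `^ alpha).
have c20 : 0 < c ^+ 2 by rewrite exprn_gt0.
have dc0 : 0 < dl * c ^+ 2 by rewrite mulr_gt0.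
have P20 : 0 < P2 by rewrite P2E powR_gt0// -mulrA mulr_gt0.
(* The four bounds serve, in this order, [m <= m1], [s ^+ 2 * m.+1 <= 1], the initial bound on
   [lyap], and the growth condition of [lyap_phase]. *)
pose q := Num.min (Num.min (dl * c ^+ 2 / 2) 2^-1) (Num.min (e2 * c ^+ 2) (e2 * c ^+ 2 / (4 * P2))).
(* The middle phase costs only a constant factor, as it lasts about [Bq * a ^+ 2] stages at
   frequency [pi / a]. *)
pose f2 := expR (- ((1 + k2) * (L2 * pi ^+ 2 * Bq))) / (4 * (1 + 2 * k2) ^+ 2).
pose f3 := 1 / (4 * (1 + 2 * k3) ^+ 2).
(* With [a = c / s], the stages are split at [m1], about [lyap_time * a^2], and at [m2],
   about [Bq * a^2]. Up to [m1] the function [lyap] confines; then comes a strip of half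
   the width with a large [kappa], which tolerates the drift of order [1 / a] of these
   stages; after [m2] the drift is small enough for the full strip with [kappa = k3],
   whose rate is optimal up to [eta]. *)
pose s0 := Num.min (Num.min (t2 * c / pi) (t3 * c / pi))
  (Num.min 2^-1 (Num.min (c / (16 * b)) (dl * c ^+ 2 / (b + 2)))).
have b0 : 0 < b by move: b2; clr; lra.
have b20 : 0 < b + 2 by move: b2; clr; lra.
have k2p : 0 < (1 + 2 * k2) ^+ 2 by rewrite exprn_gt0//; move: k20; clr; lra.
have k3p : 0 < (1 + 2 * k3) ^+ 2 by rewrite exprn_gt0//; move: k30; clr; lra.
have f20 : 0 < f2 by rewrite divr_gt0 ?expR_gt0// mulr_gt0.
have f30 : 0 < f3 by rewrite divr_gt0// mulr_gt0.
have qdef : [/\ 0 < q, q <= dl * c ^+ 2 / 2, q <= 2^-1, q <= e2 * c ^+ 2 &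
     q <= e2 * c ^+ 2 / (4 * P2)].
  split; rewrite /q ?ge_min ?lexx ?orbT//.
  by rewrite !lt_min; do 2 ?[apply/andP; split]; rewrite ?invr_gt0// ?divr_gt0// mulr_gt0.
have [q0 qd qh qe qp] := qdef.
exists q, (2^-1 * f2 * f3), s0, (Bq * c ^+ 2); split => //.
- by apply: mulr_gt0 f30; apply: mulr_gt0 f20.
- rewrite /s0 !lt_min; do 3 ?[apply/andP; split]; rewrite ?invr_gt0// ?divr_gt0// ?mulr_gt0//.
clear qdef.
move=> kd n m s y phi /andP[sp]; rewrite !le_min.
move=> /andP[/andP[s1 s2] /and3P[s3 s4 s5]] mq nB phiy y0 yq.
clearbody q; clear s0.
have s20 : 0 < s ^+ 2 by rewrite exprn_gt0.
have [a aE] : {a | a = c / s} by exists (c / s).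
have a0 : 0 < a by rewrite aE divr_gt0.
have a20 : 0 < a ^+ 2 by rewrite exprn_gt0.
have a2E : a ^+ 2 = c ^+ 2 / s ^+ 2 by rewrite aE expr_div_n.
have ba : 16 * (W0 + B0)%:R <= a.
  by rewrite -bE aE ler_pdivlMr// mulrC -ler_pdivlMr// mulr_gt0.
have ss : s ^+ 2 <= s / 2 by rewrite expr2; apply: ler_wpM2l => //; exact: ltW.
have da : (W0 + B0)%:R + 2 <= lyap_time * a ^+ 2.
  rewrite -bE -dlE a2E mulrA ler_pdivlMr//.
  move: s5; rewrite ler_pdivlMr// mulrC => s5; apply: le_trans s5.
  by rewrite ler_wpM2l ?(ltW b20)//; move: ss sp; clr; lra.
have qs x : q <= x -> m%:R <= x / s ^+ 2.
  by move=> qx; apply: (le_trans mq); rewrite ler_pM2r ?invr_gt0.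
have ma : m%:R <= lyap_time * a ^+ 2 / 2.
  apply: (le_trans (qs _ qd)); rewrite -dlE a2E; move: (gt_eqF s20); clr => sn.
  by rewrite le_eqVlt; apply/orP; left; apply/eqP; field; move: sn; rewrite expf_eq0 /= => ->.
have sm0 : 0 < s ^+ 2 * m.+1%:R by rewrite mulr_gt0.
have sm1 : s ^+ 2 * m.+1%:R <= 1.
  have : s ^+ 2 * m%:R <= 2^-1 by rewrite mulrC -ler_pdivlMr// qs.
  rewrite -[m.+1%:R]natr1 mulrDr mulr1; move: ss s3; clr; lra.
have pw1 : 1 <= (s ^+ 2 * m.+1%:R)^-1 `^ alpha.
  have one_alpha : 1 `^ alpha = 1 :> R by rewrite powR1.
  rewrite -[X in X <= _]one_alpha ge0_ler_powR ?nnegrE ?(ltW al0) ?invr_ge0 ?(ltW sm0)//.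
  by rewrite -[leLHS]invr1 lef_pV2 ?posrE.
have yx : y <= a ^+ 2 * lyap_frac.
  apply: le_trans (_ : y * (s ^+ 2 * m.+1%:R)^-1 `^ alpha <= _); first by rewrite ler_peMr.
  by apply: (le_trans yq); rewrite -e2E a2E mulrAC ler_pM2r ?invr_gt0// mulrC.
have yq' : (2 * (lyap_time * a ^+ 2) / m.+1%:R) `^ alpha * y <= a ^+ 2 * lyap_frac / 4.
  have -> : 2 * (lyap_time * a ^+ 2) / m.+1%:R = 2 * dl * c ^+ 2 * (s ^+ 2 * m.+1%:R)^-1.
    rewrite -dlE a2E; move: (s ^+ 2) (m.+1%:R : R) (c ^+ 2) => u w d.
    by rewrite invfM; ring.
  rewrite powRM ?invr_ge0 ?(ltW sm0)//; last by rewrite -mulrA mulr_ge0// ltW.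
  rewrite -P2E -mulrA (mulrC _ y); apply: (le_trans (ler_wpM2l (ltW P20) yq)).
  have : P2 * (q / s ^+ 2) <= P2 * (e2 * c ^+ 2 / (4 * P2) / s ^+ 2).
    by rewrite ler_pM2l// ler_pM2r ?invr_gt0.
  move=> /le_trans; apply; rewrite -e2E a2E.
  move: (gt_eqF P20) (gt_eqF s20); clr => Pn sn.
  rewrite le_eqVlt; apply/orP; left; apply/eqP; field.
  by move: sn; rewrite expf_eq0 /= Pn => ->.
have := lyap_phase W0_gt0 B0_gt0 pW0 pW1 pB0 pB1 rho_half a0 da ma phiy y0 yx yq'.
rewrite -dlE; set m1 := Num.truncn (dl * a ^+ 2).
set phi1 := (X in word_prob m1 X) => ph1.
rewrite -dlE in da ma.
pose m2 := Num.truncn (Bq * a ^+ 2).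
have /truncn_itv/andP[m1l m1u] : 0 <= dl * a ^+ 2 by rewrite mulr_ge0 ?ltW.
have /truncn_itv/andP[m2l m2u] : 0 <= Bq * a ^+ 2 by rewrite mulr_ge0 ?ltW.
rewrite -/m1 in m1l m1u; rewrite -/m2 in m2l m2u.
rewrite -[m1.+1%:R]natr1 in m1u; rewrite -[m2.+1%:R]natr1 in m2u.
have dB : dl * a ^+ 2 <= Bq * a ^+ 2 by rewrite ler_pM2r// BqE lerDr ltW.
rewrite -bE in da.
have m1h : dl * a ^+ 2 / 2 <= m1%:R by move: m1u da b2; clr; lra.
have m2h : Bq * a ^+ 2 / 2 <= m2%:R by move: m2u dB da b2; clr; lra.
have mm1 : (m <= m1)%N by rewrite -(ler_nat R) (le_trans ma).
have m12 : (m1 <= m2)%N by apply: le_truncn.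
have m2n : (m2 <= n)%N.
  by rewrite -(ler_nat R); apply: (le_trans m2l); rewrite a2E mulrA ler_pdivrMr.
(* The strip of [th2] is [|dev| < a / 2] and that of [th3] is [|dev| < a]. Being inside the former
   at time [m2] is the starting condition of the last phase. *)
pose th2 := pi / a; pose th3 := pi / (2 * a).
have aa0 : 0 < 2 * a by rewrite mulr_gt0.
have small h : lyap h <= a ^+ 2 * lyap_frac ->
    (forall kd, `|dev kd h| <= a / 4) /\ `|added_mart h| <= a / 4.
  by move=> ly; apply: (@lyap_small R W0 B0 pW pB).
have phi1dev h : (m1 <= size h)%N -> phi1 h ->
    (forall kd, `|dev kd h| <= a / 4) /\ `|added_mart h| <= a / 4.
  move=> m1h' ph; apply: small.
  pose phi0 (h : word) := (size h == m) && phi h.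
  have phi0x h' : phi0 h' -> lyap h' <= a ^+ 2 * lyap_frac.
    by move=> /andP[/eqP hm ph']; apply: le_trans yx; exact: phiy.
  by apply: (@stay_last m (fun h => lyap h <= a ^+ 2 * lyap_frac) h phi0) => //; exact: leq_trans m1h'.
pose psi1 (h : word) := (m1 <= size h)%N && phi1 h.
have thaK : 0 < a / 4 by rewrite divr_gt0.
have psi1dev h : psi1 h -> `|th2 * dev kd h| <= pi / 4 /\ (kd -> `|th2 / K * added_mart h| <= pi / 4).
  move=> /andP[h1 h2]; have [d1 d2] := phi1dev h h1 h2; split.
    rewrite (_ : th2 * _ = pi / a / 1 * dev kd h); last by rewrite divr1.
    by apply: scaled_le; rewrite ?mulr1.
  by move=> _; apply: scaled_le => //; apply: (le_trans d2); rewrite ler_peMr// ltW.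
have th20 : 0 < th2 by rewrite divr_gt0.
have th30 : 0 < th3 by rewrite divr_gt0.
have th32 : th2 = 2 * th3.
  by rewrite /th2 /th3; move: (gt_eqF a0); clr => an; field; rewrite an.
have th2s : th2 = pi * s / c.
  by rewrite /th2 aE; move: (gt_eqF sp) (gt_eqF c0); clr => sn cn; field; rewrite sn cn.
have th2t : 0 < th2 <= t2.
  by rewrite th20 th2s ler_pdivrMr// mulrC -ler_pdivlMr.
have th3t : 0 < th3 <= t3.
  have : th2 <= t3 by rewrite th2s ler_pdivrMr// mulrC -ler_pdivlMr.
  by rewrite th30 th32; move: th30; clr; lra.
have th2sq : th2 ^+ 2 * a ^+ 2 = pi ^+ 2.
  by rewrite -exprMn /th2 divfK// gt_eqF.
have pi4 : 4 <= pi ^+ 2 :> R.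
  by rewrite (_ : 4 = 2 ^+ 2) ?lerXn2r// ?nnegrE// ?(ltW pi0)//; rewrite expr2; clr; lra.
have th22 : 0 < th2 ^+ 2 by rewrite exprn_gt0.
have cond2 : 5 * K / (k2 * sig2) <= th2 ^+ 2 * m1%:R.
  apply: (le_trans _ (ler_wpM2l (ltW th22) m1h)).
  rewrite (_ : th2 ^+ 2 * _ = dl * (th2 ^+ 2 * a ^+ 2) / 2); last by clr; ring.
  rewrite th2sq (_ : 5 * K / (k2 * sig2) = dl * (5 / 3)); last first.
    rewrite k2E; move: (gt_eqF sig0) (gt_eqF dl0) (gt_eqF K0); clr => sn dn Kn.
    by field; rewrite sn dn Kn.
  rewrite -mulrA ler_wpM2l ?(ltW dl0)//; move: pi4; clr; lra.
have := phase2 kd th2 m1 m2 psi1 th2t m12 cond2 psi1dev.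
set phi2 := (X in word_prob m2 X) => ph2.
have psi1strip h : psi1 h -> in_strip kd th2 (th2 / K) h.
  move=> /psi1dev[g1 g2]; rewrite /in_strip (le_lt_trans g1) /=; last by move: pi0; clr; lra.
  by apply/implyP => /g2 {}g2; apply: (le_lt_trans g2); move: pi0; clr; lra.
pose psi2 (h : word) := (m2 <= size h)%N && phi2 h.
have half_strip z : `|th2 * z| < pi / 2 -> `|th3 * z| <= pi / 4.
  by rewrite th32 -mulrA normrM ger0_norm//; clr; lra.
have psi2dev h : psi2 h -> `|th3 * dev kd h| <= pi / 4 /\ (kd -> `|th3 / K * added_mart h| <= pi / 4).
  move=> /andP[h1 h2].
  have : in_strip kd th2 (th2 / K) h.
    by apply: (@stay_last m1 (in_strip kd th2 (th2 / K)) h psi1) => //; exact: leq_trans h1.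
  move=> /andP[/half_strip g1 g2]; split=> // kt; move: g2; rewrite kt /= => g2.
  by rewrite -mulrA half_strip// mulrA.
have th32sq : th3 ^+ 2 * a ^+ 2 = pi ^+ 2 / 4.
  by rewrite -th2sq th32; clr; field.
have th32_0 : 0 < th3 ^+ 2 by rewrite exprn_gt0.
have cond3 : 5 * K / (k3 * sig2) <= th3 ^+ 2 * m2%:R.
  apply: (le_trans _ (ler_wpM2l (ltW th32_0) m2h)).
  rewrite (_ : th3 ^+ 2 * _ = Bq * (th3 ^+ 2 * a ^+ 2) / 2); last by clr; ring.
  have : Bq * 1 <= Bq * (th3 ^+ 2 * a ^+ 2).
    by rewrite th32sq ler_wpM2l ?(ltW Bq0)//; move: pi4; clr; lra.
  rewrite BqE in Bq0 *; rewrite mulr1; move: dl0.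
  have -> : 10 * K / (k3 * sig2) = 2 * (5 * K / (k3 * sig2)) by clr; ring.
  by clr; lra.
have := phase3 kd th3 m2 n psi2 th3t m2n cond3 psi2dev.
set phi3 := (X in word_prob n X) => ph3.
have wp0 k g : 0 <= word_prob k g by apply: word_prob_ge0.
have eq1 : word_prob m1 phi1 = word_prob m1 psi1.
  by apply: eq_word_mean => // h hm; rewrite /psi1 hm leqnn.
have eq2 : word_prob m2 phi2 = word_prob m2 psi2.
  by apply: eq_word_mean => // h hm; rewrite /psi2 hm leqnn.
have g2 : f2 * word_prob m1 phi1 <= word_prob m2 phi2.
  have k24 : 0 < (4 * (1 + 2 * k2) ^+ 2)^-1 by rewrite invr_gt0 mulr_gt0.
  rewrite eq1; apply: le_trans ph2; rewrite ler_wpM2r// /f2 ler_pM2r//.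
  rewrite ler_expR lerN2 -L2E -mulrA ler_wpM2l//; first by move: k20; clr; lra.
  rewrite -!(mulrA L2) ler_wpM2l ?(ltW L20)// -th2sq -mulrA ler_wpM2l ?(ltW th22)//.
  by rewrite mulrC.
have g3 : expR (- ((1 + eta) * (pi ^+ 2 * sig2 / (8 * c ^+ 2)) * (n%:R * s ^+ 2))) * f3
     * word_prob m2 phi2 <= word_prob n phi3.
  rewrite eq2; apply: le_trans ph3; rewrite ler_wpM2r// /f3 div1r.
  have k34 : 0 < (4 * (1 + 2 * k3) ^+ 2)^-1 by rewrite invr_gt0 mulr_gt0.
  rewrite ler_pM2r// ler_expR lerN2.
  have -> : (1 + k3) * ((sig2 + 1 / K ^+ 2) * bump_rate k3 * th3 ^+ 2) * n%:R =
    (1 + k3) * ((sig2 + 1 / K ^+ 2) * bump_rate k3) * (th3 ^+ 2 * n%:R) by clr; ring.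
  have -> : (1 + eta) * (pi ^+ 2 * sig2 / (8 * c ^+ 2)) * (n%:R * s ^+ 2) =
     (1 + eta) * sig2 / 2 * (th3 ^+ 2 * n%:R).
    have -> : th3 = pi * s / c / 2 by rewrite -th2s th32; clr; field.
    by move: (gt_eqF c0); clr => cn; field; rewrite cn.
  by rewrite ler_wpM2r// mulr_ge0// ltW.
have fin : 2^-1 * f2 * f3 *
    expR (- ((1 + eta) * (pi ^+ 2 * sig2 / (8 * c ^+ 2)) * (n%:R * s ^+ 2))) *
    word_prob m phi <= word_prob n phi3.
  apply: le_trans g3.
  have f3e : 0 <= expR (- ((1 + eta) * (pi ^+ 2 * sig2 / (8 * c ^+ 2)) * (n%:R * s ^+ 2))) * f3.
    by rewrite mulr_ge0 ?expR_ge0 ?(ltW f30).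
  apply: (le_trans _ (ler_wpM2l f3e g2)).
  have := ler_wpM2l (mulr_ge0 f3e (ltW f20)) ph1.
  move=> H; rewrite [leRHS]mulrA; apply: le_trans H.
  by rewrite le_eqVlt; apply/orP; left; apply/eqP; clr; ring.
apply: (le_trans fin).
apply: word_prob_le => // h hn /andP[/andP[_ /andP[/andP[_ ph1h] st2]] st3].
have m2h' : (m2 <= size h)%N by rewrite hn.
have m1h' : (m1 <= size h)%N by rewrite (leq_trans m12).
have mh' : (m <= size h)%N by rewrite (leq_trans mm1).
rewrite past_past// in ph1h.
have sz2 : size (past m2 h) = m2 by rewrite size_past.
have sz1 : size (past m1 h) = m1 by rewrite size_past.
have /andP[/andP[_ ph] st1] := ph1h.
rewrite past_past// in ph; rewrite ph /=.
apply/stayP => j /andP[mj jh]; rewrite -aE.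
have [jm1|m1j] := leqP j m1.
  have lj : lyap (past j h) <= a ^+ 2 * lyap_frac.
    by move/stayP: st1 => /(_ j); rewrite sz1 mj jm1 past_past//; apply.
  have [dv _] := small _ lj.
  by apply: (le_trans (dv kd)); move: a0; clr; lra.
have [jm2|m2j] := leqP j m2.
  have := stayP _ _ _ st2 j; rewrite sz2 m1j jm2 past_past// => /(_ isT).
  by move=> /(strip_dev a0)/ltW dv; apply: (le_trans dv); move: a0; clr; lra.
have := stayP _ _ _ st3 j; rewrite m2j jh => /(_ isT).
by move=> /(strip_dev aa0)/ltW dv; apply: (le_trans dv); move: a0; clr; lra.
Qed.


End ConfinementThreePhases.

(** * Almost sure statements *)

Section AlmostSure.
Context d (T : measurableType d) (R : realType) (P : probability T R).

Lemma limn_einf_eq (u : nat -> R) (c : R) :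
  (forall j : nat, \forall n \near \oo, c - j.+1%:R^-1 <= u n) ->
  (forall j N : nat, exists2 n, (N <= n)%N & u n <= c + j.+1%:R^-1) ->
  limn_einf (fun n => (u n)%:E) = c%:E.
Proof.
move=> lo up; rewrite limn_einf_lim.
have small e : 0 < e -> exists j : nat, j.+1%:R^-1 <= e :> R.
  move=> e0; have [N _ /(_ N (leqnn N))/= H] := near_infty_natSinv_lt (PosNum e0).
  by exists N; exact: ltW.
apply/eqP; rewrite eq_le; apply/andP; split.
  apply/lee_addgt0Pr => e /small[j je].
  apply: lime_le; first exact: is_cvg_einfs.
  apply: nearW => N; have [n Nn un] := up j N.
  apply: (@le_trans _ _ (u n)%:E); first by apply: ereal_inf_lbound; exists n.
  by rewrite -EFinD lee_fin (le_trans un)// lerD2l.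
apply/lee_subgt0Pr => e /small[j je].
apply: lime_ge; first exact: is_cvg_einfs.
have [N _ uN] := lo j; exists N => // k /= Nk.
apply: le_ereal_inf_tmp => _ [n /= kn <-]; rewrite -EFinB lee_fin.
apply: (@le_trans _ _ (c - j.+1%:R^-1)); first by rewrite lerD2l lerN2.
by apply: uN => /=; exact: leq_trans kn.
Qed.

(** Summability enters through the decrements of a non-negative [g]: the partial sums from [K] on
    telescope and stay below [g K]. *)
Lemma borel_cantelli_ae (F : (set T)^nat) (g : nat -> R) (K : nat) :
  (forall k, measurable (F k)) -> (forall k, 0 <= g k) ->
  (forall k, (K <= k)%N -> (P (F k) <= (g k - g k.+1)%:E)%E) ->
  {ae P, forall w, \forall k \near \oo, ~ F k w}.
Proof.
move=> mF g0 PF; pose F' k := F (k + K)%N.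
have bound n : (\sum_(0 <= k < n) P (F' k) <= (g K)%:E)%E.
  apply: (@le_trans _ _ (\sum_(0 <= k < n) (g (k + K) - g (k + K).+1)%:E)%E).
    by apply: lee_sum => k _; apply: PF; exact: leq_addl.
  rewrite sumEFin lee_fin.
  have -> : \sum_(0 <= k < n) (g (k + K)%N - g (k + K).+1) = g K - g (n + K)%N.
    elim: n => [|n IH]; first by rewrite big_geq// subrr.
    by rewrite big_nat_recr//= IH addrA subrK addSn.
  by rewrite gerBl.
have F0 : P (lim_sup_set F') = 0%E.
  apply: lim_sup_set_cvg0 => [k|]; first exact: mF.
  apply: (@le_lt_trans _ _ (g K)%:E); last exact: ltry.
  apply: lime_le; first by apply: is_cvg_nneseries.
  exact: nearW.
have mL : measurable (lim_sup_set F').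
  by apply: bigcapT_measurable => n; apply: bigcup_measurable => k _; exact: mF.
exists (lim_sup_set F'); split => // w /= H n _.
apply: contrapT => Hn; apply: H; exists (n + K)%N => // k /= nk Fk.
apply: Hn; exists (k - K)%N => /=.
  by rewrite -(leq_add2r K) subnK// (leq_trans _ nk)// leq_addl.
by rewrite /F' subnK// (leq_trans _ nk)// leq_addl.
Qed.

(** It stands in for the second Borel-Cantelli lemma where independence fails: [E k] will be a
    failure, and long runs of failures are shown to be improbable. *)
Lemma ae_infinitely_often (E : (set T)^nat) :
  (forall k, measurable (E k)) ->
  (forall K e, 0 < e -> exists2 L, (K <= L)%N &
     (P (\bigcap_(k in [set k | (K <= k < L)%N]) E k) <= e%:E)%E) ->
  {ae P, forall w, forall K, exists2 k, (K <= k)%N & ~ E k w}.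
Proof.
move=> mE small; apply/ae_foralln => K.
have mB : measurable (\bigcap_(k in [set k | (K <= k)%N]) E k).
  by apply: bigcap_measurable => //; exists K => /=.
exists (\bigcap_(k in [set k | (K <= k)%N]) E k); split => //.
  apply/eqP; rewrite eq_le measure_ge0 andbT; apply/lee_addgt0Pr => e e0.
  have [L KL PL] := small K e e0; rewrite add0e; apply: le_trans PL.
  apply: le_measure; rewrite ?inE//.
    exact: bigcap_measurableType.
  by move=> w Ew k /= /andP[Kk _]; exact: Ew.
by move=> w /= H k /= Kk; apply: contrapT => nE; apply: H; exists k.
Qed.

End AlmostSure.

(** * The iterated-logarithm scale and geometric times *)

Section Scale.
Variable R : realType.

Definition lnln (n : nat) : R := ln (ln n%:R).
Definition lil_scale (n : nat) : R := Num.sqrt (lnln n / n%:R).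

Lemma ln_natr_gt0 n : (2 < n)%N -> 0 < ln (n%:R : R).
Proof. by move=> n2; apply: ln_gt0; rewrite (ltr_nat _ 1) ltnW. Qed.

Lemma le_lnln m n : (2 < m)%N -> (m <= n)%N -> lnln m <= lnln n.
Proof.
move=> m2 mn; have n2 := leq_trans m2 mn.
have m0 : (0 < m)%N by apply: leq_trans m2.
have n0 : (0 < n)%N by apply: leq_trans n2.
rewrite ler_ln ?posrE ?ln_natr_gt0// ler_ln ?posrE ?ltr0n//.
by rewrite ler_nat.
Qed.

Lemma expR_lnln n : (2 < n)%N -> expR (lnln n) = ln n%:R.
Proof. by move=> n2; rewrite lnK// posrE ln_natr_gt0. Qed.

Lemma lnln_ge (B : R) : \forall n \near \oo, B <= lnln n.
Proof.
exists (maxn 3 (Num.truncn (expR (expR B))).+1) => // n /=.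
rewrite geq_max => /andP[n2 Bn].
have n0 : 0 < n%:R :> R by rewrite ltr0n; apply: leq_trans n2.
rewrite -ler_expR expR_lnln// -ler_expR lnK ?posrE//.
by rewrite ltW// (lt_le_trans (truncnS_gt _))// ler_nat.
Qed.

Lemma lnln_pow4_le n : (2 < n)%N -> 0 <= lnln n -> lnln n ^+ 4 <= 24 * n%:R.
Proof.
move=> n2 l0; have n0 : 0 < n%:R :> R by rewrite ltr0n; apply: leq_trans n2.
have := expR_ge1Dxn 3 l0; rewrite expR_lnln// => h.
have : lnln n ^+ 4 / 24 <= ln n%:R.
  apply: le_trans h; rewrite (_ : 4`!%:R = 24 :> R); last by rewrite !factS fact0.
  by rewrite lerDr.
by have := ln_sublinear n0; lra.
Qed.

Lemma lil_scale_near (B s0 : R) : 0 < s0 -> \forall n \near \oo,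
  [/\ (2 < n)%N, 1 <= lnln n, B <= lnln n, 0 < lil_scale n <= s0 &
      n%:R * lil_scale n ^+ 2 = lnln n /\ n%:R * lil_scale n ^+ 3 <= 1].
Proof.
move=> s00.
have s20 : 0 < s0 ^+ 2 by rewrite exprn_gt0.
near=> n.
have n2 : (2 < n)%N by near: n; exists 3%N.
have l1 : 1 <= lnln n by near: n; exact: lnln_ge.
(* One factor [lnln n] is traded for the constant 24 of [lnln_pow4_le], which leaves
   [lnln n ^+ 3 <= n]; this is [n * s ^+ 3 <= 1] squared. *)
have l24 : 24 <= lnln n by near: n; exact: lnln_ge.
have ls : 24 / s0 ^+ 2 <= lnln n by near: n; exact: lnln_ge.
have l0 : 0 < lnln n by lra.
have n0 : 0 < n%:R :> R by rewrite ltr0n; apply: leq_trans n2.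
have l4 := lnln_pow4_le n2 (ltW l0).
have l30 : 0 < lnln n ^+ 3 by rewrite exprn_gt0.
have l3 : lnln n ^+ 3 <= n%:R.
  have : 24 * lnln n ^+ 3 <= lnln n * lnln n ^+ 3 by rewrite ler_pM2r.
  by rewrite -exprS; lra.
have ln0 : 0 <= lnln n / n%:R by rewrite divr_ge0 ?ltW.
have sq : lil_scale n ^+ 2 = lnln n / n%:R by rewrite sqr_sqrtr.
have s_gt0 : 0 < lil_scale n by rewrite sqrtr_gt0 divr_gt0.
have nn0 : n%:R != 0 :> R by rewrite gt_eqF.
split => //.
- by near: n; exact: lnln_ge.
- rewrite s_gt0 /= -(@ler_pXn2r _ 2) ?nnegrE ?(ltW s_gt0) ?(ltW s00)// sq ler_pdivrMr//.
  have := ler_wpM2r (ltW l30) ls; rewrite -exprS => hh.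
  have : lnln n * 1 <= lnln n * lnln n ^+ 2.
    by rewrite ler_pM2l// exprn_ege1.
  rewrite mulr1 -exprS => l13.
  have : lnln n * (24 / s0 ^+ 2) <= 24 * n%:R.
    apply: (le_trans _ l4); apply: (le_trans _ hh); rewrite mulrC ler_wpM2l//.
    by rewrite divr_ge0 ?ltW.
  by rewrite mulrCA ler_pM2l// ler_pdivrMr// mulrC.
- split; first by rewrite sq mulrC divfK.
  rewrite -(@ler_pXn2r _ 2) ?nnegrE ?mulr_ge0 ?exprn_ge0 ?(ltW s_gt0) ?(ltW n0)//.
  rewrite expr1n exprMn -exprM mulnC exprM sq.
  have -> : n%:R ^+ 2 * (lnln n / n%:R) ^+ 3 = lnln n ^+ 3 / n%:R.
    by field.
  by rewrite ler_pdivrMr// mul1r.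
Unshelve. all: by end_near. Qed.

Lemma bernoulli_ineq (r : R) k : 1 <= r -> 1 + k%:R * (r - 1) <= r ^+ k.
Proof.
move=> r1; elim: k => [|k IH]; first by rewrite mul0r addr0 expr0.
rewrite exprS; have := ler_wpM2l (le_trans ler01 r1) IH; apply: le_trans.
rewrite -natr1; have : 0 <= k%:R * (r - 1) ^+ 2 by rewrite mulr_ge0// sqr_ge0.
by rewrite -subr_ge0 => h; rewrite -subr_ge0 [X in 0 <= X](_ : _ = k%:R * (r - 1) ^+ 2); [lra|ring].
Qed.

(** With the successor, [geom_time r k] is at least [r ^+ k], and every [n] strictly below
    [geom_time r k.+1] is at most [r ^+ k.+1], hence at most [r * geom_time r k]. *)
Definition geom_time (r : R) k := (Num.truncn (r ^+ k)).+1.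

Lemma geom_time_ge r k : r ^+ k <= (geom_time r k)%:R.
Proof. by rewrite ltW// truncnS_gt. Qed.

Lemma geom_time_large r N : 1 < r -> exists k0, forall k, (k0 <= k)%N -> (N <= geom_time r k)%N.
Proof.
move=> r1; exists (Num.truncn (N%:R / (r - 1))).+1 => k kk.
have r0 : 0 < r - 1 by lra.
rewrite -(ler_nat R); apply: le_trans (geom_time_ge _ _).
apply: le_trans (bernoulli_ineq _ (ltW r1)).
have : N%:R / (r - 1) <= k%:R.
  by apply: ltW; apply: (lt_le_trans (truncnS_gt _)); rewrite ler_nat.
by rewrite ler_pdivrMr//; lra.
Qed.

Lemma geom_time_bracket r K n : 1 < r -> (geom_time r K <= n)%N ->
  exists2 k, (K <= k)%N & (geom_time r k <= n < geom_time r k.+1)%N.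
Proof.
move=> r1 Kn; have [k0 large] := geom_time_large n.+1 r1.
have ub k : (geom_time r k <= n)%N -> (k <= k0)%N.
  move=> kn; rewrite leqNgt; apply/negP => k0k.
  by have := leq_trans (large k (ltnW k0k)) kn; rewrite ltnn.
have exk : exists k, (geom_time r k <= n)%N by exists K.
have [k kn kmax] := ex_maxnP exk ub.
exists k; first exact: kmax.
rewrite kn /= ltnNge; apply/negP => /kmax; by rewrite ltnn.
Qed.

(** Summability of a power below -1, in the form that [borel_cantelli_ae] expects. *)
Lemma powRN_telescope (k delta : R) : 1 < k -> 0 < delta ->
  k `^ (- (1 + delta)) <= ((k - 1) `^ (- delta) - k `^ (- delta)) / delta.
Proof.
move=> k1 d0; have k0 : 0 < k by lra.
rewrite ler_pdivlMr// lerBrDr opprD.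
have -> : k `^ (-1 - delta) = k `^ (- delta) / k.
  have kn0 : k != 0 by rewrite gt_eqF.
  by rewrite addrC powRD ?kn0 ?implybT// powR_inv1 ?ltW.
have km : 0 < (k - 1) `^ delta by rewrite powR_gt0// subr_gt0.
have kp : 0 < k `^ delta by rewrite powR_gt0.
have -> : k `^ (- delta) / k * delta + k `^ (- delta) = k `^ (- delta) * (1 + delta / k) by ring.
rewrite !powRN ler_pdivrMl// ler_pdivlMr//.
have /powR_pred_le/(_ (ltW d0)) h := k1.
apply: (le_trans (ler_pM _ (ltW km) (expR_ge1Dx (delta / k)) h)).
  by apply: addr_ge0 => //; apply: divr_ge0; exact: ltW.
by rewrite mulrCA expRN divff ?mulr1// gt_eqF// expR_gt0.
Qed.

End Scale.

(** * Lower bound for the liminf *)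

Section LiminfLower.
Context d (T : measurableType d) (R : realType) (P : probability T R).
Variables (W0 B0 : nat) (pW pB : R) (drawn added : {RV P >-> bool}^nat).
Hypothesis W0_gt0 : (0 < W0)%N.
Hypothesis pW0 : 0 < pW.
Hypothesis pW1 : pW < 1.
Hypothesis pB0 : 0 < pB.
Hypothesis pB1 : pB < 1.
Hypothesis urn : play_the_winner_urn W0 B0 pW pB drawn added.
Local Notation sig2 := (limit_var pW pB).
Local Notation dev := (dev W0 pW pB).
Local Notation history := (history drawn added).

Lemma stay_history m (G : pred word) n w : (m <= n)%N ->
  reflect (forall j, (m < j <= n)%N -> G (history j w)) (stay m G (history n w)).
Proof.
move=> mn; apply: (iffP (stayP _ _ _)) => H j.
  by move=> /andP[mj jn]; have := H j; rewrite size_history mj jn past_history//; apply.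
by rewrite size_history => /andP[mj jn]; rewrite past_history//; apply: H; rewrite mj.
Qed.

(** The width [c1] lies strictly between [c] and the critical value. The gap above it gives
    summability along geometric times; the gap below it is spent on the ratio
    [r = c1 ^+ 2 / c ^+ 2], so that an exit at [c1] by time [geom_time r k] is an exit at [c] for
    every [n] before the next such time. *)
Lemma dev_liminf_lower kd (c : R) : 0 < c -> c ^+ 2 < pi ^+ 2 * sig2 / 8 ->
  {ae P, forall w, \forall n \near \oo, exists2 m, (0 < m <= n)%N &
     c < lil_scale R n * `|dev kd (history m w)|}.
Proof.
move=> c0 cc; have pi0 := pi_gt0 R.
have c20 : 0 < c ^+ 2 by rewrite exprn_gt0.
have [k2 k2E] : {k : R | k = pi ^+ 2 * sig2 / 8} by exists (pi ^+ 2 * sig2 / 8).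
rewrite -k2E in cc.
have [c1 c1E] : {c1 : R | c1 = Num.sqrt ((c ^+ 2 + k2) / 2)} by exists (Num.sqrt ((c ^+ 2 + k2) / 2)).
have c1sq : c1 ^+ 2 = (c ^+ 2 + k2) / 2 by rewrite c1E sqr_sqrtr//; lra.
have c1_gt0 : 0 < c1 by rewrite c1E sqrtr_gt0; lra.
have c1sq0 : 0 < c1 ^+ 2 by rewrite exprn_gt0.
have c1k : c1 ^+ 2 < k2 by rewrite c1sq; lra.
have cc1 : c ^+ 2 < c1 ^+ 2 by rewrite c1sq; lra.
have [r rE] : {r : R | r = c1 ^+ 2 / c ^+ 2} by exists (c1 ^+ 2 / c ^+ 2).
have r1 : 1 < r by rewrite rE ltr_pdivlMr// mul1r.
have [X XE] : {X : R | X = k2 / c1 ^+ 2} by exists (k2 / c1 ^+ 2).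
have X1 : 1 < X by rewrite XE ltr_pdivlMr// mul1r.
have X0 : 0 < X by lra.
(* Since [(1 - dl) ^+ 3] is at least [1 - 3 * dl], it suffices that [dl * (3 * X + 1) <= X - 1]; as
   [1 < X], this holds when [dl * (4 * X) = X - 1]. *)
have [dl dlE] : {dl : R | dl = (X - 1) / (4 * X)} by exists ((X - 1) / (4 * X)).
have dl0 : 0 < dl by rewrite dlE divr_gt0 ?mulr_gt0// subr_gt0.
have dlX : dl * (4 * X) = X - 1 by rewrite dlE divfK// gt_eqF// mulr_gt0.
have dl1 : dl < 1.
  by rewrite dlE ltr_pdivrMr ?mulr_gt0//; lra.
have expo : 1 + dl <= (1 - dl) ^+ 3 * X.
  have : 0 <= dl ^+ 2 * (3 - dl) by rewrite mulr_ge0 ?sqr_ge0//; lra.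
  have e3 : (1 - dl) ^+ 3 = 1 - 3 * dl + dl ^+ 2 * (3 - dl) by ring.
  move=> h; have := mulr_ge0 h (ltW X0); rewrite e3 mulrDl; have X10 : 0 < X - 1 by lra.
  have := mulr_gt0 dl0 X10; lra.
have dl01 : 0 < dl < 1 by rewrite dl0.
have [K [s0 [s00 upper]]] := @confinement_upper R W0 B0 pW pB W0_gt0 pW0 pW1 pB0 pB1 c1 dl c1_gt0 dl01.
have ratio : pi ^+ 2 * sig2 / (8 * c1 ^+ 2) = X.
  by rewrite XE k2E invfM mulrA.
rewrite ratio in upper.
have [N _ scaleN] := lil_scale_near 0 s00.
have [k0 large] := geom_time_large N r1.
pose F k := [set w | stay 0 (fun h => `|dev kd h| <= c1 / lil_scale R (geom_time r k))
                            (history (geom_time r k) w)].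
have mF k : measurable (F k) by exact: (measurable_history _ _ _ (stay 0 _)).
have lr0 : 0 < ln r by apply: ln_gt0.
have [D DE] : {D : R | D = expR K + 2} by exists (expR K + 2).
have D0 : 0 <= D by rewrite DE addr_ge0// expR_ge0.
pose g (k : nat) : R := D * ln r `^ (- (1 + dl)) * ((k%:R - 1) `^ (- dl) / dl).
have g0 k : 0 <= g k by rewrite !mulr_ge0 ?powR_ge0 ?invr_ge0 ?(ltW dl0).
have PF k : (maxn k0 2 <= k)%N -> (P (F k) <= (g k - g k.+1)%:E)%E.
  rewrite geq_max => /andP[kk0 k2'].
  have [n2 l1 _ sn [ns2 ns3]] := scaleN _ (large k kk0).
  rewrite (measure_history urn) lee_fin.
  set n := geom_time r k in n2 l1 sn ns2 ns3 *.
  rewrite -ns2 in l1; apply: (le_trans (upper kd n _ sn l1 ns3)).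
  rewrite ns2 in l1 *.
  have kR : 1 < k%:R :> R by rewrite ltr1n.
  have logk : k%:R * ln r <= ln n%:R.
    have r0 : 0 < r by lra.
    have : ln (r ^+ k) <= ln n%:R by rewrite ler_ln ?posrE ?exprn_gt0 ?ltr0n// geom_time_ge.
    by rewrite lnXn// mulr_natl.
  have pow : expR (- ((1 + dl) * lnln R n)) <= k%:R `^ (- (1 + dl)) * ln r `^ (- (1 + dl)).
    have klr : 0 < k%:R * ln r by rewrite mulr_gt0//; lra.
    rewrite -powRM ?(ltW lr0)// /powR gt_eqF// ler_expR mulNr lerN2 ler_wpM2l//; first by lra.
    by rewrite ler_ln ?posrE// (lt_le_trans klr).
  have tele := powRN_telescope kR dl0.
  have e1 : expR (K - (1 - dl) ^+ 3 * X * lnln R n) <= expR K * expR (- ((1 + dl) * lnln R n)).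
    rewrite -expRD ler_expR lerD2l lerN2 ler_wpM2r//; lra.
  have e2 : expR (- (4 * lnln R n)) <= expR (- ((1 + dl) * lnln R n)).
    rewrite ler_expR lerN2 ler_wpM2r//; lra.
  apply: (@le_trans _ _ (D * expR (- ((1 + dl) * lnln R n)))).
    by rewrite DE [leRHS]mulrDl; apply: lerD => //; rewrite ler_pM2l.
  apply: (@le_trans _ _ (D * (k%:R `^ (- (1 + dl)) * ln r `^ (- (1 + dl))))).
    by rewrite ler_wpM2l.
  have lrp : 0 <= D * ln r `^ (- (1 + dl)) by rewrite mulr_ge0 ?powR_ge0.
  have -> : g k - g k.+1 = D * ln r `^ (- (1 + dl)) *
      (((k%:R - 1) `^ (- dl) - k%:R `^ (- dl)) / dl).
    by rewrite /g -natr1 addrK; ring.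
  rewrite [leLHS](_ : _ = D * ln r `^ (- (1 + dl)) * k%:R `^ (- (1 + dl))); last by ring.
  exact: ler_wpM2l.
have := borel_cantelli_ae mF g0 PF; apply: filterS => w [K1 _ notF].
pose K2 := maxn K1 k0.
exists (maxn N (geom_time r K2)) => // n /=; rewrite geq_max => /andP[Nn Kn].
have [k Kk /andP[kn nk]] := geom_time_bracket r1 Kn.
move: Kk; rewrite geq_max => /andP[K1k k0k].
have [_ l1 _ /andP[sn _] [ns2 _]] := scaleN _ Nn.
have [n2' l1' _ /andP[sn' _] [ns2' _]] := scaleN _ (large k k0k).
have /(_ K1k) nF := notF k.
have [m mk dm] : exists2 m, (0 < m <= geom_time r k)%N &
    c1 / lil_scale R (geom_time r k) < `|dev kd (history m w)|.
  apply: contrapT => H; apply: nF; apply: (introT (@stay_history 0 _ (geom_time r k) w (leq0n _))) => j jk.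
  by rewrite leNgt; apply/negP => dj; apply: H; exists j.
exists m; first by case/andP: mk => -> mk; rewrite (leq_trans mk).
have nn0 : 0 < n%:R :> R by rewrite ltr0n (leq_trans _ kn).
have nk0 : 0 < (geom_time r k)%:R :> R by rewrite ltr0n.
have cmp : lil_scale R (geom_time r k) * c <= c1 * lil_scale R n.
  rewrite -(@ler_pXn2r _ 2) ?nnegrE ?mulr_ge0 ?(ltW c0) ?(ltW c1_gt0) ?(ltW sn) ?(ltW sn')//.
  rewrite !exprMn -(ler_pM2l nk0) mulrA ns2'.
  have nr : n%:R <= r * (geom_time r k)%:R.
    have nt : (n <= Num.truncn (r ^+ k.+1))%N by rewrite -ltnS.
    apply: (@le_trans _ _ (r ^+ k.+1)).
      apply: (@le_trans _ _ (Num.truncn (r ^+ k.+1))%:R); first by rewrite ler_nat.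
      by rewrite truncn_le exprn_ge0//; lra.
    by rewrite exprS ler_pM2l ?geom_time_ge//; lra.
  have le1 : lnln R (geom_time r k) <= n%:R * lil_scale R n ^+ 2.
    by rewrite ns2; apply: le_lnln.
  have -> : c1 ^+ 2 = r * c ^+ 2 by rewrite rE divfK// gt_eqF.
  rewrite [leRHS](_ : _ = r * (geom_time r k)%:R * lil_scale R n ^+ 2 * c ^+ 2); last by ring.
  rewrite ler_pM2r//; apply: (le_trans le1); rewrite ler_pM2r// exprn_gt0//.
rewrite -(ltr_pM2l sn) in dm; apply: le_lt_trans dm.
by rewrite mulrA ler_pdivlMr// mulrC (mulrC _ c1).
Qed.

End LiminfLower.

(** * Powers of factorials as times *)

Section FactorialTimes.
Variable R : realType.
Implicit Types (d p q : R).

Definition fact_time A k : nat := (k`! ^ A)%N.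

Lemma fact_timeS A k : fact_time A k.+1 = (k.+1 ^ A * fact_time A k)%N.
Proof. by rewrite /fact_time factS expnMn. Qed.

Lemma fact_time_gt0 A k : (0 < fact_time A k)%N.
Proof. by rewrite expn_gt0 fact_gt0. Qed.

Lemma fact_time_ge A k : (0 < A)%N -> (k <= fact_time A k)%N.
Proof.
move=> A0; apply: (@leq_trans k`!).
  by case: k => // k; rewrite factS leq_pmulr ?fact_gt0.
by rewrite -{1}(expn1 k`!) leq_pexp2l ?fact_gt0.
Qed.

Lemma fact_time_homo A j k : (j <= k)%N -> (fact_time A j <= fact_time A k)%N.
Proof. by case: A => // A jk; rewrite leq_exp2r ?leq_fact. Qed.

Lemma ln_le_scaled (x c : R) : 0 < c -> 0 < x -> ln x <= ln c + x / c.
Proof.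
move=> c0 x0; have xc : 0 < x / c by rewrite divr_gt0.
have := ltW (ln_sublinear xc).
by rewrite ln_div ?posrE// lerBlDl.
Qed.

(** From [k! <= k ^ k] the logarithm of the time is at most [A * k * ln k], and [ln k] is at most
    [k] to the power [d], divided by [d]. *)
Lemma lnln_fact_time A k d : (0 < A)%N -> (2 < k)%N -> 0 < d ->
  lnln R (fact_time A k) <= ln (A%:R / d) + (1 + d) * ln k%:R.
Proof.
move=> A0 k2 d0; have k0 : 0 < k%:R :> R by rewrite ltr0n (leq_trans _ k2).
have n2 : (2 < fact_time A k)%N by apply: leq_trans (fact_time_ge k A0).
have Ad : 0 < A%:R / d by rewrite divr_gt0 ?ltr0n.
have kd : 0 < k%:R `^ (1 + d) by rewrite powR_gt0.
rewrite -ln_powR -lnM ?posrE// ler_ln ?posrE ?ln_natr_gt0//; last exact: mulr_gt0.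
have kk : (k`! <= k ^ k)%N.
  elim: {k2 k0 n2 kd} k => // k IH; rewrite factS expnS leq_mul2l /=.
  by apply: (leq_trans IH); case: k {IH} => // k; rewrite leq_exp2r.
have fk : (fact_time A k)%:R <= (k%:R ^+ k) ^+ A :> R.
  by rewrite -!natrX ler_nat leq_exp2r.
have -> : A%:R / d * k%:R `^ (1 + d) = A%:R * (k%:R * (k%:R `^ d / d)).
  rewrite powRD ?powRr1 ?(ltW k0)//; first by ring.
  by rewrite (gt_eqF k0) implybT.
apply: (@le_trans _ _ (ln ((k%:R ^+ k) ^+ A))).
  by rewrite ler_ln ?posrE ?exprn_gt0// ltr0n fact_time_gt0.
rewrite !lnXn ?exprn_gt0// -[leLHS]mulr_natl ler_pM2l ?ltr0n// -[leLHS]mulr_natl ler_pM2l//.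
rewrite ler_pdivlMr// mulrC -ln_powR; apply: ltW; apply: ln_sublinear.
by rewrite powR_gt0.
Qed.

Lemma ln_natr_near (M : R) : \forall k \near \oo, M <= ln k%:R.
Proof.
near=> k; have k0 : expR M <= k%:R by near: k; exact: nbhs_infty_ger.
by rewrite -ler_expR lnK// posrE (lt_le_trans (expR_gt0 M)).
Unshelve. all: by end_near. Qed.

(** The condition on [A] makes the ratio of successive times so large that, raised to the power
    [1 - al], it still beats the factor [k.+1 ^+ 2] allowed for the state at the earlier time. *)
Lemma fact_time_near A (al p q B s0 e : R) :
  0 < al < 1 -> 3 <= (A%:R - 1) * (1 - al) -> 0 < p -> 0 < q -> 0 < s0 -> 0 < e < 1 ->
  \forall k \near \oo, exists2 s, s = lil_scale R (fact_time A k.+1) &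
  [/\ 0 < s <= s0, (fact_time A k)%:R <= q / s ^+ 2 /\
      (fact_time A k)%:R * k.+1%:R ^+ 2 <= q / s ^+ 2,
      B <= (fact_time A k.+1)%:R * s ^+ 2,
      (fact_time A k)%:R * k.+1%:R ^+ 2 * (s ^+ 2 * (fact_time A k).+1%:R)^-1 `^ al
        <= q / s ^+ 2 &
      k.+1%:R^-1 <= p * expR (- ((1 - e) * ((fact_time A k.+1)%:R * s ^+ 2)))].
Proof.
move=> /andP[al0 al1] A3 p0 q0 s00 /andP[e0 e1].
have A0 : (0 < A)%N.
  by rewrite lt0n; apply/eqP => AE; move: A3; rewrite AE; nra.
have [N _ scaleN] := lil_scale_near B s00.
have [C CE] : {C : R | C = ln (A%:R / e)} by exists (ln (A%:R / e)).
suff : \forall k \near \oo, exists2 s, s = lil_scale R (fact_time A k) &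
  [/\ 0 < s <= s0, (fact_time A k.-1)%:R <= q / s ^+ 2 /\
      (fact_time A k.-1)%:R * k%:R ^+ 2 <= q / s ^+ 2,
      B <= (fact_time A k)%:R * s ^+ 2,
      (fact_time A k.-1)%:R * k%:R ^+ 2 * (s ^+ 2 * (fact_time A k.-1).+1%:R)^-1 `^ al
        <= q / s ^+ 2 &
      k%:R^-1 <= p * expR (- ((1 - e) * ((fact_time A k)%:R * s ^+ 2)))].
  by move=> [K _ H]; exists K => // k /= Kk; apply: (H k.+1); rewrite /= ltnW.
near=> k; exists (lil_scale R (fact_time A k)) => //.
have k2 : (2 < k)%N by near: k; exact: nbhs_infty_ge.
have Nn : (N <= fact_time A k)%N.
  by apply: leq_trans (fact_time_ge k A0); near: k; exact: nbhs_infty_ge.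
have [_ l1 lB sn [ns2 _]] := scaleN _ Nn.
have {}ns2 := ns2; have := lnln_fact_time A0 k2 e0; rewrite -CE => lC.
have kq : q^-1 <= k%:R by near: k; exact: nbhs_infty_ger.
have klog : 2 * (C + 2 * ln 8) <= k%:R by near: k; exact: nbhs_infty_ger.
have kp : ((1 - e) * C - ln p) / e ^+ 2 <= ln k%:R by near: k; exact: ln_natr_near.
have k0 : 0 < k%:R :> R by rewrite ltr0n (leq_trans _ k2).
have k1 : 1 <= k%:R :> R by rewrite ler1n (leq_trans _ k2).
have logk0 : 0 <= ln (k%:R : R) by apply: ln_ge0.
have lk : lnln R (fact_time A k) <= k%:R.
  apply: (le_trans lC).
  have := ln_le_scaled (ltr0Sn R 7) k0; have := ler_wpM2r logk0 (ltW e1); lra.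
move: (lil_scale R _) sn ns2 => s /andP[s_gt0 ss0] ns2.
rewrite s_gt0 ss0 ns2.
have s20 : 0 < s ^+ 2 by rewrite exprn_gt0.
have kE : k.-1.+1 = k by rewrite prednK// (leq_trans _ k2).
have m0 : 0 < (fact_time A k.-1)%:R :> R by rewrite ltr0n fact_time_gt0.
have nE : (fact_time A k)%:R = k%:R ^+ A * (fact_time A k.-1)%:R :> R.
  by rewrite -{1}kE fact_timeS natrM natrX kE.
have l0 : 0 < lnln R (fact_time A k) by lra.
move: m0 (nE) l1 lB ns2 lk l0 lC; move: (fact_time A k.-1) (fact_time A k) (lnln R _) => m n l.
move=> m0 {}nE l1 lB ns2 lk l0 lC.
have zE : (s ^+ 2 * m%:R)^-1 = k%:R ^+ A / l.
  have kA0 : k%:R ^+ A != 0 :> R by rewrite gt_eqF// exprn_gt0.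
  by rewrite -ns2 nE -mulrA [in RHS]invfM mulrA divff// mul1r mulrC.
have z_ge : k%:R `^ (A%:R - 1) <= k%:R ^+ A / l.
  rewrite powRD ?powR_mulrn ?(ltW k0)//; last by rewrite (gt_eqF k0) implybT.
  rewrite powRN powRr1 ?(ltW k0)// ler_wpM2l ?exprn_ge0 ?(ltW k0)//.
  by rewrite lef_pV2 ?posrE.
(* [z] compares [1 / s ^+ 2] with the elapsed time [m]. The conditions on the state reduce to
   [k ^+ 2 <= q * z ^ (1 - al)]; the choice of [A] yields [k ^+ 3 <= z ^ (1 - al)], and the spare
   factor [k] absorbs [q]. *)
have [z zdef] : {z : R | z = k%:R ^+ A / l} by exists (k%:R ^+ A / l).
rewrite -zdef in zE z_ge.
have z0 : 0 < z by rewrite zdef divr_gt0// exprn_gt0.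
have qE : q / s ^+ 2 = q * m%:R * z.
  by rewrite -zE -mulrA (invfM (s ^+ 2)) (mulrC (s ^+ 2)^-1) mulVKf // gt_eqF.
have k3 : k%:R ^+ 3 <= z `^ (1 - al).
  apply: (@le_trans _ _ ((k%:R `^ (A%:R - 1)) `^ (1 - al))).
    rewrite -powRrM -[leLHS]powR_mulrn ?(ltW k0)// ler_powR//.
  by rewrite ge0_ler_powR ?nnegrE ?powR_ge0 ?(ltW z0)// subr_ge0 ltW.
have k2z : k%:R ^+ 2 <= q * z `^ (1 - al).
  apply: (@le_trans _ _ (q * k%:R ^+ 3)); last by rewrite ler_pM2l.
  have := ler_wpM2l (ltW q0) kq; rewrite divff ?gt_eqF// => qk.
  have := ler_wpM2r (sqr_ge0 k%:R) qk; lra.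
have z1 : 1 <= z.
  rewrite leNgt; apply/negP => zl.
  have : 1 <= k%:R ^+ 3 :> R by rewrite exprn_ege1.
  move/le_trans/(_ k3); rewrite leNgt => /negP; apply.
  have p1 : (1 : R) `^ (1 - al) = 1 by rewrite powR1.
  by rewrite -[ltRHS]p1 gt0_ltr_powR ?nnegrE ?(ltW z0)// subr_gt0.
have zz : z `^ (1 - al) * z `^ al = z.
  by rewrite -powRD ?subrK ?powRr1 ?(ltW z0)// (gt_eqF z0) implybT.
have za1 : z `^ (1 - al) <= z.
  rewrite -[leRHS]zz ler_peMr ?powR_ge0//.
  by rewrite -[leLHS](powRr0 z) ler_powR// ltW.
have yq : m%:R * k%:R ^+ 2 <= q * m%:R * z.
  rewrite (mulrC q) -mulrA ler_pM2l// (le_trans k2z)// ler_pM2l//.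
split => //.
- rewrite qE; split => //; apply: le_trans yq; rewrite ler_peMr ?(ltW m0)//.
  by rewrite exprn_ege1.
- rewrite qE (mulrC q) -[leLHS]mulrA -[leRHS]mulrA ler_pM2l//.
  apply: (@le_trans _ _ (q * z `^ (1 - al) * z `^ al)); last by rewrite -mulrA zz.
  apply: ler_pM; rewrite ?sqr_ge0 ?powR_ge0//.
  have wz : (s ^+ 2 * m.+1%:R)^-1 <= z.
    rewrite -zE lef_pV2 ?posrE ?ler_pM2l ?ler_nat//; first exact: mulr_gt0.
    exact: mulr_gt0.
  apply: ge0_ler_powR => //; rewrite ?nnegrE ?(ltW al0) ?(ltW z0)// invr_ge0.
  by apply: mulr_ge0; rewrite ?ltW.
(* Because [(1 - e) * (1 + e) = 1 - e ^+ 2], a term [e ^+ 2 * ln k] is left over, and by [kp] it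
   outweighs the constants. *)
- rewrite -ler_ln ?posrE ?invr_gt0 ?mulr_gt0 ?expR_gt0// lnM ?posrE ?expR_gt0// expRK lnV ?posrE//.
  have e20 : 0 < e ^+ 2 by rewrite exprn_gt0.
  move: kp; rewrite ler_pdivrMr//.
  have e1' : 0 <= 1 - e by lra.
  have := ler_wpM2l e1' lC; lra.
Unshelve. all: by end_near. Qed.

End FactorialTimes.

(** * Upper bound for the liminf *)

Section LiminfUpper.
Context d (T : measurableType d) (R : realType) (P : probability T R).
Variables (W0 B0 : nat) (pW pB : R) (drawn added : {RV P >-> bool}^nat).
Hypothesis W0_gt0 : (0 < W0)%N.
Hypothesis B0_gt0 : (0 < B0)%N.
Hypothesis pW0 : 0 < pW.
Hypothesis pW1 : pW < 1.
Hypothesis pB0 : 0 < pB.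
Hypothesis pB1 : pB < 1.
Hypothesis urn : play_the_winner_urn W0 B0 pW pB drawn added.
Local Notation word_prob := (word_prob W0 B0 pW pB).
Local Notation sig2 := (limit_var pW pB).
Local Notation dev := (dev W0 pW pB).
Local Notation history := (history drawn added).
Local Notation lyap := (lyap W0 B0 pW pB).
Local Notation alpha := (lyap_exp pW pB).
Hypothesis rho_half : rho pW pB < 2^-1.

(** [Good k] bounds [lyap] at all times up to [n k], so it controls the start of the next block and
    also confinement before [n k]. Almost surely [Good k] holds eventually and [bad k] fails
    infinitely often; at such an index the strip is kept both before and after [n k]. *)
Lemma dev_liminf_upper kd (c : R) : 0 < c -> pi ^+ 2 * sig2 / 8 < c ^+ 2 ->
  {ae P, forall w, forall N, exists n, [/\ (N <= n)%N, 0 < lil_scale R n &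
     forall m, (0 < m <= n)%N -> `|dev kd (history m w)| <= c / lil_scale R n]}.
Proof.
move=> c0 cc.
have c20 : 0 < c ^+ 2 by rewrite exprn_gt0.
have sig0 : 0 < sig2 by apply: limit_var_gt0.
have pi20 : 0 < (pi : R) ^+ 2 by rewrite exprn_gt0// pi_gt0.
have [X XE] : {X : R | X = pi ^+ 2 * sig2 / (8 * c ^+ 2)} by exists (pi ^+ 2 * sig2 / (8 * c ^+ 2)).
have X0 : 0 < X by rewrite XE; apply: divr_gt0; apply: mulr_gt0.
have X1 : X < 1 by rewrite XE invfM mulrA ltr_pdivrMr// mul1r.
(* With [X = 1 - 2 * e], the rate [(1 + e) * X] of [confinement_lower] is [1 - e - 2 * e ^+ 2],
   below the [1 - e] that [fact_time_near] compares with [1 / k.+1]. *)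
have [e eE] : {e : R | e = (1 - X) / 2} by exists ((1 - X) / 2).
have e01 : 0 < e < 1 by rewrite eE; apply/andP; split; lra.
have eX : (1 + e) * X <= 1 - e.
  have : 0 <= (1 - X) * (1 - X) by apply: mulr_ge0; lra.
  rewrite eE; lra.
have [al0 al1 _] := lyap_exp_bounds rho_half.
have lf0 := lyap_frac_gt0 rho_half.
have b0 : 0 < (W0 + B0)%:R :> R by rewrite ltr0n addn_gt0 W0_gt0.
have e0 : 0 < e by case/andP: e01.
have [q [p [s0 [B [q0 p0 s00 low]]]]] :=
  confinement_lower W0_gt0 B0_gt0 pW0 pW1 pB0 pB1 rho_half c0 e0.
rewrite -XE in low.
have [K K0 root] := lyap_exit_root W0_gt0 B0_gt0 pW0 pW1 pB0 pB1 rho_half.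
have [A AE] : {A : nat | A = (Num.truncn (1 + 3 / (1 - alpha))).+1} by eexists.
have A3 : 3 <= (A%:R - 1) * (1 - alpha).
  have : 1 + 3 / (1 - alpha) < A%:R by rewrite AE truncnS_gt.
  rewrite -ltrBrDl ltr_pdivrMr ?subr_gt0//; exact: ltW.
have A0 : (0 < A)%N by rewrite AE.
pose n := fact_time A.
have n_gt0 k : (0 < n k)%N by exact: fact_time_gt0.
have [s1 s1E] : {s1 : R | s1 = Num.min s0 (c / (16 * (W0 + B0)%:R))} by eexists.
have s10 : 0 < s1 by rewrite s1E lt_min s00; apply: divr_gt0 => //; apply: mulr_gt0.
(* The second bound makes [y k] at most [(c / s) ^+ 2 * lyap_frac], so that [lyap_small] applies to
   all times up to [n k]. *)
have [q1 q1E] : {q1 : R | q1 = Num.min q (c ^+ 2 * lyap_frac pW pB)} by eexists.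
have q10 : 0 < q1 by rewrite q1E lt_min q0; apply: mulr_gt0.
have al01 : 0 < alpha < 1 by rewrite al0.
have [k0 _ near] := fact_time_near B al01 A3 p0 q10 s10 e01.
(* By [lyap_exit_root], the factor [k.+1 ^+ 2] makes the probabilities of the failures of [Good]
   summable. *)
pose y k : R := (n k)%:R * k.+1%:R ^+ 2.
have y0 k : 0 < y k by apply: mulr_gt0; rewrite ?exprn_gt0 ?ltr0n.
pose Good k := stay 0 (fun h => lyap h <= y k).
pose conf k := stay (n k) (fun h => `|dev kd h| <= c / lil_scale R (n k.+1)).
have GoodP k h : size h = n k -> Good k h -> lyap h <= y k.
  move=> hn /stayP/(_ (n k)); rewrite hn n_gt0 leqnn => /(_ isT).
  by rewrite -hn past_size.
have conf_prob k (phi : pred word) : (k0 <= k)%N ->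
    k.+1%:R^-1 * word_prob (n k) (fun h => phi h && Good k h) <=
    word_prob (n k.+1) (fun h => (phi (past (n k) h) && Good k (past (n k) h)) && conf k h).
  move=> kk; have [s sE [/andP[s_gt0 ss] [qs _] Bs ys pk]] := near k kk.
  have qq : q1 / s ^+ 2 <= q / s ^+ 2.
    by rewrite ler_pM2r ?invr_gt0 ?exprn_gt0// q1E ge_min lexx.
  have ss0 : 0 < s <= s0 by rewrite s_gt0 (le_trans ss)// s1E ge_min lexx.
  have phiG (h : word) : size h = n k -> phi h && Good k h -> lyap h <= y k.
    by move=> hn /andP[_]; exact: GoodP.
  have := low kd (n k.+1) (n k) s (y k) (fun h => phi h && Good k h) ss0
    (le_trans qs qq) Bs phiG (ltW (y0 k)) (le_trans ys qq).
  rewrite /conf sE; apply: le_trans; rewrite ler_wpM2r ?word_prob_ge0//.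
  apply: (le_trans pk); rewrite ler_pM2l// ler_expR lerN2 -sE ler_wpM2r//.
  by apply: mulr_ge0; rewrite ?sqr_ge0.
pose bad k (h : word) := Good k (past (n k) h) && ~~ conf k h.
have le_n j k : (j <= k)%N -> (n j <= n k)%N by exact: fact_time_homo.
(* Given the past, [bad k] has probability at most [1 - 1 / (k + 1)], and the product
   of these bounds telescopes. *)
have bad_prob M j : (k0 <= M)%N -> (0 < M)%N ->
    word_prob (n (M + j)%N) (fun h => all (fun k => bad k (past (n k.+1) h)) (iota M j))
    <= M%:R / (M + j)%:R.
  move=> kM M0; elim: j => [|j IH].
    by rewrite addn0 divff ?word_prob_le1// gt_eqF// ltr0n.
  pose phi (h : word) := all (fun k => bad k (past (n k.+1) h)) (iota M j).
  have Mj : 0 < (M + j)%:R :> R by rewrite ltr0n addn_gt0 M0.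
  have kMj : (k0 <= M + j)%N by rewrite (leq_trans kM)// leq_addr.
  have step : word_prob (n (M + j.+1)%N)
      (fun h => all (fun k => bad k (past (n k.+1) h)) (iota M j.+1)) <=
    word_prob (n (M + j).+1) (fun h => (phi (past (n (M + j)%N) h) &&
       Good (M + j)%N (past (n (M + j)%N) h)) && ~~ conf (M + j)%N h).
    rewrite addnS; apply: word_prob_le => // h hn.
    rewrite -addn1 iotaD all_cat /= andbT => /andP[/allP allh].
    rewrite -[X in past X h]hn past_size /bad => /andP[-> ->]; rewrite !andbT.
    apply/allP => k kj; have := allh k kj; rewrite past_past//.
      by apply: le_n; move: kj; rewrite mem_iota => /andP[].
    by rewrite hn; apply: le_n.
  apply: (le_trans step); rewrite word_probC//.
  have := conf_prob (M + j)%N phi kMj.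
  rewrite (@word_prob_past _ _ _ _ _ _ _ _ _ _ (n (M + j)%N) _ (fun h => phi h && Good (M + j)%N h))//;
    last exact: le_n.
  have phile : word_prob (n (M + j)%N) (fun h => phi h && Good (M + j)%N h) <= M%:R / (M + j)%:R.
    by apply: (le_trans _ IH); apply: word_prob_le => // h _ /andP[].
  have x0 : 0 <= word_prob (n (M + j)%N) (fun h => phi h && Good (M + j)%N h).
    exact: word_prob_ge0.
  move: (word_prob (n (M + j)%N) (fun h => phi h && Good (M + j)%N h)) phile x0 => x xM x0.
  move: (word_prob (n (M + j).+1) _) => x' xx.
  apply: (@le_trans _ _ ((1 - (M + j).+1%:R^-1) * x)); first by rewrite mulrBl mul1r lerD2l lerN2.
  have u1 : (M + j).+1%:R^-1 <= 1 :> R by rewrite invf_le1// ler1n.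
  apply: (@le_trans _ _ ((1 - (M + j).+1%:R^-1) * (M%:R / (M + j)%:R))).
    by rewrite ler_wpM2l// subr_ge0.
  rewrite addnS -natr1; move: (gt_eqF Mj) => Mn.
  have Mn' : (M + j)%:R + 1 != 0 :> R by rewrite natr1.
  move: (M + j)%:R Mn Mn' => t t0 t1.
  by rewrite le_eqVlt; apply/orP; left; apply/eqP; field; rewrite t1 t0.
have goodE : {ae P, forall w, \forall k \near \oo, ~ ~~ Good k (history (n k) w)}.
  apply: (@borel_cantelli_ae _ _ _ _ (fun k => [set w | ~~ Good k (history (n k) w)])
    (fun k => K * k%:R^-1) 1%N).
  - by move=> k; exact: (measurable_history _ _ _ (fun h => ~~ Good k h)).
  - by move=> k; apply: mulr_ge0; rewrite ?invr_ge0 ?(ltW K0).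
  move=> k k1; have k10 : 0 < k%:R :> R by rewrite ltr0n.
  rewrite (measure_history urn _ (fun h => ~~ Good k h)) lee_fin.
  apply: (le_trans (root (n k) (y k) (n_gt0 k) (y0 k))).
  have nk0 : (n k)%:R != 0 :> R by rewrite gt_eqF// ltr0n.
  have -> : K * (n k)%:R / y k = K / k.+1%:R ^+ 2.
    rewrite /y; have : k.+1%:R != 0 :> R by [].
    move: (n k)%:R k.+1%:R nk0 => a b a1 b1; by field; rewrite a1 b1.
  rewrite -mulrBr ler_pM2l// -[k.+1%:R]natr1.
  have -> : k%:R^-1 - (k%:R + 1)^-1 = (k%:R * (k%:R + 1))^-1 :> R.
    by move: k%:R k10 => t t0; field; rewrite !gt_eqF// addr_gt0.
  rewrite lef_pV2 ?posrE ?exprn_gt0 ?mulr_gt0 ?addr_gt0//.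
  by rewrite expr2 ler_pM2r ?addr_gt0// lerDl.
have confE : {ae P, forall w, forall N, exists2 k, (N <= k)%N & ~ bad k (history (n k.+1) w)}.
  apply: (@ae_infinitely_often _ _ _ _ (fun k => [set w | bad k (history (n k.+1) w)])).
    by move=> k; exact: (measurable_history _ _ _ (bad k)).
  move=> N e' e'0; pose M := maxn N k0.+1.
  have M0 : (0 < M)%N by rewrite leq_max orbT.
  pose j := (Num.truncn (M%:R / e')).+1.
  exists (M + j)%N; first by rewrite (leq_trans (leq_maxl _ _) (leq_addr _ _)).
  pose phi (h : word) := all (fun k => bad k (past (n k.+1) h)) (iota M j).
  apply: (@le_trans _ _ (P [set w | phi (history (n (M + j)%N) w)])).
    apply: le_measure; rewrite ?inE.
    - by apply: bigcap_measurableType => k _; exact: (measurable_history _ _ _ (bad k)).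
    - exact: measurable_history.
    move=> w /= Ew; apply/allP => k; rewrite mem_iota => /andP[Mk kj].
    rewrite past_history; last exact: le_n.
    by apply: (Ew k) => /=; rewrite kj (leq_trans (leq_maxl _ _) Mk).
  rewrite (measure_history urn) lee_fin.
  apply: (le_trans (bad_prob M j _ M0)); first by rewrite ltnW// leq_maxr.
  rewrite ler_pdivrMr ?ltr0n ?addn_gt0 ?M0// natrD mulrDr.
  have : M%:R / e' < j%:R by rewrite truncnS_gt.
  rewrite ltr_pdivrMr// => h.
  by apply: (le_trans (ltW h)); rewrite (mulrC e' j%:R) lerDr mulr_ge0// ltW.
move: goodE confE; apply: filterS2 => w [K1 _ good] often N.
have [k] := often (maxn N (maxn K1 k0)); rewrite !geq_max => /and3P[Nk K1k k0k] nbad.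
have [s sE [/andP[s_gt0 ss] [_ qs] _ _ _]] := near k k0k.
have Gk : Good k (history (n k) w) by apply/negPn/negP; exact: good.
exists (n k.+1); rewrite -sE; split=> //.
  by apply: (leq_trans Nk); apply: (leq_trans (leqnSn k)); exact: fact_time_ge.
move=> m /andP[m0 mn]; have [mk|mk] := leqP m (n k).
  have ly : lyap (history m w) <= y k.
    by apply: (elimT (stay_history _ _ (fun h => lyap h <= y k) w (leq0n (n k))) Gk m); rewrite m0.
  have a0 : 0 < c / s by apply: divr_gt0.
  have ba : 16 * (W0 + B0)%:R <= c / s.
    have : s <= c / (16 * (W0 + B0)%:R) by apply: (le_trans ss); rewrite s1E ge_min lexx orbT.
    by rewrite !ler_pdivlMr ?mulr_gt0// mulrC.
  have ly' : lyap (history m w) <= (c / s) ^+ 2 * lyap_frac pW pB.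
    apply: (le_trans ly); apply: (le_trans qs).
    rewrite expr_div_n mulrAC ler_pM2r ?invr_gt0 ?exprn_gt0//.
    by rewrite q1E ge_min lexx orbT.
  have [H _] := lyap_small pW0 pW1 pB0 pB1 rho_half a0 ba ly'.
  by apply: (le_trans (H kd)); lra.
have : conf k (history (n k.+1) w).
  by apply/negPn/negP => nc; apply: nbad; rewrite /bad past_history ?Gk ?le_n.
move=> /(elimT (stay_history _ _ _ _ (le_n _ _ (leqnSn k))))/(_ m); rewrite mk mn sE; exact.
Qed.

End LiminfUpper.

(** * From confinement to the value of the liminf *)

Section LiminfSup.
Context d (T : measurableType d) (R : realType) (P : probability T R).
Variables (W0 B0 : nat) (pW pB : R) (drawn added : {RV P >-> bool}^nat).
Hypothesis W0_gt0 : (0 < W0)%N.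
Hypothesis B0_gt0 : (0 < B0)%N.
Hypothesis pW0 : 0 < pW.
Hypothesis pW1 : pW < 1.
Hypothesis pB0 : 0 < pB.
Hypothesis pB1 : pB < 1.
Hypothesis urn : play_the_winner_urn W0 B0 pW pB drawn added.
Local Notation sig2 := (limit_var pW pB).
Local Notation dev := (dev W0 pW pB).
Local Notation history := (history drawn added).
Local Notation v := (limit_frac pW pB).
Hypothesis rho_half : rho pW pB < 2^-1.

Lemma count_history (p : bool * bool -> bool) (x : nat -> T -> bool) m w :
  (forall k, p (drawn k w, added k w) = x k w) ->
  count p (history m w) = white_count (x ^~ w) m.
Proof.
move=> px; elim: m => [|m IH]; rewrite /white_count; first by rewrite big_ord0.
by rewrite big_ord_recr /= IH px addnC.
Qed.

Lemma devY_history m w : (urn_Y W0 added m w)%:R - m%:R * v = dev false (history m w).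
Proof.
by rewrite /= /devY /whites size_history (@count_history _ (fun k w => added k w)).
Qed.

Lemma devN_history m w : (urn_N drawn m w)%:R - m%:R * v = dev true (history m w).
Proof.
by rewrite /= /devN size_history (@count_history _ (fun k w => drawn k w)).
Qed.

Lemma limn_einf_sup_dev kd (u : nat -> T -> nat) (c : R) :
  (forall m w, (u m w)%:R - m%:R * v = dev kd (history m w)) ->
  0 < c -> c ^+ 2 = pi ^+ 2 * sig2 / 8 ->
  {ae P, forall w, limn_einf (fun n => (lil_scale R n * sup_dev (u ^~ w) v n)%:E) = c%:E}.
Proof.
move=> uE c0 c2E.
have inv0 j : 0 < j.+1%:R^-1 :> R by rewrite invr_gt0 ltr0n.
have up_ae : {ae P, forall w, forall j N, exists2 n, (N <= n)%N &
    lil_scale R n * sup_dev (u ^~ w) v n <= c + j.+1%:R^-1}.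
  apply/ae_foralln => j; have cj0 : 0 < c + j.+1%:R^-1 by rewrite addr_gt0.
  have cj : pi ^+ 2 * sig2 / 8 < (c + j.+1%:R^-1) ^+ 2.
    by rewrite -c2E ltr_pXn2r ?nnegrE ?(ltW c0) ?(ltW cj0)// ltrDl.
  have := dev_liminf_upper W0_gt0 B0_gt0 pW0 pW1 pB0 pB1 urn rho_half kd cj0 cj.
  apply: filterS => w H N; have [n [Nn s0 sup]] := H N; exists n => //.
  rewrite mulrC -ler_pdivlMr// /sup_dev big_seq; apply: bigmax_le.
    by rewrite divr_ge0 ?(ltW cj0) ?(ltW s0).
  by move=> m; rewrite mem_index_iota ltnS uE => /sup.
have lo_ae : {ae P, forall w, forall j, \forall n \near \oo,
    c - j.+1%:R^-1 <= lil_scale R n * sup_dev (u ^~ w) v n}.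
  apply/ae_foralln => j; have [cj0|cj0] := leP (c - j.+1%:R^-1) 0.
    apply: nearW => w; apply: nearW => n; apply: (le_trans cj0).
    by apply: mulr_ge0; [exact: sqrtr_ge0|exact: bigmax_ge_id].
  have cj : (c - j.+1%:R^-1) ^+ 2 < pi ^+ 2 * sig2 / 8.
    by rewrite -c2E ltr_pXn2r ?nnegrE ?(ltW c0) ?(ltW cj0)// gtrBl.
  have := dev_liminf_lower W0_gt0 pW0 pW1 pB0 pB1 urn kd cj0 cj.
  apply: filterS => w; apply: filterS => n [m mn h].
  apply: (le_trans (ltW h)); apply: ler_wpM2l; first exact: sqrtr_ge0.
  by rewrite -uE; apply: (@bigmax_sup_seq _ _ _ _ _ m); rewrite ?mem_index_iota.
move: lo_ae up_ae; apply: filterS2 => w lo up; exact: limn_einf_eq.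
Qed.

End LiminfSup.

Theorem mainTheorem6 (R : realType) (d : measure_display)
    (T : measurableType d) (P : probability T R)
    (W0 B0 : nat) (pW pB : R) (drawn added : {RV P >-> bool}^nat)
    (W0_gt0 : (0 < W0)%N) (B0_gt0 : (0 < B0)%N)
    (pW01 : 0 < pW < 1) (pB01 : 0 < pB < 1)
    (urn : play_the_winner_urn W0 B0 pW pB drawn added)
    (rho_lt : pW + pB - 1 < 2^-1) :
  let qW := 1 - pW in
  let qB := 1 - pB in
  let v := qB / (qW + qB) in
  let sigma1 := Num.sqrt (qW * qB) / (qW + qB) in
  {ae P, forall w : T,
    limn_einf (fun n : nat =>
      (Num.sqrt (ln (ln n%:R) / n%:R)
         * sup_dev (fun m => urn_Y W0 added m w) v n)%:E)
      = (sigma1 * pi / Num.sqrt 8)%:E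
    /\
    limn_einf (fun n : nat =>
      (Num.sqrt (ln (ln n%:R) / n%:R)
         * sup_dev (fun m => urn_N drawn m w) v n)%:E)
      = (sigma1 * pi / Num.sqrt 8)%:E}.
Proof.
move=> qW qB v sigma1.
have /andP[pW0 pW1] := pW01; have /andP[pB0 pB1] := pB01.
have qW0 : 0 < qW by rewrite subr_gt0.
have qB0 : 0 < qB by rewrite subr_gt0.
have q0 : 0 < qW + qB by exact: addr_gt0.
have vE : v = limit_frac pW pB by rewrite limit_fracE.
have s0 : 0 < sigma1 * pi / Num.sqrt 8.
  by rewrite !(mulr_gt0, divr_gt0) ?invr_gt0 ?sqrtr_gt0 ?pi_gt0// mulr_gt0.
have frac_var (a b p : R) : 0 < a + b ->
    a * b * (a + b) ^- 2 * p ^+ 2 / 8 = p ^+ 2 * (b / (a + b) * (1 - b / (a + b))) / 8.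
  by move=> ab0; field; rewrite gt_eqF.
have s2 : (sigma1 * pi / Num.sqrt 8) ^+ 2 = pi ^+ 2 * limit_var pW pB / 8.
  rewrite limit_varE -vE /v /sigma1 !exprMn !exprVn !sqr_sqrtr ?mulr_ge0 ?(ltW qW0) ?(ltW qB0)//.
  exact: frac_var.
have := limn_einf_sup_dev W0_gt0 B0_gt0 pW0 pW1 pB0 pB1 urn rho_lt
  (@devN_history _ _ _ _ W0 pW pB drawn added) s0 s2.
have := limn_einf_sup_dev W0_gt0 B0_gt0 pW0 pW1 pB0 pB1 urn rho_lt
  (@devY_history _ _ _ _ W0 pW pB drawn added) s0 s2.
by rewrite -vE; apply: filterS2 => w.
Qed.
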